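(* Let $N\ge 1$ be an integer, $0<\theta\le 2$, $p>1$, $0<\gamma<\min\{\theta,N\}$, and, if $0<\theta<2$, assume in addition $\gamma<\theta(p-1)$. Then there exists a constant $C_1>0$ depending only on $N,\theta,p,\gamma$ with the following property. Let $0<T<\infty$, let $\mu$ be a nonnegative Radon measure on $\mathbb{R}^N$, and suppose that $u$ is a solution in $\mathbb{R}^N\times[0,T)$ (in the sense defined in the context) of $$\partial_t u+(-\Delta)^{\theta/2}u=|x|^{-\gamma}u^p,\quad x\in\mathbb{R}^N,\ t>0,\qquad u(0)=\mu\ \text{ in }\mathbb{R}^N .$$ Then $$\sup_{z\in\mathbb{R}^N}\left(\frac{1}{|B(z,\sigma)|}\int_{B(z,\sigma)}|x|^{\frac{\gamma}{p-1}}\,dx\right)^{-1}\mu(B(z,\sigma))\le C_1\,\sigma^{N-\frac{\theta}{p-1}}\qquad\text{for all }0<\sigma<T^{1/\theta}.$$ In particular, in the case $p=p_\gamma:=1+\frac{\theta-\gamma}{N}$, there exists a constant $C_1'>0$ depending only on $N,\theta,\gamma$ such that, for every such $T$, $\mu$, $u$, $$\mu(B(0,\sigma))\le C_1'\left[\log\left(e+\frac{T^{1/\theta}}{\sigma}\right)\right]^{-\frac{N}{\theta-\gamma}}\qquad\text{for all }0<\sigma<T^{1/\theta}.$$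
   Context: $B(x,r)=\{y\in\mathbb{R}^N:|x-y|<r\}$ and $|B(x,r)|$ is its Lebesgue measure. $(-\Delta)^{\theta/2}$ is the fractional power of $-\Delta$ in $\mathbb{R}^N$. $G=G(x,t)$ denotes the fundamental solution (heat kernel) of $\partial_t v+(-\Delta)^{\theta/2}v=0$ in $\mathbb{R}^N\times(0,\infty)$, i.e. $G(x,t)=(2\pi)^{-N}\int_{\mathbb{R}^N}e^{ix\cdot\xi-t|\xi|^\theta}\,d\xi$. Definition of solution: for $0<T\le\infty$, a nonnegative measurable function $u$ on $\mathbb{R}^N\times(0,T)$ is a solution of the Cauchy problem in $\mathbb{R}^N\times[0,T)$ if $$\infty>u(x,t)=\int_{\mathbb{R}^N}G(x-y,t)\,d\mu(y)+\int_0^t\int_{\mathbb{R}^N}G(x-y,t-s)|y|^{-\gamma}u(y,s)^p\,dy\,ds$$ for almost all $x\in\mathbb{R}^N$ and $0<t<T$. *)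

(* Defs.v *)
From HB Require Import structures.
From mathcomp Require Import all_boot all_order all_algebra.
From mathcomp Require Import complex.
From mathcomp Require Import all_classical all_reals all_analysis.
From mathcomp Require Import measurable_realfun.

Set Implicit Arguments.
Unset Strict Implicit.
Unset Printing Implicit Defensive.

Import Order.TTheory GRing.Theory Num.Theory.
Import numFieldNormedType.Exports.

Local Open Scope classical_set_scope.
Local Open Scope ring_scope.

(* R^N is [N.-tuple R], whose library sigma-algebra is the one generated by the
   coordinates, that is, the Borel sigma-algebra of R^N. *)

Section euclidean_space.
Context {R : realType} {N : nat}.
Implicit Types x y z : N.-tuple R.

Definition vsub x y : N.-tuple R := [tuple tnth x i - tnth y i | i < N].

Definition vzero : N.-tuple R := [tuple 0 | i < N].

Definition dot x y : R := \sum_(i < N) tnth x i * tnth y i.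

Definition enorm x : R := Num.sqrt (\sum_(i < N) tnth x i ^+ 2).

Definition eball z (r : R) : set (N.-tuple R) := [set y | enorm (vsub z y) < r].

(* The library has a topology on row vectors but none on tuples. *)
Definition tuple_compact (K : set (N.-tuple R)) : Prop :=
  compact [set (\row_(i < N) tnth x i : 'rV[R]_N) | x in K].

(* A Borel measure on R^N that is finite on compact sets is automatically
   inner and outer regular. *)
Definition radon_measure (mu : {measure set (N.-tuple R) -> \bar R}) : Prop :=
  forall K, tuple_compact K -> (mu K < +oo)%E.

End euclidean_space.

Section lebesgue_measure_step.
Local Open Scope ereal_scope.
Context {R : realType} (N : nat).

Definition cons_pair (z : measurableTypeR R * N.-tuple R) : N.+1.-tuple R :=
  [tuple of z.1 :: z.2].

Lemma measurable_cons_pair : measurable_fun setT cons_pair.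
Proof.
apply: (@measurable_cons _ _ (measurableTypeR R * N.-tuple R)%type R fst N snd);
  by [exact: measurable_fst|exact: measurable_snd].
Qed.

Variable m : {sigma_finite_measure set (N.-tuple R) -> \bar R}.

Definition lebesgue_step : set (N.+1.-tuple R) -> \bar R :=
  pushforward (@lebesgue_measure R \x m) cons_pair.

Let mcons_pair : measurable_fun setT cons_pair := measurable_cons_pair.

Let step0 : lebesgue_step set0 = 0.
Proof. exact: measure0. Qed.

Let step_ge0 A : 0 <= lebesgue_step A.
Proof. exact: measure_ge0. Qed.

Let step_sigma_additive : semi_sigma_additive lebesgue_step.
Proof. exact: measure_semi_sigma_additive. Qed.

HB.instance Definition _ := isMeasure.Build _ _ _ lebesgue_step
  step0 step_ge0 step_sigma_additive.

Let step_sigma_finite : sigma_finite setT lebesgue_step.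
Proof.
pose uncons (t : N.+1.-tuple R) : measurableTypeR R * N.-tuple R :=
  (thead t, [tuple of behead t]).
have unconsK : cancel cons_pair uncons.
  by move=> [x y]; rewrite /uncons theadE; congr (_, _); exact/val_inj.
have muncons : measurable_fun setT uncons.
  apply: measurable_fun_pair; last exact: measurable_behead.
  exact: (@measurable_tnth _ R N.+1 ord0).
have /sigma_finiteP[F [FT ndF Foo]] := sigma_finiteT (@lebesgue_measure R).
have /sigma_finiteP[G [GT ndG Goo]] := sigma_finiteT m.
exists (fun i => uncons @^-1` (F i `*` G i)).
  rewrite -preimage_bigcup; apply/esym/seteqP; split => // t _ /=.
  have : (\bigcup_i F i) (thead t) by rewrite -FT.
  have : (\bigcup_i G i) [tuple of behead t] by rewrite -GT.
  move=> [j _ Gj] [k _ Fk]; exists (maxn k j) => //; split => /=.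
    by move: Fk; exact/subsetPset/ndF/leq_maxl.
  by move: Gj; exact/subsetPset/ndG/leq_maxr.
move=> i; have [? ?] := Foo i; have [? ?] := Goo i; split.
  by rewrite -[X in measurable X]setTI; apply: muncons => //; exact: measurableX.
rewrite /lebesgue_step /pushforward -comp_preimage.
rewrite (_ : uncons \o cons_pair = id); last first.
  by apply/funext => z; exact: unconsK.
by rewrite preimage_id product_measure1E// lte_mul_pinfty// ge0_fin_numE.
Qed.

HB.instance Definition _ := Measure_isSigmaFinite.Build _ _ _ lebesgue_step
  step_sigma_finite.

End lebesgue_measure_step.

(* Lebesgue measure on R^N: R^0 is a point of mass 1, and the measure on
   R^(N+1) is the image under [cons] of the product of the Lebesgue measures on
   R and R^N. *)
Fixpoint lebesgueN (R : realType) (N : nat) :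
    {sigma_finite_measure set (N.-tuple R) -> \bar R} :=
  match N with
  | 0%N => @dirac _ (0.-tuple R) [tuple] R
  | N'.+1 => lebesgue_step (lebesgueN R N')
  end.

Lemma lebesgueN_box (R : realType) (N : nat) (A : 'I_N -> set R) :
  (forall i, measurable (A i)) ->
  (lebesgueN R N [set x | forall i, A i (tnth x i)] =
   \prod_(i < N) @lebesgue_measure R (A i))%E.
Proof.
have mbox n (B : 'I_n -> set R) : (forall i, measurable (B i)) ->
    measurable [set x : n.-tuple R | forall i, B i (tnth x i)].
  move=> mB; rewrite (_ : mkset _ =
      \bigcap_(i in [set: 'I_n]) ((fun x : n.-tuple R => tnth x i) @^-1` B i)).
    apply: fin_bigcap_measurable => // i _; rewrite -[X in measurable X]setTI.
    exact: measurable_tnth.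
  by apply/seteqP; split => x /= Bx i => [_|]; exact: Bx.
elim: N A => [|N IH] A mA.
  by rewrite big_ord0 /= diracE mem_set//= => -[].
rewrite big_ord_recl -IH//= /lebesgue_step /pushforward.
have mA' i : measurable (A (lift ord0 i)) by exact: mA.
apply: etrans (@product_measure1E _ _ (measurableTypeR R) (N.-tuple R) R
  (@lebesgue_measure R) (lebesgueN R N) _ _ (mA ord0) (mbox N _ mA')).
congr (product_measure1 _ _ _); apply/seteqP; split => -[x t] /=.
  move=> Axt; split; first exact: (Axt ord0).
  by move=> i; have := Axt (lift ord0 i); rewrite tnthS.
move=> [A0 At] i; case: (unliftP ord0 i) => [j ->|->]//.
by rewrite tnthS.
Qed.

Section heat_kernel.
Context {R : realType}.
Local Open Scope complex_scope.

Definition cexp (z : R[i]) : R[i] :=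
  (expR (complex.Re z))%:C * (cos (complex.Im z) +i* sin (complex.Im z)).

Definition cintegral d (T : measurableType d) (mu : {measure set T -> \bar R})
    (f : T -> R[i]) : R[i] :=
  (\int[mu]_x complex.Re (f x)) +i* (\int[mu]_x complex.Im (f x)).

(* The integrand is conjugated by xi |-> - xi, so the integral is real and
   taking the real part only changes its type. *)
Definition heat_kernel (N : nat) (theta : R) (x : N.-tuple R) (t : R) : R :=
  (2 * pi) ^- N *
  complex.Re (cintegral (lebesgueN R N) (fun xi =>
    cexp ('i * (dot x xi)%:C - (t * enorm xi `^ theta)%:C))).

Lemma heat_kernelE (N : nat) (theta : R) (x : N.-tuple R) (t : R) :
  heat_kernel theta x t = (2 * pi) ^- N *
    \int[lebesgueN R N]_xi (expR (- (t * enorm xi `^ theta)) * cos (dot x xi)).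
Proof.
rewrite /heat_kernel; congr (_ * _); apply: eq_Rintegral => xi _.
by rewrite /cexp /=; simpc; rewrite /= ?(mul0r, mul1r, subr0, add0r, addr0).
Qed.

End heat_kernel.

Section cauchy_problem.
Context {R : realType}.
Local Open Scope ereal_scope.

(* Measurability with respect to the completion of [mu]; for a Lebesgue measure
   this is Lebesgue measurability.  The library integral of a nonnegative
   function is a supremum over simple functions below it, so it agrees with the
   integral for the completed measure on such functions. *)
Definition completed_measurable_fun d d' (T : measurableType d)
    (U : measurableType d') (mu : set T -> \bar R) (D : set T)
    (f : T -> U) : Prop :=
  forall Y, measurable Y -> completed_algebra_gen mu (D `&` f @^-1` Y).

Definition spacetime (N : nat) (T : R) : set (N.-tuple R * measurableTypeR R)%type :=
  [set z | (0 < z.2 < T)%R].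

Definition spacetime_measure (N : nat) :
    set (N.-tuple R * measurableTypeR R) -> \bar R :=
  lebesgueN R N \x @lebesgue_measure R.

Definition duhamel (N : nat) (theta gamma p : R)
    (mu : {measure set (N.-tuple R) -> \bar R})
    (u : N.-tuple R * measurableTypeR R -> \bar R)
    (x : N.-tuple R) (t : R) : \bar R :=
  \int[mu]_y (heat_kernel theta (vsub x y) t)%:E +
  \int[lebesgue_measure]_(s in `]0%R, t[) \int[lebesgueN R N]_y
    ((heat_kernel theta (vsub x y) (t - s))%:E *
     ((enorm y `^ (- gamma))%:E * u (y, s) `^ p)).

Definition weight_average (N : nat) (a : R) (z : N.-tuple R) (r : R) : R :=
  ((\int[lebesgueN R N]_(x in eball z r) (enorm x `^ a)) /
   fine (lebesgueN R N (eball z r)))%R.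

(* The integral equation holds for almost every (x, t); this is implied by its
   holding, for each t, for almost every x. *)
Definition is_solution (N : nat) (theta gamma p T : R)
    (mu : {measure set (N.-tuple R) -> \bar R})
    (u : N.-tuple R * measurableTypeR R -> \bar R) : Prop :=
  [/\ completed_measurable_fun (@spacetime_measure N) (spacetime T) u,
      (forall z, spacetime T z -> 0 <= u z) &
      {ae @spacetime_measure N, forall z, spacetime T z ->
        u z < +oo /\ u z = duhamel theta gamma p mu u z.1 z.2}].

End cauchy_problem.

(* Main.v *)
Require Import Defs.
From HB Require Import structures.
From mathcomp Require Import all_boot all_order all_algebra.
From mathcomp Require Import all_classical all_reals all_analysis.
From mathcomp Require Import measurable_realfun.
From mathcomp Require Import lra ring.

Set Implicit Arguments.
Unset Strict Implicit.
Unset Printing Implicit Defensive.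

Import Order.TTheory GRing.Theory Num.Theory.
Import numFieldNormedType.Exports.

Local Open Scope classical_set_scope.
Local Open Scope ring_scope.

(* Kernel.  Since [l `^ s] with [s < 1] is a mixture of the functions
   [1 - expR (- (r * l))], [expR (- (t * |xi| `^ theta))] is a limit of positive
   combinations of Gaussians, so the heat kernel is nonnegative; damping with
   Gaussians gives its Fourier transform, hence mass 1 and the semigroup
   identity, and scaling gives the pointwise lower bound and the moment bound.

   Decay.  Write [k = |y| `^ (- gamma) * u `^ p] and, for fixed [z] and [A], let
   [F s] be the integral of G (z - y, A) against [mu] plus the integral of
   G (z - y, A - r) k (y, r) over [r < s].  By the semigroup identity [F s] is at
   most the integral of G (z - x, A - s) u (x, s), and Young's inequality
   [u <= L * |x| `^ a + L `^ (1 - p) * k], a = gamma / (p - 1), optimised in [L],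
   turns this into [F' >= kappa * F `^ p] with
   [kappa ~ (|z| + A `^ theta^-1) `^ (- gamma)].  As [F] is finite up to time [A],
   [F (A / 2)] cannot exceed [C * (kappa * A) `^ (- (p - 1)^-1)].  Averaging over [z]
   near a ball of radius [sigma ~ A `^ theta^-1] gives the first claim.

   Logarithm.  For critical [p], let [E tau] be the mass of the small ball plus
   the integral of [k] over the parabolic region |y| <= eta r^(1/theta),
   t0 < r < tau, with [t0 ~ sigma `^ theta].  The decay bound gives [E <= C], while
   u >= c t^(-N/theta) E (t / 2) in that region gives
   E (4 tau) >= E tau + c E(tau)^p.  There are about log (T / t0) such steps. *)

(** For [theta < 2] the restriction on [gamma] says [a < theta], so that |y|^a is integrable against
    a kernel with tail |y|^(-N - theta); at [theta = 2] all moments are finite. The average of |x|^a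
    over B(z, sigma) is of order (|z| + sigma)^a, the power in the decay bound; this is how the
    average in the theorem arises.

    As [u] is only Lebesgue measurable and the equation holds almost everywhere, [u] is replaced by
    a Borel [w <= u], equal to it almost everywhere. The source then decreases, and the equation
    becomes an inequality. [F] is monotone but need not be differentiable, so the differential
    inequality is kept in the form F t >= F s + (t - s) * kappa * (F s)^p, and blow-up is detected
    by summing doubling times. Finiteness is known only at almost every point of almost every time
    slice, so times are picked in intervals and points in cubes.

    At critical [p] the powers of time in the decay bound cancel, which bounds [E] uniformly, while
    [E] grows at rate at least of order E^p / r. The integral of 1 / r over a block of fixed ratio
    is scale-free, so every step gains the same amount. *)

Section measurable_euclidean.
Context (R : realType).

Lemma measurable_cos : measurable_fun setT (@cos R).
Proof. by apply: continuous_measurable_fun => x; exact: continuous_cos. Qed.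

Lemma measurable_sin : measurable_fun setT (@sin R).
Proof. by apply: continuous_measurable_fun => x; exact: continuous_sin. Qed.

(** Inversion is discontinuous at 0; measurability is inherited from the power of exponent -1, sign
    by sign. *)
Lemma measurable_invr : measurable_fun setT (@GRing.inv R).
Proof.
have -> : @GRing.inv R =
    fun x => if x < 0 then - (- x) `^ (- 1) else x `^ (- 1).
  apply/funext => x; case: ltP => x0; rewrite powR_inv1 ?oppr_ge0 ?(ltW x0)//.
  by rewrite invrN opprK.
apply: measurable_fun_ifT.
- by apply: measurable_fun_ltr; [exact: measurable_id|exact: measurable_cst].
- apply: measurable_funN; apply: (measurableT_comp (measurable_powR _)).
  by apply: measurable_funN; exact: measurable_id.
- exact: measurable_powR.
Qed.

Context d (T : measurableType d) (N : nat).
Implicit Types f g : T -> N.-tuple R.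

Lemma measurable_tnth_comp f i : measurable_fun setT f ->
  measurable_fun setT (fun x => tnth (f x) i).
Proof. by move=> /measurable_fun_tnthP/(_ i). Qed.

Lemma measurable_dot f g : measurable_fun setT f -> measurable_fun setT g ->
  measurable_fun setT (fun x => dot (f x) (g x)).
Proof.
move=> mf mg; rewrite /dot; apply: measurable_sum => i.
by apply: measurable_funM; exact: measurable_tnth_comp.
Qed.

Lemma measurable_enorm f : measurable_fun setT f ->
  measurable_fun setT (fun x => enorm (f x)).
Proof.
move=> mf; rewrite /enorm; apply: (@measurableT_comp _ _ _ _ _ _ (@Num.sqrt R)).
  by apply: continuous_measurable_fun => x; exact: sqrt_continuous.
by apply: measurable_sum => i; apply: measurable_funX; exact: measurable_tnth_comp.
Qed.

Lemma measurable_vsub f g : measurable_fun setT f -> measurable_fun setT g ->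
  measurable_fun setT (fun x => vsub (f x) (g x)).
Proof.
move=> mf mg; apply/measurable_fun_tnthP => i.
rewrite (_ : _ \o _ = fun x => tnth (f x) i - tnth (g x) i).
  by apply: measurable_funB; exact: measurable_tnth_comp.
by apply/funext => x /=; rewrite tnth_mktuple.
Qed.

End measurable_euclidean.

(* Redefined below, as lemmas about further functions become available. *)
Ltac measurability_hook := fail.

Ltac measurability_step :=
  lazymatch goal with
  | |- measurable_fun _ (fun _ => ?c) => solve [exact: measurable_cst | apply: measurable_cst | done]
  | |- measurable_fun _ (fun x => x) => exact: measurable_id
  | |- measurable_fun _ id => exact: measurable_id
  | |- measurable_fun _ (fun x => @?f x + @?g x)%R =>
      refine (@measurable_funD _ _ _ _ f g _ _)
  | |- measurable_fun _ (fun x => @?f x * @?g x)%R =>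
      refine (@measurable_funM _ _ _ _ f g _ _)
  | |- measurable_fun _ (fun x => - @?f x)%R =>
      refine (@measurable_funN _ _ _ _ f _)
  | |- measurable_fun _ (fun x => @?f x ^+ ?n)%R =>
      refine (@measurable_funX _ _ _ _ f n _)
  | |- measurable_fun _ (fun x => (@?f x)^-1)%R =>
      refine (measurableT_comp (@measurable_invr _) (_ : measurable_fun _ f))
  | |- measurable_fun _ (fun x => `|@?f x|)%R =>
      refine (measurableT_comp (@normr_measurable _ _) (_ : measurable_fun _ f))
  | |- measurable_fun _ (fun x => expR (@?f x)) =>
      refine (measurableT_comp (@measurable_expR _) (_ : measurable_fun _ f))
  | |- measurable_fun _ (fun x => cos (@?f x)) =>
      refine (measurableT_comp (@measurable_cos _) (_ : measurable_fun _ f))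
  | |- measurable_fun _ (fun x => sin (@?f x)) =>
      refine (measurableT_comp (@measurable_sin _) (_ : measurable_fun _ f))
  | |- measurable_fun _ (fun x => (@?f x) `^ ?r) =>
      refine (measurableT_comp (@measurable_powR _ r) (_ : measurable_fun _ f))
  | |- measurable_fun _ (fun x => dot (@?f x) (@?g x)) =>
      refine (@measurable_dot _ _ _ _ f g _ _)
  | |- measurable_fun _ (fun x => vsub (@?f x) (@?g x)) =>
      refine (@measurable_vsub _ _ _ _ f g _ _)
  | |- measurable_fun _ (fun x => enorm (@?f x)) =>
      refine (@measurable_enorm _ _ _ _ f _)
  | |- measurable_fun _ (fun x => tnth (@?f x) ?i) =>
      refine (@measurable_tnth_comp _ _ _ _ f i _)
  | |- measurable_fun _ (fun x => (@?f x, @?g x)) =>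
      refine (@measurable_fun_pair _ _ _ _ _ _ f g _ _)
  | |- measurable_fun _ (fun x => fst (@?f x)) =>
      refine (measurableT_comp (@measurable_fst _ _ _ _) (_ : measurable_fun _ f))
  | |- measurable_fun _ (fun x => snd (@?f x)) =>
      refine (measurableT_comp (@measurable_snd _ _ _ _) (_ : measurable_fun _ f))
  | |- measurable_fun _ (fun x => (@?f x)%:E) =>
      refine (iffRL (@measurable_EFinP _ _ _ _ f) _)
  | |- measurable_fun _ (EFin \o ?f) =>
      refine (iffRL (@measurable_EFinP _ _ _ _ f) _)
  | |- measurable_fun _ (fun x => `|@?f x|%E) =>
      refine (measurableT_comp (@abse_measurable _ _) (_ : measurable_fun _ f))
  | |- measurable_fun _ (fun x => (@?f x * @?g x)%E) =>
      refine (@emeasurable_funM _ _ _ _ f g _ _)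
  | |- measurable_fun _ (fun x => (@?f x + @?g x)%E) =>
      refine (@emeasurable_funD _ _ _ _ f g _ _)
  | H : measurable_fun setT ?f |- measurable_fun _ (fun x => ?f (@?g x)) =>
      lazymatch g with
      | (fun x => x) => exact H
      | _ => refine (measurableT_comp H (_ : measurable_fun _ g))
      end
  | |- measurable_fun _ (fun x => _) => fail
  | |- measurable_fun _ _ => assumption
  end.

Ltac measurability := do 3 (repeat first [measurability_hook | measurability_step]).


(** * Dominated convergence, Fubini and substitution for real-valued integrals *)

Section integral_complements.
Context d (T : measurableType d) (R : realType).
Implicit Types (mu : {measure set T -> \bar R}) (f g : T -> R).

Lemma dominated_integrable mu f g : measurable_fun setT f ->
  (forall x, `|f x| <= g x) -> mu.-integrable setT (EFin \o g) ->
  mu.-integrable setT (EFin \o f).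
Proof.
move=> mf fg; apply: le_integrable => //; first exact/measurable_EFinP.
by move=> x _ /=; rewrite lee_fin (le_trans (fg x))// ler_norm.
Qed.

Lemma dominated_cvg_Rintegral mu (f_ : nat -> T -> R) f g :
  (forall n, measurable_fun setT (f_ n)) -> measurable_fun setT f ->
  (forall x, f_ n x @[n --> \oo] --> f x) ->
  (forall n x, `|f_ n x| <= g x) -> mu.-integrable setT (EFin \o g) ->
  \int[mu]_x f_ n x @[n --> \oo] --> \int[mu]_x f x.
Proof.
move=> mf_ mf ff fg ig.
have [] := @dominated_convergence _ _ _ mu setT measurableT
    (fun n => EFin \o f_ n) (EFin \o f) (EFin \o g).
- by move=> n; exact/measurable_EFinP.
- exact/measurable_EFinP.
- by apply: aeW => x _; apply: cvg_EFin; [exact: nearW|exact: ff].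
- exact: ig.
- by apply: aeW => x n _ /=; rewrite lee_fin.
move=> intf _ /= h; rewrite /Rintegral; apply: fine_cvg.
by rewrite fineK//; exact: integrable_fin_num.
Qed.

(* The library version assumes the functions to be measurable. *)
Lemma ge0_le_integral_nomeas mu D (f g : T -> \bar R) :
  (forall x, D x -> 0 <= f x)%E -> (forall x, D x -> f x <= g x)%E ->
  (\int[mu]_(x in D) f x <= \int[mu]_(x in D) g x)%E.
Proof.
move=> f0 fg; rewrite integral_mkcond [leRHS]integral_mkcond.
have pf x : (0 <= (f \_ D) x)%E.
  by rewrite patchE; case: ifPn => // xD; apply: f0; exact/set_mem.
have pfg x : ((f \_ D) x <= (g \_ D) x)%E.
  by rewrite !patchE; case: ifPn => // xD; apply: fg; exact/set_mem.
rewrite !ge0_integralTE//; last by move=> x; exact: le_trans (pfg x).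
apply: le_ereal_sup => _ [h hf <-]; exists h => // x.
exact: le_trans (pfg x).
Qed.

Lemma Rintegral_sum mu (I : Type) (s : seq I) (F : I -> T -> R) :
  (forall i, mu.-integrable setT (EFin \o F i)) ->
  mu.-integrable setT (EFin \o (fun x => \sum_(i <- s) F i x)) /\
  \int[mu]_x (\sum_(i <- s) F i x) = \sum_(i <- s) \int[mu]_x F i x.
Proof.
move=> iF; elim: s => [|i s [IH1 IH2]].
  split.
    rewrite (_ : EFin \o _ = cst 0%E); first exact: integrable0.
    by apply/funext => x /=; rewrite big_nil.
  rewrite big_nil (_ : (fun x => _) = cst 0); first by rewrite Rintegral_cst// mul0r.
  by apply/funext => x; rewrite big_nil.
have E : (fun x => \sum_(j <- i :: s) F j x) =
    (fun x => F i x + \sum_(j <- s) F j x) by apply/funext => x; rewrite big_cons.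
split.
  rewrite E (_ : EFin \o _ = (EFin \o F i) \+ (EFin \o (fun x => \sum_(j <- s) F j x)))//.
  exact: integrableD.
by rewrite E big_cons -IH2 RintegralD.
Qed.

End integral_complements.

Section fubini_complements.
Context d1 d2 (T1 : measurableType d1) (T2 : measurableType d2) (R : realType).
Variables (m1 : {sigma_finite_measure set T1 -> \bar R})
  (m2 : {sigma_finite_measure set T2 -> \bar R}).

(** Domination by a product [g x * h y] is the form in which exchanges of signed integrals are
    justified below. *)
Lemma integrable_prod (f : T1 * T2 -> R) (g : T1 -> R) (h : T2 -> R) :
  measurable_fun setT f -> (forall x y, `|f (x, y)| <= g x * h y) ->
  m1.-integrable setT (EFin \o g) -> m2.-integrable setT (EFin \o h) ->
  (m1 \x m2)%E.-integrable setT (EFin \o f).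
Proof.
move=> mf fgh ig ih; apply/integrable12ltyP; first exact/measurable_EFinP.
have mg : measurable_fun setT g by exact/measurable_EFinP/(measurable_int m1).
have mh : measurable_fun setT h by exact/measurable_EFinP/(measurable_int m2).
have ing := integrable_norm ig; have inh := integrable_norm ih.
have Hh : (\int[m2]_y `|(h y)%:E| < +oo)%E by case/integrableP : ih.
apply: (@le_lt_trans _ _ (\int[m1]_x (`|g x|%:E * \int[m2]_y `|(h y)%:E|))%E).
  apply: ge0_le_integral => //=.
  - by move=> x _; exact: integral_ge0.
  - apply: (measurable_fun_fubini_tonelli_F (fun z => `|(f z)%:E|%E)) => //.
    by measurability.
  - measurability.
  move=> x _; rewrite -ge0_integralZl//; last first.
    by measurability.
  apply: ge0_le_integral => //=.
  - measurability.
  - measurability.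
  by move=> y _; rewrite -EFinM lee_fin (le_trans (fgh x y))// -normrM ler_norm.
rewrite ge0_integralZr//; first last.
- exact: integral_ge0.
- by measurability.
rewrite lte_mul_pinfty//; first exact: integral_ge0.
by rewrite ge0_fin_numE; [case/integrableP : ig|exact: integral_ge0].
Qed.

Lemma Rintegral_prod (f : T1 * T2 -> R) :
  (m1 \x m2)%E.-integrable setT (EFin \o f) ->
  (forall x, m2.-integrable setT (EFin \o (fun y => f (x, y)))) ->
  \int[(m1 \x m2)%E]_z f z = \int[m1]_x \int[m2]_y f (x, y).
Proof.
move=> iF i2; rewrite /Rintegral -integral12_prod_meas1//.
congr fine; apply: eq_integral => x _; rewrite fineK//.
by have /integrable_fin_num := i2 x; apply.
Qed.

Lemma Rintegral_fubini (f : T1 * T2 -> R) (g : T1 -> R) (h : T2 -> R) :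
  measurable_fun setT f -> (forall x y, `|f (x, y)| <= g x * h y) ->
  m1.-integrable setT (EFin \o g) -> m2.-integrable setT (EFin \o h) ->
  \int[m1]_x \int[m2]_y f (x, y) = \int[m2]_y \int[m1]_x f (x, y).
Proof.
move=> mf fgh ig ih; have ip := integrable_prod mf fgh ig ih.
have i2 x : m2.-integrable setT (EFin \o (fun y => f (x, y))).
  apply: (@dominated_integrable _ _ _ _ _ (fun y => g x * h y)) => //.
  - by apply: (measurableT_comp mf); exact: pair1_measurable.
  - exact: (integrableZl measurableT (g x) ih).
have i1 y : m1.-integrable setT (EFin \o (fun x => f (x, y))).
  apply: (@dominated_integrable _ _ _ _ _ (fun x => h y * g x)) => //.
  - by apply: (measurableT_comp mf); exact: pair2_measurable.
  - by move=> x; rewrite mulrC.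
  - exact: (integrableZl measurableT (h y) ig).
rewrite -Rintegral_prod// /Rintegral -integral21_prod_meas1//.
congr fine; apply: eq_integral => y _; rewrite fineK//.
by have /integrable_fin_num := i1 y; apply.
Qed.

(** Tonelli gives measurability for the positive and the negative part separately, so slices with a
    divergent integral are covered as well. *)
Lemma measurable_Rintegral (f : T1 * T2 -> R) : measurable_fun setT f ->
  measurable_fun setT (fun x => \int[m2]_y f (x, y)).
Proof.
move=> mf; rewrite /Rintegral.
apply: (@measurableT_comp _ _ _ _ _ _ fine); first exact: fine_measurable.
rewrite (_ : (fun x => _) = (fun x => \int[m2]_y ((EFin \o f)^\+ (x, y)) -
    \int[m2]_y ((EFin \o f)^\- (x, y)))%E); last first.
  apply/funext => x; rewrite [LHS]integralE.
  by congr (_ - _)%E; apply: eq_integral => y _; rewrite ?funeposE ?funenegE.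
apply: emeasurable_funB.
  by apply: measurable_fun_fubini_tonelli_F => //; exact/measurable_funepos/measurable_EFinP.
by apply: measurable_fun_fubini_tonelli_F => //; exact/measurable_funeneg/measurable_EFinP.
Qed.

End fubini_complements.

Section Rintegral_change_of_variables.
Context d1 d2 (T1 : measurableType d1) (T2 : measurableType d2) (R : realType).
Variables (m1 : {measure set T1 -> \bar R}) (m2 : {measure set T2 -> \bar R}).
Variables (phi : T1 -> T2) (k : R).

(** Splitting [f] into positive and negative parts reduces a substitution rule to nonnegative
    functions. *)
Lemma Rintegral_change_of_variables (f : T2 -> R) : 0 < k ->
  measurable_fun setT phi ->
  (forall g : T2 -> \bar R, measurable_fun setT g -> (forall x, 0 <= g x)%E ->
    (\int[m1]_x g (phi x) = k%:E * \int[m2]_x g x)%E) ->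
  m2.-integrable setT (EFin \o f) ->
  m1.-integrable setT (EFin \o (fun x => f (phi x))) /\
  \int[m1]_x f (phi x) = k * \int[m2]_x f x.
Proof.
move=> k0 mphi h iF; have mf : measurable_fun setT f.
  by case/integrableP : iF => /measurable_EFinP.
have maf : measurable_fun setT (fun x => f (phi x)).
  exact: (measurableT_comp mf mphi).
have ia : m1.-integrable setT (EFin \o (fun x => f (phi x))).
  apply/integrableP; split; first exact/measurable_EFinP.
  rewrite (h (fun x => `|(f x)%:E|)%E)//; last first.
    by measurability.
  by rewrite lte_mul_pinfty ?lee_fin ?(ltW k0)//; case/integrableP : iF.
split=> //.
have fE : forall x, f x = f^\+%R x - f^\-%R x.
  by move=> x; rewrite -[LHS]/(f x) -{1}(funrposBneg f).
have mp : measurable_fun setT f^\+%R by exact: measurable_funrpos.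
have mn : measurable_fun setT f^\-%R by exact: measurable_funrneg.
have ip := integrable_funrpos measurableT iF.
have in_ := integrable_funrneg measurableT iF.
have ipa := integrable_funrpos measurableT ia.
have ina := integrable_funrneg measurableT ia.
have key (g : T2 -> R) : measurable_fun setT g -> (forall x, 0 <= g x) ->
    \int[m1]_x g (phi x) = k * \int[m2]_x g x.
  move=> mg g0; rewrite /Rintegral (h (fun x => (g x)%:E))//; last by measurability.
  have : (0 <= \int[m2]_x (g x)%:E)%E.
    by apply: integral_ge0 => x _; rewrite lee_fin.
  (* [fine] sends [+oo] to 0 on both sides, so the identity survives divergence. *)
  case: (integral _ _ _) => [r _//|_|//].
  by rewrite gt0_muley ?lte_fin//= mulr0.
under eq_Rintegral => x _ do rewrite fE.
rewrite [in RHS](_ : f = (fun x => f^\+%R x - f^\-%R x)); last exact/funext.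
by rewrite !RintegralB// !key ?mulrBr.
Qed.

End Rintegral_change_of_variables.

(** * Affine substitutions on the line *)

Section lebesgue_affine.
Context (R : realType).
Local Notation mu := (@lebesgue_measure R).
Local Open Scope ereal_scope.

Lemma ge0_integral_reflect (f : R -> \bar R) : measurable_fun setT f ->
  (forall x, 0 <= f x) -> \int[mu]_x f (- x)%R = \int[mu]_x f x.
Proof.
move=> mf f0.
have mo : measurable_fun [set: measurableTypeR R] (-%R : R -> measurableTypeR R).
  by apply: measurable_funN; exact: measurable_id.
rewrite -(ge0_integral_pushforward mo mu measurableT)//.
by apply: eq_measure_integral => A mA _; exact: lebesgue_measureN.
Qed.

(** The right-hand side is a measure in [A] that gives each []a, b]] its length, so uniqueness of
    Lebesgue measure applies. *)
Lemma lebesgue_measure_affine (c v : R) A : (0 < c)%R -> measurable A ->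
  mu A = c%:E * mu ((fun x => c * x + v)%R @^-1` A).
Proof.
move=> c0 mA.
have mphi : measurable_fun [set: measurableTypeR R]
    (fun x => c * x + v : measurableTypeR R)%R.
  by measurability.
pose k : {nonneg R} := NngNum (ltW c0).
have -> : c%:E * mu ((fun x => c * x + v)%R @^-1` A) =
  mscale k (pushforward mu (fun x => c * x + v : measurableTypeR R)%R) A by [].
apply: lebesgue_measure_unique => // _ [[a b]] _ <- /=.
rewrite /mscale/= /pushforward.
have -> : (fun x => c * x + v)%R @^-1` `]a, b] =
    `]((a - v) / c)%R, ((b - v) / c)%R]%classic.
  apply/seteqP; split => x /=; rewrite !in_itv/= ltr_pdivrMr// ler_pdivlMr//.
    by rewrite ltrBlDr lerBrDr mulrC.
  by rewrite ltrBlDr lerBrDr mulrC.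
rewrite !lebesgue_measure_itv/= !lte_fin ltr_pM2r ?invr_gt0// ltrD2r.
case: ifPn => ab; last by rewrite mule0.
by rewrite -!EFinD -EFinM; congr EFin; field; rewrite gt_eqF.
Qed.

Lemma ge0_integral_affine1 (c v : R) (f : R -> \bar R) : c != 0%R ->
  measurable_fun setT f -> (forall x, 0 <= f x) ->
  \int[mu]_x f (c * x + v)%R = (`|c|^-1)%:E * \int[mu]_x f x.
Proof.
move=> c0 mf f0.
wlog cp : c f c0 mf f0 / (0 < c)%R => [hw|].
  case: (ltrgt0P c) c0 => [cp _|cn _|//].
    by rewrite hw ?gt_eqF// gtr0_norm.
  rewrite -(ge0_integral_reflect (f := fun x => f (c * x + v)%R)); last 2 first.
  - by measurability.
  - by [].
  under eq_integral do rewrite mulrN -mulNr.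
  by rewrite hw ?oppr_eq0 ?lt_eqF ?oppr_gt0// gtr0_norm ?oppr_gt0.
have mphi : measurable_fun [set: measurableTypeR R]
    (fun x => c * x + v : measurableTypeR R)%R.
  by measurability.
rewrite -(ge0_integral_pushforward mphi mu measurableT)// gtr0_norm//.
have -> : \int[mu]_x f x = c%:E * \int[pushforward mu (fun x => c * x + v :
     measurableTypeR R)%R]_x f x.
  have := @ge0_integral_mscale _ _ R (pushforward mu (fun x => c * x + v :
     measurableTypeR R)%R) setT measurableT
     (NngNum (ltW cp)) f mf (fun x _ => f0 x).
  move=> /= <-; apply: eq_measure_integral => A mA _.
  exact: lebesgue_measure_affine.
by rewrite muleA -EFinM mulVf ?gt_eqF// mul1e.
Qed.

Lemma Rintegral_affine1 (c v : R) (f : R -> R) : c != 0%R ->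
  mu.-integrable setT (EFin \o f) ->
  mu.-integrable setT (EFin \o (fun x => f (c * x + v)%R)) /\
  (\int[mu]_x f (c * x + v) = `|c|^-1 * \int[mu]_x f x)%R.
Proof.
move=> c0; apply: Rintegral_change_of_variables.
- by rewrite invr_gt0 normr_gt0.
- by measurability.
- by move=> g mg g0; exact: ge0_integral_affine1.
Qed.

End lebesgue_affine.

(** * Lebesgue integrals on R^N by induction on the dimension *)

Section lebesgueN_integral.
Context (R : realType).
Local Notation mu := (@lebesgue_measure R).

Lemma cons_pair_surj N (t : N.+1.-tuple R) : exists x y, t = cons_pair (x, y).
Proof. by exists (thead t), [tuple of behead t]; rewrite [LHS]tuple_eta. Qed.

Lemma tnth_cons_pair0 N (z : R * N.-tuple R) : tnth (cons_pair z) ord0 = z.1.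
Proof. by []. Qed.

Lemma tnth_cons_pairS N (z : R * N.-tuple R) i :
  tnth (cons_pair z) (lift ord0 i) = tnth z.2 i.
Proof. by rewrite tnthS; congr tnth; exact/val_inj. Qed.

Lemma ge0_integral_lebesgueNS N (f : N.+1.-tuple R -> \bar R) :
  measurable_fun setT f -> (forall x, 0 <= f x)%E ->
  (\int[lebesgueN R N.+1]_x f x =
   \int[mu]_x \int[lebesgueN R N]_y f (cons_pair (x, y)))%E.
Proof.
move=> mf f0; rewrite /= /lebesgue_step.
rewrite (ge0_integral_pushforward (@measurable_cons_pair R N))//.
rewrite preimage_setT.
have mfc : measurable_fun setT (fun z => f (@cons_pair R N z)).
  by apply: measurableT_comp => //; exact: measurable_cons_pair.
exact: (@fubini_tonelli1 _ _ _ _ _ mu (lebesgueN R N) _ mfc (fun z => f0 _)).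
Qed.

Lemma Rintegral_lebesgueNS N (f : N.+1.-tuple R -> R) (g : R -> R)
    (h : N.-tuple R -> R) : measurable_fun setT f ->
  (forall x y, `|f (cons_pair (x, y))| <= g x * h y) ->
  mu.-integrable setT (EFin \o g) ->
  (lebesgueN R N).-integrable setT (EFin \o h) ->
  (lebesgueN R N.+1).-integrable setT (EFin \o f) /\
  \int[lebesgueN R N.+1]_x f x =
  \int[mu]_x \int[lebesgueN R N]_y f (cons_pair (x, y)).
Proof.
move=> mf fgh ig ih.
pose F z := f (@cons_pair R N z).
have mF : measurable_fun setT F.
  by apply: measurableT_comp => //; exact: measurable_cons_pair.
have iF : (mu \x lebesgueN R N)%E.-integrable setT (EFin \o F).
  exact: integrable_prod ig ih.
have mEf : measurable_fun setT (EFin \o f) by exact/measurable_EFinP.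
have iP : (mu \x lebesgueN R N)%E.-integrable ((@cons_pair R N) @^-1` setT)
    ((EFin \o f) \o @cons_pair R N) by rewrite preimage_setT.
split.
  exact: (integrable_pushforward (@measurable_cons_pair R N) mEf iP).
transitivity (\int[(mu \x lebesgueN R N)%E]_z F z).
  rewrite /Rintegral; congr fine.
  rewrite [LHS](integral_pushforward (@measurable_cons_pair R N) mEf iP)//.
apply: Rintegral_prod => // x.
apply: (@dominated_integrable _ _ _ _ _ (fun y => g x * h y)).
- by rewrite /F; apply: (measurableT_comp mF); exact: pair1_measurable.
- by move=> y; exact: fgh.
- exact: (integrableZl measurableT (g x) ih).
Qed.

(** One family covers translations, dilations and reflections, and also differences, by
    [vsub_affine]. *)
Definition affine N (c : R) (v x : N.-tuple R) : N.-tuple R :=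
  [tuple c * tnth x i + tnth v i | i < N].

Lemma measurable_affine N d (T : measurableType d) (c : T -> R)
    (v x : T -> N.-tuple R) : measurable_fun setT c -> measurable_fun setT v ->
  measurable_fun setT x ->
  measurable_fun setT (fun t => affine (c t) (v t) (x t)).
Proof.
move=> mc mv mx; apply/measurable_fun_tnthP => i.
rewrite (_ : _ \o _ = fun t => c t * tnth (x t) i + tnth (v t) i).
  by measurability.
by apply/funext => t /=; rewrite tnth_mktuple.
Qed.

Lemma affine_cons N c v (w : N.-tuple R) x y :
  affine c (cons_pair (v, w)) (cons_pair (x, y)) =
  cons_pair (c * x + v, affine c w y).
Proof.
apply: eq_from_tnth => i; rewrite tnth_mktuple.
case: (unliftP ord0 i) => [j ->|->]; last by rewrite !tnth_cons_pair0.
by rewrite !tnth_cons_pairS tnth_mktuple.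
Qed.

Lemma ge0_integral_affine N (c : R) (v : N.-tuple R) (f : N.-tuple R -> \bar R) :
  c != 0 -> measurable_fun setT f -> (forall x, 0 <= f x)%E ->
  (\int[lebesgueN R N]_x f (affine c v x) =
   (`|c| ^- N)%:E * \int[lebesgueN R N]_x f x)%E.
Proof.
move=> c0; elim: N v f => [|N IH] v f mf f0.
  rewrite expr0 invr1 mul1e /=; apply: eq_integral => x _; congr f.
  by apply: eq_from_tnth => -[].
have [w [v' ->]] := cons_pair_surj v.
rewrite ge0_integral_lebesgueNS//; last first.
  by apply: measurableT_comp => //; apply: measurable_affine; measurability.
rewrite ge0_integral_lebesgueNS//.
have mfc : measurable_fun setT (fun z => f (@cons_pair R N z)).
  by apply: measurableT_comp => //; exact: measurable_cons_pair.
pose H x := (\int[lebesgueN R N]_y f (cons_pair (x, y)))%E.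
have mH : measurable_fun [set: R] H.
  exact: (measurable_fun_fubini_tonelli_F (fun z => f (cons_pair z))).
have H0 x : (0 <= H x)%E by exact: integral_ge0.
transitivity (\int[mu]_x ((`|c| ^- N)%:E * H (c * x + w)%R))%E.
  apply: eq_integral => x _; rewrite -(IH v').
  - by apply: eq_integral => y _; rewrite affine_cons.
  - by apply: (measurableT_comp mfc); exact: pair1_measurable.
  - by move=> y; exact: f0.
have k0 : (0 <= (`|c| ^- N)%:E)%E by rewrite lee_fin invr_ge0 exprn_ge0.
have mHc : measurable_fun [set: R] (fun x => H (c * x + w)) by measurability.
apply: etrans; first exact: (ge0_integralZl mu measurableT mHc (fun x _ => H0 _) k0).
have E := ge0_integral_affine1 w c0 mH H0.
apply: (etrans (congr1 (fun z => (`|c| ^- N)%:E * z)%E E)).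
by rewrite muleA -EFinM exprSr invfM.
Qed.

Lemma Rintegral_affine N (c : R) (v : N.-tuple R) (f : N.-tuple R -> R) :
  c != 0 -> (lebesgueN R N).-integrable setT (EFin \o f) ->
  (lebesgueN R N).-integrable setT (EFin \o (fun x => f (affine c v x))) /\
  \int[lebesgueN R N]_x f (affine c v x) =
  `|c| ^- N * \int[lebesgueN R N]_x f x.
Proof.
move=> c0; apply: Rintegral_change_of_variables.
- by rewrite invr_gt0 exprn_gt0 ?normr_gt0.
- by apply: (@measurable_affine N _ _ (fun=> c) (fun=> v) id); measurability.
- by move=> g mg g0; exact: ge0_integral_affine.
Qed.

Lemma ge0_integral_prodN N (f : R -> R) : measurable_fun setT f ->
  (forall x, 0 <= f x) -> mu.-integrable setT (EFin \o f) ->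
  (lebesgueN R N).-integrable setT (EFin \o (fun x => \prod_(i < N) f (tnth x i))) /\
  \int[lebesgueN R N]_x (\prod_(i < N) f (tnth x i)) = (\int[mu]_x f x) ^+ N.
Proof.
move=> mf f0 iF; elim: N => [|N [IH1 IH2]].
  rewrite expr0 (_ : (fun x : 0.-tuple R => _) = cst 1); last first.
    by apply/funext => x; rewrite big_ord0.
  split.
    exact: (@finite_measure_integrable_cst _ _ _
      (@dirac _ (0.-tuple R) [tuple] R) setT 1 measurableT).
  have -> := Rintegral_cst (lebesgueN R 0) measurableT 1.
  by rewrite -[RHS]mulr1 -[in RHS]/(fine 1%E); congr (_ * fine _); exact: diracT.
have mprod n : measurable_fun setT (fun x : n.-tuple R => \prod_(i < n) f (tnth x i)).
  by apply: measurable_prod => i _; measurability.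
have step x y : \prod_(i < N.+1) f (tnth (cons_pair (x, y)) i) =
    f x * \prod_(i < N) f (tnth y i).
  rewrite big_ord_recl tnth_cons_pair0; congr (_ * _).
  by apply: eq_bigr => i _; rewrite tnth_cons_pairS.
have dom x y : `|\prod_(i < N.+1) f (tnth (cons_pair (x, y)) i)| <=
    f x * \prod_(i < N) f (tnth y i).
  by rewrite step ger0_norm// mulr_ge0// prodr_ge0.
have [? ->] := @Rintegral_lebesgueNS N _ f _ (mprod _) dom iF IH1.
split=> //; under eq_Rintegral => x _.
  under eq_Rintegral => y _ do rewrite step.
  rewrite RintegralZl// IH2; over.
by rewrite RintegralZr// exprS.
Qed.

End lebesgueN_integral.

(** * Fourier transform of Gaussians *)

Section gaussian_fourier.
Context (R : realType).
Local Notation mu := (@lebesgue_measure R).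

Lemma is_derive_Rintegral d (T : measurableType d) (m : {measure set T -> \bar R})
    (f f' : R -> T -> R) (G : T -> R) (a u v : R) : u < a < v ->
  (forall x, m.-integrable setT (EFin \o f x)) ->
  (forall x y, is_derive x (1 : R) (f ^~ y) (f' x y)) ->
  m.-integrable setT (EFin \o G) ->
  (forall x y, u < x < v -> `|f' x y| <= G y) ->
  is_derive a (1 : R) (fun x => \int[m]_y f x y) (\int[m]_y f' a y).
Proof.
move=> auv iF df iG fG.
have Ia : `]u, v[%classic a by rewrite /= in_itv.
have pE x y : partial1of2 f x y = f' x y.
  by rewrite partial1of2E; exact: derive_val.
have D1 x y : `]u, v[%classic x -> [set: T] y -> derivable (f ^~ y) x 1.
  by move=> _ _; exact: ex_derive.
have G0 y : 0 <= G y by exact: le_trans (fG a y auv).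
have Gub x y : `]u, v[%classic x -> [set: T] y -> `|partial1of2 f x y| <= G y.
  by rewrite /= in_itv /= => xuv _; rewrite pE fG.
have iF' x : `]u, v[%classic x -> m.-integrable setT (EFin \o f x) by [].
apply: DeriveDef.
  exact: (derivable_under_integral measurableT Ia iF' D1 G0 iG Gub).
rewrite -derive1E (differentiation_under_integral measurableT Ia iF' D1 G0 iG Gub).
by apply: eq_Rintegral => y _; rewrite pE.
Qed.

Lemma integrable_gauss (d : R) : 0 < d ->
  mu.-integrable setT (EFin \o (fun y => expR (- (d * y ^+ 2)))) /\
  \int[mu]_y expR (- (d * y ^+ 2)) = Num.sqrt (pi / d).
Proof.
move=> d0; have sd0 : 0 < Num.sqrt d by rewrite sqrtr_gt0.
have E : (\int[mu]_y (expR (- (d * y ^+ 2)))%:E = (Num.sqrt (pi / d))%:E)%E.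
  transitivity (\int[mu]_y (gauss_fun (Num.sqrt d * y + 0))%:E)%E.
    apply: eq_integral => y _; rewrite /gauss_fun addr0 exprMn sqr_sqrtr//.
    exact: ltW.
  have := @ge0_integral_affine1 R (Num.sqrt d) 0 (EFin \o gauss_fun).
  move=> ->; rewrite ?gt_eqF//; last 2 first.
  - by apply/measurable_EFinP; exact: measurable_gauss_fun.
  - by move=> x; rewrite lee_fin gauss_fun_ge0.
  rewrite integralT_gauss -EFinM gtr0_norm// sqrtrM ?pi_ge0// sqrtrV ?(ltW d0)//.
  by rewrite mulrC.
split; last by rewrite /Rintegral E.
apply/integrableP; split; first by measurability.
under eq_integral => y _ do rewrite /= ger0_norm ?expR_ge0//.
by rewrite E ltry.
Qed.

Lemma bounded_gauss_integrable (d M : R) (f : R -> R) : 0 < d ->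
  measurable_fun setT f ->
  (forall y, `|f y| <= M * expR (- (d * y ^+ 2))) ->
  mu.-integrable setT (EFin \o f).
Proof.
move=> d0 mf fM; apply: (@dominated_integrable _ _ _ mu f _ mf fM).
exact: (integrableZl measurableT M (integrable_gauss d0).1).
Qed.

Lemma normr_le_expR_sqr (x : R) : `|x| <= expR (x ^+ 2 / 2).
Proof.
apply: le_trans (expR_ge1Dx _).
by rewrite -(real_normK (num_real x)); have := sqr_ge0 (`|x| - 1); nra.
Qed.

(** The phase [b] treats the cosine and the sine transform together: a shift by [pi / 2] turns one
    into the other up to sign. *)
Let Phi (b xi : R) := \int[mu]_y (cos (b + y * xi) * expR (- y ^+ 2)).

Lemma normr_cos_le1 (x : R) : `|cos x| <= 1.
Proof. by rewrite ler_norml cos_geN1 cos_le1. Qed.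

Lemma normr_sin_le1 (x : R) : `|sin x| <= 1.
Proof. by rewrite ler_norml sin_geN1 sin_le1. Qed.

Let integrable_Phi b xi h :
  mu.-integrable setT
    (EFin \o (fun y => cos (b + (y + h) * xi) * expR (- (y + h) ^+ 2))).
Proof.
apply: (@bounded_gauss_integrable (1/2) (expR (h ^+ 2))) => //.
  by measurability.
move=> y; rewrite normrM (ger0_norm (expR_ge0 _)) -expRD.
apply: le_trans (_ : expR (- (y + h) ^+ 2) <= _).
  by rewrite ler_piMl ?expR_ge0 ?normr_cos_le1.
by rewrite ler_expR; have := sqr_ge0 (y + 2 * h); nra.
Qed.

Let derive_Phi (b xi : R) : is_derive xi (1 : R) (Phi b)
  (\int[mu]_y (- (y * sin (b + y * xi)) * expR (- y ^+ 2))).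
Proof.
apply: (@is_derive_Rintegral _ _ mu
  (fun xi y => cos (b + y * xi) * expR (- y ^+ 2))
  (fun xi y => - (y * sin (b + y * xi)) * expR (- y ^+ 2))
  (fun y => 1 * expR (- (1 / 2 * y ^+ 2))) xi (xi - 1) (xi + 1)).
- by rewrite ltrBlDr ltrDl ltr01.
- move=> x; have := integrable_Phi b x 0.
  by congr (_.-integrable _ _); apply/funext => y /=; rewrite addr0.
- move=> x y.
  have H : is_derive x (1 : R) (fun x => b + y * x) y.
    apply: (@is_derive_eq _ _ _ (cst b + y \*: id)).
    by rewrite /= add0r /GRing.scale/= mulr1.
  have H2 := is_derive1_comp (is_derive_cos _) H.
  have H3 := is_deriveM H2 (is_derive_cst (expR (- y ^+ 2)) x 1).
  apply: is_derive_eq H3 _.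
  by rewrite /= scaler0 add0r /GRing.scale/=; ring.
- exact: (integrableZl measurableT 1 (integrable_gauss _).1).
- move=> x y _; rewrite normrM normrN normrM (ger0_norm (expR_ge0 _)) mul1r.
  apply: le_trans (_ : expR (y ^+ 2 / 2) * expR (- y ^+ 2) <= _).
    rewrite ler_wpM2r ?expR_ge0//.
    apply: le_trans (normr_le_expR_sqr y).
    by rewrite ler_piMr ?normr_sin_le1.
  by rewrite -expRD ler_expR; lra.
Qed.

(* Translation invariance makes [\int cos (b + (y + h) * xi) * expR (- (y + h) ^+ 2)]
   constant in [h]; this is its derivative at [h = 0]. *)
Let Phi_by_parts (b xi : R) :
  \int[mu]_y ((- (xi * sin (b + y * xi)) - 2 * y * cos (b + y * xi)) *
    expR (- y ^+ 2)) = 0.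
Proof.
pose F h := \int[mu]_y (cos (b + (y + h) * xi) * expR (- (y + h) ^+ 2)).
have FE h : F h = F 0.
  have [_] := @Rintegral_affine1 R 1 h _ (oner_neq0 _) (integrable_Phi b xi 0).
  rewrite normr1 invr1 mul1r => E; rewrite -[RHS]E.
  by apply: eq_Rintegral => y _ /=; rewrite mul1r addr0.
pose F' h y := (- (xi * sin (b + (y + h) * xi)) - 2 * (y + h) *
  cos (b + (y + h) * xi)) * expR (- (y + h) ^+ 2).
(* For [|h| < 1], half of the Gaussian exponent satisfies
   [- (y + h) ^+ 2 / 2 <= 1 / 2 - y ^+ 2 / 4]; the other half absorbs the factor [y + h]. *)
pose G y := (`|xi| + 2) * expR (1 / 2) * expR (- (1 / 4 * y ^+ 2)).
have dF : is_derive (0 : R) (1 : R) F (\int[mu]_y F' 0 y).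
  apply: (@is_derive_Rintegral _ _ mu
    (fun h y => cos (b + (y + h) * xi) * expR (- (y + h) ^+ 2)) F' G 0 (-1) 1).
  - by rewrite ltrN10 ltr01.
  - by move=> h; exact: integrable_Phi.
  - move=> h y.
    have H1 : is_derive h (1 : R) (fun h => y + h) 1.
      apply: (@is_derive_eq _ _ _ (cst y + id)).
      by rewrite /= add0r.
    have H2 : is_derive h (1 : R) (fun h => b + (y + h) * xi) xi.
      have := is_deriveM H1 (is_derive_cst xi h 1).
      move=> /(is_deriveD (is_derive_cst b h 1)) /is_derive_eq; apply.
      by rewrite scaler0 !add0r /GRing.scale/= mulr1.
    have H3 : is_derive h (1 : R) (fun h => - (y + h) ^+ 2) (- (2 * (y + h))).
      have := is_deriveN (is_deriveX 2 H1).
      by move=> /is_derive_eq; apply; rewrite /GRing.scale/= mulr1 expr1.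
    have := is_deriveM (is_derive1_comp (is_derive_cos _) H2)
      (is_derive1_comp (is_derive_expR _) H3).
    by move=> /is_derive_eq; apply; rewrite /F' /GRing.scale/=; ring.
  - apply: (integrableZl measurableT _ (integrable_gauss _).1).
    by lra.
  - move=> h y /andP[h1 h2]; rewrite /F' /G normrM (ger0_norm (expR_ge0 _)).
    apply: le_trans (_ : (`|xi| + 2) * expR ((y + h) ^+ 2 / 2) *
        expR (- (y + h) ^+ 2) <= _).
      rewrite ler_wpM2r ?expR_ge0//.
      have e1 : 1 <= expR ((y + h) ^+ 2 / 2).
        by rewrite -[leLHS]expR0 ler_expR divr_ge0 ?sqr_ge0.
      rewrite [leRHS]mulrDl; apply: le_trans (ler_normB _ _) _; apply: lerD.
        rewrite normrN normrM ler_pM//.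
        exact: le_trans (normr_sin_le1 _) e1.
      rewrite !normrM (ger0_norm (ler0n _ 2)) -mulrA ler_wpM2l//.
      apply: le_trans (normr_le_expR_sqr _).
      by rewrite ler_piMr ?normr_cos_le1.
    rewrite -!mulrA ler_wpM2l ?addr_ge0// -!expRD ler_expR.
    have := sqr_ge0 (y + 2 * h); nra.
have dF0 : is_derive (0 : R) (1 : R) F 0.
  rewrite (_ : F = cst (F 0)); first exact: is_derive_cst.
  by apply/funext => h; exact: FE.
have := @derive_val _ _ _ _ _ _ _ dF; rewrite (@derive_val _ _ _ _ _ _ _ dF0).
move=> /esym <-; apply: eq_Rintegral => y _; rewrite /F' addr0//.
Qed.

(** [Phi_by_parts] at phase [b + pi / 2] expresses the integral of [y * sin] through that of [cos],
    which closes the differential equation. *)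
Let derive_Phi' (b xi : R) : is_derive xi (1 : R) (Phi b) (- (xi / 2) * Phi b xi).
Proof.
apply: is_derive_eq (derive_Phi b xi) _.
have := Phi_by_parts (b + pi / 2) xi.
pose S y := - (y * sin (b + y * xi)) * expR (- y ^+ 2).
have iS : mu.-integrable setT (EFin \o S).
  apply: (@bounded_gauss_integrable (1/2) 1) => //; first by rewrite /S; measurability.
  move=> y; rewrite /S normrM normrN normrM (ger0_norm (expR_ge0 _)) mul1r.
  apply: le_trans (_ : expR (y ^+ 2 / 2) * expR (- y ^+ 2) <= _).
    rewrite ler_wpM2r ?expR_ge0//.
    apply: le_trans (normr_le_expR_sqr y).
    by rewrite ler_piMr ?normr_sin_le1.
  by rewrite -expRD ler_expR; lra.
have iC : mu.-integrable setT (EFin \o (fun y => cos (b + y * xi) * expR (- y ^+ 2))).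
  have := integrable_Phi b xi 0.
  by congr (_.-integrable _ _); apply/funext => y /=; rewrite addr0.
have -> : \int[mu]_y ((- (xi * sin (b + pi / 2 + y * xi)) -
      2 * y * cos (b + pi / 2 + y * xi)) * expR (- y ^+ 2)) =
    \int[mu]_y ((- xi) * (cos (b + y * xi) * expR (- y ^+ 2)) + (- 2) * S y).
  apply: eq_Rintegral => y _.
  by rewrite addrAC sinDpihalf cosDpihalf /S; ring.
rewrite RintegralD//; last 2 first.
- exact: (integrableZl measurableT (- xi) iC).
- exact: (integrableZl measurableT (- 2) iS).
rewrite !RintegralZl// -/(Phi b xi) => E.
have -> : \int[mu]_y (- (y * sin (b + y * xi)) * expR (- y ^+ 2)) =
  \int[mu]_y S y by [].
lra.
Qed.

Let Phi0 b : Phi b 0 = cos b * Num.sqrt pi.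
Proof.
have [i1 E1] := integrable_gauss ltr01.
rewrite divr1 in E1; rewrite -E1 -RintegralZl//.
by apply: eq_Rintegral => y _; rewrite mulr0 addr0 mul1r.
Qed.

Let PhiE b xi : Phi b xi = cos b * Num.sqrt pi * expR (- (xi ^+ 2 / 4)).
Proof.
pose P x := Phi b x * expR (x ^+ 2 / 4).
have dP (x : R) : is_derive x (1 : R) P 0.
  have H : is_derive x (1 : R) (fun x => x ^+ 2 / 4) (x / 2).
    have := is_deriveM (is_deriveX 2 (is_derive_id x (1 : R))) (is_derive_cst (4^-1 : R) x (1 : R)).
    move=> /is_derive_eq; apply.
    by rewrite scaler0 add0r /GRing.scale/= mulr1 expr1; field.
  have := is_deriveM (derive_Phi' b x) (is_derive1_comp (is_derive_expR _) H).
  by move=> /is_derive_eq; apply; rewrite /GRing.scale/=; ring.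
have := is_derive_0_is_cst xi 0 dP.
rewrite /P Phi0 expr0n/= mul0r expR0 mulr1 => <-.
by rewrite -mulrA -expRD subrr expR0 mulr1.
Qed.

Lemma gauss_fourier1 (d b xi : R) : 0 < d ->
  \int[mu]_y (cos (b + y * xi) * expR (- (d * y ^+ 2))) =
  cos b * Num.sqrt (pi / d) * expR (- (xi ^+ 2 / (4 * d))).
Proof.
move=> d0; have sd0 : 0 < Num.sqrt d by rewrite sqrtr_gt0.
have iC : mu.-integrable setT (EFin \o (fun y =>
    cos (b + y * (xi / Num.sqrt d)) * expR (- y ^+ 2))).
  have := integrable_Phi b (xi / Num.sqrt d) 0.
  by congr (_.-integrable _ _); apply/funext => y /=; rewrite addr0.
have [_ E] := @Rintegral_affine1 R (Num.sqrt d) 0 _ (lt0r_neq0 sd0) iC.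
transitivity (\int[mu]_x (cos (b + (Num.sqrt d * x + 0) * (xi / Num.sqrt d)) *
    expR (- (Num.sqrt d * x + 0) ^+ 2))).
  apply: eq_Rintegral => y _; rewrite addr0 exprMn sqr_sqrtr ?(ltW d0)//.
  congr (cos _ * _); congr (_ + _); field; exact: lt0r_neq0.
rewrite E -/(Phi b (xi / Num.sqrt d)) PhiE gtr0_norm// sqrtrM ?pi_ge0//.
rewrite sqrtrV ?(ltW d0)// mulrA [_^-1 * _]mulrC !mulrA; congr (_ * expR (- _)).
rewrite exprMn exprVn sqr_sqrtr ?(ltW d0)//; field; exact: lt0r_neq0.
Qed.

End gaussian_fourier.

Section euclidean_algebra.
Context (R : realType).

Lemma enorm_sqr N (x : N.-tuple R) : enorm x ^+ 2 = \sum_(i < N) tnth x i ^+ 2.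
Proof. by rewrite sqr_sqrtr// sumr_ge0// => i _; exact: sqr_ge0. Qed.

Lemma enorm_ge0 N (x : N.-tuple R) : 0 <= enorm x.
Proof. exact: sqrtr_ge0. Qed.

Lemma enorm_sqr_cons N (z : R * N.-tuple R) :
  enorm (cons_pair z) ^+ 2 = z.1 ^+ 2 + enorm z.2 ^+ 2.
Proof.
rewrite !enorm_sqr big_ord_recl tnth_cons_pair0; congr (_ + _).
by apply: eq_bigr => i _; rewrite tnth_cons_pairS.
Qed.

Lemma dot_cons N (z w : R * N.-tuple R) :
  dot (cons_pair z) (cons_pair w) = z.1 * w.1 + dot z.2 w.2.
Proof.
rewrite /dot big_ord_recl !tnth_cons_pair0; congr (_ + _).
by apply: eq_bigr => i _; rewrite !tnth_cons_pairS.
Qed.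

Lemma dotC N (x y : N.-tuple R) : dot x y = dot y x.
Proof. by apply: eq_bigr => i _; rewrite mulrC. Qed.

End euclidean_algebra.

Section gaussian_fourierN.
Context (R : realType).

(** The phase [b] carries the induction: when the first coordinate is split off, its product [x * a]
    joins the phase of the remaining ones. *)
Lemma gauss_fourier N (d b : R) (xi : N.-tuple R) : 0 < d ->
  (lebesgueN R N).-integrable setT
    (EFin \o (fun y => expR (- (d * enorm y ^+ 2)))) /\
  \int[lebesgueN R N]_y (cos (b + dot y xi) * expR (- (d * enorm y ^+ 2))) =
  cos b * Num.sqrt (pi / d) ^+ N * expR (- (enorm xi ^+ 2 / (4 * d))).
Proof.
move=> d0; have [i1 _] := integrable_gauss d0.
elim: N b xi => [|N IH] b xi.
  have m0 (f : 0.-tuple R -> R) : f = cst (f [tuple]).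
    by apply/funext => x; congr f; exact: tuple0.
  have cE r : \int[lebesgueN R 0]_y (cst r y) = r.
    have -> := Rintegral_cst (lebesgueN R 0) measurableT r.
    by rewrite -[RHS]mulr1 -[in RHS]/(fine 1%E); congr (_ * fine _); exact: diracT.
  split.
    rewrite (m0 (fun y => expR (- (d * enorm y ^+ 2)))).
    exact: (@finite_measure_integrable_cst _ _ _
      (@dirac _ (0.-tuple R) [tuple] R) setT _ measurableT).
  rewrite (m0 (fun y => cos _ * _)) cE !enorm_sqr /dot !big_ord0 expr0.
  by rewrite ?mulr0 ?mul0r ?oppr0 ?expR0 ?addr0 ?mulr1; exact: mulr1.
have [a [w ->]] := cons_pair_surj xi.
have Eexp x y : expR (- (d * enorm (cons_pair (x, y) : N.+1.-tuple R) ^+ 2)) =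
    expR (- (d * x ^+ 2)) * expR (- (d * enorm y ^+ 2)).
  by rewrite enorm_sqr_cons -expRD/=; congr expR; ring.
have [iN _] := IH 0 w.
split.
  apply: (Rintegral_lebesgueNS _ _ i1 iN).1; first by measurability.
  by move=> x y; rewrite Eexp ger0_norm// mulr_ge0 ?expR_ge0.
pose f (y : N.+1.-tuple R) :=
  cos (b + dot y (cons_pair (a, w))) * expR (- (d * enorm y ^+ 2)).
have mf : measurable_fun setT f by rewrite /f; measurability.
have dom x y : `|f (cons_pair (x, y))| <=
    expR (- (d * x ^+ 2)) * expR (- (d * enorm y ^+ 2)).
  rewrite /f Eexp normrM (ger0_norm (mulr_ge0 (expR_ge0 _) (expR_ge0 _))).
  by rewrite ler_piMl ?normr_cos_le1// mulr_ge0 ?expR_ge0.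
have [_ ->] := Rintegral_lebesgueNS mf dom i1 iN.
transitivity (\int[@lebesgue_measure R]_x
    (Num.sqrt (pi / d) ^+ N * expR (- (enorm w ^+ 2 / (4 * d))) *
     (cos (b + x * a) * expR (- (d * x ^+ 2))))).
  apply: eq_Rintegral => x _.
  under eq_Rintegral => y _ do rewrite /f Eexp dot_cons/= addrA mulrCA.
  rewrite RintegralZl//; last first.
    apply: (dominated_integrable _ _ iN); first by measurability.
    move=> y; rewrite normrM (ger0_norm (expR_ge0 _)).
    by rewrite ler_piMl ?expR_ge0 ?normr_cos_le1.
  by rewrite (IH (b + x * a) w).2; ring.
rewrite RintegralZl//; last first.
  apply: (@dominated_integrable _ _ _ _ _ _ _ _ i1); first by measurability.
  move=> y; rewrite normrM (ger0_norm (expR_ge0 _)).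
  by rewrite ler_piMl ?expR_ge0 ?normr_cos_le1.
rewrite gauss_fourier1// enorm_sqr_cons/= (exprS _ N).
rewrite (mulrDl (a ^+ 2) (enorm w ^+ 2) (4 * d)^-1).
rewrite (opprD (a ^+ 2 / _)) expRD; move: (Num.sqrt _ ^+ N) => s; ring.
Qed.

End gaussian_fourierN.

(** * Elementary bounds for cosine and exponential *)

Section real_inequalities.
Context (R : realType).

Lemma normr_sin_le (x : R) : `|sin x| <= `|x|.
Proof.
wlog x0 : x / 0 <= x => [hw|].
  have [/hw//|/ltW x0] := leP 0 x.
  by have := hw (- x); rewrite sinN !normrN oppr_ge0 => /(_ x0).
have [|c _] := @MVT_segment R (@sin R) (@cos R) 0 x x0.
  by apply: continuous_subspaceT => y; exact: continuous_sin.
by rewrite sin0 !subr0 => ->; rewrite normrM ler_piMl// cos_max.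
Qed.

Lemma oneBcosE (x : R) : 1 - cos x = 2 * sin (x / 2) ^+ 2.
Proof.
have -> : cos x = cos ((x / 2) *+ 2) by congr cos; rewrite -mulr_natr; field.
rewrite cos_mulr2n; have := cos2Dsin2 (x / 2).
by rewrite !mulr2n => h; nra.
Qed.

Lemma oneBcos_ge0 (x : R) : 0 <= 1 - cos x.
Proof. by rewrite subr_ge0 cos_le1. Qed.

Lemma oneBcos_le2 (x : R) : 1 - cos x <= 2.
Proof. by have := cos_geN1 x; lra. Qed.

Lemma oneBcos_le_sqr (x : R) : 1 - cos x <= x ^+ 2.
Proof.
rewrite oneBcosE.
have h : sin (x / 2) ^+ 2 <= (x / 2) ^+ 2.
  rewrite -(real_normK (num_real (sin _))) -(real_normK (num_real (x / 2))).
  by rewrite ler_sqr ?nnegrE// normr_sin_le.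
by apply: le_trans (ler_wpM2l _ h) _ => //; have := sqr_ge0 x; nra.
Qed.

(** [m] is large enough that [r ^+ 2 <= (r ^ theta) ^+ m.+1] for [r >= 1], and the exponential
    dominates its Taylor term of degree [m.+1]. *)
Lemma sqr_le_expR_powR (theta s : R) : 0 < theta -> 0 < s ->
  exists2 C, 0 < C & forall r, 0 <= r -> 1 + r ^+ 2 <= C * expR (s * r `^ theta).
Proof.
move=> t0 s0; pose m := Num.bound (2 / theta).
have mt : 2 <= m.+1%:R * theta.
  rewrite -ler_pdivrMr//; have d0 : 0 <= 2 / theta by rewrite divr_ge0// ltW.
  by rewrite (le_trans (ltW (archi_boundP d0)))// ler_nat leqW.
pose C := 2 + m.+1`!%:R / s ^+ m.+1.
have C2 : 2 <= C by rewrite lerDl divr_ge0// exprn_ge0// ltW.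
exists C; first exact: lt_le_trans C2.
move=> r r0; set x := r `^ theta.
have x0 : 0 <= x by exact: powR_ge0.
have e1 : 1 <= expR (s * x).
  by rewrite -[leLHS]expR0 ler_expR mulr_ge0// ltW.
have [r1|/ltW r1] := leP r 1.
  apply: le_trans (_ : 2 * 1 <= _); first by nra.
  by rewrite ler_pM// ltW.
have rx : r ^+ 2 <= x ^+ m.+1.
  rewrite -powR_mulrn// /x -powR_mulrn ?powR_ge0// -powRrM ler_powR//.
  by rewrite mulrC.
have sx0 : 0 <= s * x by rewrite mulr_ge0// ltW.
have := expR_ge1Dxn m sx0; rewrite exprMn => h.
have : x ^+ m.+1 <= m.+1`!%:R / s ^+ m.+1 * expR (s * x).
  have s1 : 0 < s ^+ m.+1 by rewrite exprn_gt0.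
  have f1 : (0 : R) < m.+1`!%:R by rewrite ltr0n fact_gt0.
  rewrite mulrAC ler_pdivlMr// mulrC.
  move: h; rewrite -lerBrDl ler_pdivrMr// => /le_trans; apply.
  by rewrite mulrC ler_wpM2l ?(ltW f1)// lerBlDr lerDl.
rewrite /C mulrDl; move: rx e1; set A := _ * expR _; set B := expR _.
lra.
Qed.

End real_inequalities.

(** * Mixtures over a half-line, in logarithmic coordinates *)

Section exponential_integrability.
Context (R : realType).
Local Notation mu := (@lebesgue_measure R).

Lemma integrable_expRN_norm (c : R) : 0 < c ->
  mu.-integrable setT (EFin \o (fun w => expR (- (c * `|w|)))).
Proof.
move=> c0; have ip := integrable_exponential_pdf c0.
have N1 : (-1 : R) != 0 by rewrite oppr_eq0 oner_eq0.
have [ipn _] := Rintegral_affine1 0 N1 ip.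
have is_ := integrableZl measurableT c^-1 (integrableD measurableT ip ipn).
apply: (@dominated_integrable _ _ _ mu _
  (fun w => c^-1 * (exponential_pdf c w + exponential_pdf c (-1 * w + 0)))) is_.
  by measurability.
move=> w; rewrite ger0_norm ?expR_ge0// ler_pdivlMl//.
have [w0|/ltW w0] := leP 0 w.
  rewrite (exponential_pdfE c w0)/= ger0_norm// -mulNr lerDl.
  exact: exponential_pdf_ge0 (ltW c0) _.
have nw : 0 <= - 1 * w + 0 by lra.
rewrite (exponential_pdfE c nw)/= ler0_norm//.
have -> : - c * (-1 * w + 0) = - (c * - w) by ring.
by rewrite lerDr; exact: exponential_pdf_ge0 (ltW c0) _.
Qed.

(* The substitution [s = expR w] turns the measure [s `^ (- a - 1) ds] on the
   half-line into [expR (- a * w) dw] on the line, and dilations of [s] into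
   translations of [w]. *)
Lemma integrable_exp_weight (a b M : R) (phi : R -> R) : 0 < a < b -> 0 <= M ->
  measurable_fun setT phi ->
  (forall s, 0 < s -> `|phi s| <= M) ->
  (forall s, 0 < s -> `|phi s| <= M * s `^ b) ->
  mu.-integrable setT (EFin \o (fun w => phi (expR w) * expR (- (a * w)))).
Proof.
(* For [w] to [+oo] the bound [M] leaves decay at rate [a]; for [w] to [-oo] the bound [M * s ^ b]
   leaves rate [b - a]. *)
move=> /andP[a0 ab] M0 mphi h1 h2; pose c := Num.min a (b - a).
have c0 : 0 < c by rewrite /c lt_min a0 subr_gt0.
have ca : c <= a by rewrite /c ge_min lexx.
have cb : c <= b - a by rewrite /c ge_min lexx orbT.
apply: (@dominated_integrable _ _ _ mu _ (fun w => M * expR (- (c * `|w|)))).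
- by measurability.
- move=> w; rewrite normrM (ger0_norm (expR_ge0 _)).
  have [w0|/ltW w0] := leP 0 w.
    rewrite ler_pM ?expR_ge0 ?h1 ?expR_gt0// ler_expR ger0_norm//; nra.
  apply: le_trans (ler_wpM2r (expR_ge0 _) (h2 _ (expR_gt0 _))) _.
  rewrite -mulrA ler_wpM2l// -expRM -expRD ler_expR ler0_norm//; nra.
- exact: (integrableZl measurableT M (integrable_expRN_norm c0)).
Qed.

Lemma Rintegral_exp_weight (a l : R) (phi : R -> R) : 0 < l ->
  mu.-integrable setT (EFin \o (fun w => phi (expR w) * expR (- (a * w)))) ->
  mu.-integrable setT (EFin \o (fun w => phi (l * expR w) * expR (- (a * w)))) /\
  \int[mu]_w (phi (l * expR w) * expR (- (a * w))) =
  l `^ a * \int[mu]_w (phi (expR w) * expR (- (a * w))).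
Proof.
move=> l0 iphi; have [i1 E] := Rintegral_affine1 (ln l) (oner_neq0 _) iphi.
have wE w : phi (l * expR w) * expR (- (a * w)) =
    l `^ a * (phi (expR (1 * w + ln l)) * expR (- (a * (1 * w + ln l)))).
  rewrite mul1r expRD lnK ?posrE// [expR w * l]mulrC mulrDr opprD expRD.
  rewrite (expRN (a * ln l)) /powR gt_eqF//.
  by field; rewrite gt_eqF ?expR_gt0.
have e : (fun w => phi (l * expR w) * expR (- (a * w))) =
    (fun w => l `^ a * (phi (expR (1 * w + ln l)) * expR (- (a * (1 * w + ln l))))).
  by apply/funext => w; exact: wE.
split; rewrite e; first exact: (integrableZl measurableT _ i1).
by rewrite RintegralZl// E normr1 invr1 mul1r.
Qed.

Lemma Rintegral_gt0 (f : R -> R) (u v m : R) : u < v -> 0 < m ->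
  mu.-integrable setT (EFin \o f) -> (forall x, 0 <= f x) ->
  (forall x, u <= x <= v -> m <= f x) -> 0 < \int[mu]_x f x.
Proof.
move=> uv m0 iF f0 fm.
have ii := integrable_indic_itv u v true false.
have im := integrableZl measurableT m ii.
apply: lt_le_trans (_ : \int[mu]_x (m * \1_`[u, v] x) <= _); last first.
  apply: le_Rintegral => // x _; rewrite indicE.
  case: (boolP (x \in _)) => [|_]; last by rewrite mulr0.
  by rewrite inE/= in_itv/= mulr1 => /fm.
rewrite RintegralZl// mulr_gt0// /Rintegral integral_indic//= setIT.
rewrite lebesgue_measure_itv/= lte_fin uv/= subr_gt0//.
Qed.

(** The Levy-Khintchine form of [l ^ alpha]. Homogeneity in [l] comes from dilating [s], and
    convergence from [1 - expR (- s)] being at most 1 and at most [s]; [c] is Gamma(1 - alpha) /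
    alpha. *)
Lemma integral_oneBexp (alpha : R) : 0 < alpha < 1 -> exists2 c, 0 < c &
  forall l, 0 <= l ->
    mu.-integrable setT
      (EFin \o (fun w => (1 - expR (- (l * expR w))) * expR (- (alpha * w)))) /\
    \int[mu]_w ((1 - expR (- (l * expR w))) * expR (- (alpha * w))) =
    c * l `^ alpha.
Proof.
move=> alpha01; pose phi s : R := 1 - expR (- s).
have mphi : measurable_fun setT phi by rewrite /phi; measurability.
have p0 s : 0 <= s -> 0 <= phi s by move=> s0; rewrite subr_ge0 -expR0 ler_expR oppr_le0.
have iphi : mu.-integrable setT
    (EFin \o (fun w => phi (expR w) * expR (- (alpha * w)))).
  apply: (@integrable_exp_weight alpha 1 1) => // s s0; rewrite ger0_norm ?p0 ?(ltW s0)//.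
    by rewrite /phi lerBlDr lerDl expR_ge0.
  by rewrite mul1r powRr1 ?(ltW s0)// /phi lerBlDr -lerBlDl; exact: expR_ge1Dx.
exists (\int[mu]_w (phi (expR w) * expR (- (alpha * w)))).
  apply: (@Rintegral_gt0 _ 0 1 ((1 - expR (- 1)) * expR (- alpha))) => //.
  - rewrite mulr_gt0 ?expR_gt0// subr_gt0 -[ltRHS]expR0 ltr_expR; lra.
  - by move=> x; rewrite mulr_ge0 ?expR_ge0 ?p0 ?expR_ge0.
  move=> x /andP[x0 x1]; rewrite ler_pM ?expR_ge0//.
  - by rewrite lerD2l lerN2 ler_expR lerN2 -[leLHS]expR0 ler_expR.
  - by case/andP : alpha01 => a0 _; rewrite ler_expR; nra.
move=> l; rewrite le_eqVlt => /orP[/eqP <-|l0].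
  rewrite (_ : (fun w => _) = cst 0); last first.
    by apply/funext => w; rewrite mul0r oppr0 expR0 subrr mul0r.
  split; first exact: integrable0.
  rewrite Rintegral_cst// mul0r powR0 ?mulr0//.
  by case/andP : alpha01 => /gt_eqF ->.
by have [i1 E] := Rintegral_exp_weight l0 iphi; split=> //; rewrite E mulrC.
Qed.

(** The same representation with [1 - cos s], which is at most 2 and at most [s ^+ 2]; hence the
    range [a < 2]. It is used to compute moments of the kernel from its Fourier transform. *)
Lemma integral_oneBcos (a : R) : 0 < a < 2 -> exists2 c, 0 < c &
  forall y,
    mu.-integrable setT
      (EFin \o (fun w => (1 - cos (y * expR w)) * expR (- (a * w)))) /\
    \int[mu]_w ((1 - cos (y * expR w)) * expR (- (a * w))) = c * `|y| `^ a.
Proof.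
move=> a02; pose phi s : R := 1 - cos s.
have mphi : measurable_fun setT phi by rewrite /phi; measurability.
have iphi : mu.-integrable setT
    (EFin \o (fun w => phi (expR w) * expR (- (a * w)))).
  apply: (@integrable_exp_weight a 2 2) => // s s0; rewrite ger0_norm ?oneBcos_ge0//.
    exact: oneBcos_le2.
  rewrite (powR_mulrn 2 (ltW s0)); apply: le_trans (oneBcos_le_sqr _) _.
  by have := sqr_ge0 s; lra.
exists (\int[mu]_w (phi (expR w) * expR (- (a * w)))).
  (* For [-1 <= x <= 0] the argument [expR x] lies between [expR (-1)] and 1, where cosine decreases
     away from 1. *)
  apply: (@Rintegral_gt0 _ (-1) 0 ((1 - cos (expR (- 1))) * 1)) => //.
  - rewrite mulr1 subr_gt0 -[ltRHS]cos0 ltr_cos ?expR_gt0// in_itv/= ?lexx ?pi_ge0//.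
    have e1 : expR (-1) <= 1 :> R by rewrite -[leRHS]expR0 ler_expR.
    by rewrite expR_ge0/=; have := pi_ge2 R; lra.
  - by move=> x; rewrite mulr_ge0 ?expR_ge0 ?oneBcos_ge0.
  move=> x /andP[x0 x1]; rewrite ler_pM ?oneBcos_ge0//.
    rewrite lerD2l lerN2; have p2 := pi_ge2 R.
    have xl1 : expR x <= 1 by rewrite -[leRHS]expR0 ler_expR.
    have x11 : expR (-1) <= expR x by rewrite ler_expR.
    move: x11; rewrite le_eqVlt => /orP[/eqP -> //|h].
    by apply: ltW; rewrite ltr_cos ?in_itv/= ?expR_ge0//=; lra.
  by rewrite -[leLHS]expR0 ler_expR; case/andP : a02 => *; nra.
move=> y; have [->|y0] := eqVneq y 0.
  rewrite (_ : (fun w => _) = cst 0); last first.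
    by apply/funext => w; rewrite mul0r cos0 subrr mul0r.
  split; first exact: integrable0.
  rewrite Rintegral_cst// mul0r normr0 powR0 ?mulr0//.
  by case/andP : a02 => /gt_eqF ->.
have ny : 0 < `|y| by rewrite normr_gt0.
have [i1 E] := Rintegral_exp_weight ny iphi.
have e : (fun w => (1 - cos (y * expR w)) * expR (- (a * w))) =
    (fun w => phi (`|y| * expR w) * expR (- (a * w))).
  apply/funext => w; rewrite /phi; congr ((1 - _) * _).
  by rewrite -cos_norm normrM (ger0_norm (expR_ge0 _)).
by rewrite e; split=> //; rewrite E mulrC.
Qed.

Lemma integrable_oneDsqrV :
  mu.-integrable setT (EFin \o (fun x => (1 + x ^+ 2)^-1)).
Proof.
have p x : 0 <= (1 + x ^+ 2 : R)^-1 by rewrite invr_ge0 addr_ge0 ?sqr_ge0.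
apply/integrableP; split; first by measurability.
under eq_integral => x _ do rewrite /= ger0_norm//.
rewrite ge0_symfun_integralT//=.
- rewrite (_ : [set x | _] = `[0, +oo[%classic); last first.
    by apply/seteqP; split => x/=; rewrite in_itv/= andbT.
  by have := @integral0y_oneDsqr R; rewrite /oneDsqr => ->; rewrite -EFinM ltry.
- exact: continuous_oneDsqrV.
- by move=> x/=; rewrite sqrrN.
Qed.

End exponential_integrability.

(** * Positivity of the heat kernel *)

Section fractional_symbol.
Context (R : realType) (N : nat).
Local Notation lam := (lebesgueN R N).
Implicit Types (x y xi : N.-tuple R) (theta s t : R).

Definition symbol (theta t : R) (xi : N.-tuple R) : R :=
  expR (- (t * enorm xi `^ theta)).

Lemma symbol_ge0 theta t xi : 0 <= symbol theta t xi.
Proof. exact: expR_ge0. Qed.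

Lemma symbol_le1 theta t xi : 0 <= t -> symbol theta t xi <= 1.
Proof.
by move=> t0; rewrite -[leRHS]expR0 ler_expR oppr_le0 mulr_ge0 ?powR_ge0.
Qed.

Lemma symbolD theta s t xi :
  symbol theta (s + t) xi = symbol theta s xi * symbol theta t xi.
Proof. by rewrite /symbol -expRD mulrDl opprD. Qed.

Lemma measurable_symbol theta t : measurable_fun setT (symbol theta t).
Proof. rewrite /symbol; measurability. Qed.

Lemma tnth_le_enorm xi i : `|tnth xi i| <= enorm xi.
Proof.
rewrite -(ler_pXn2r (n := 2))// ?nnegrE ?enorm_ge0// enorm_sqr real_normK ?num_real//.
by rewrite (bigD1 i)//= lerDl sumr_ge0// => j _; exact: sqr_ge0.
Qed.

Lemma enorm_le_sum xi : enorm xi <= \sum_(i < N) `|tnth xi i|.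
Proof.
have s0 : 0 <= \sum_(i < N) `|tnth xi i| by exact: sumr_ge0.
rewrite -(ler_pXn2r (n := 2))// ?nnegrE ?enorm_ge0// enorm_sqr.
rewrite expr2 mulr_suml; apply: ler_sum => i _.
rewrite -(real_normK (num_real (tnth xi i))) expr2 ler_wpM2l//.
by rewrite (bigD1 i)//= lerDl sumr_ge0.
Qed.

Lemma integrable_symbol theta t : 0 < theta -> 0 < t ->
  lam.-integrable setT (EFin \o symbol theta t).
Proof.
(* The exponent is shared among the [N] coordinates, each share beating one factor [1 + x_i ^+ 2];
   [N.+1] keeps the divisor nonzero. *)
move=> th0 t0; have s0 : 0 < t / N.+1%:R by rewrite divr_gt0.
have [C C0 HC] := sqr_le_expR_powR th0 s0.
have p1 (u : R) : 0 < 1 + u ^+ 2 by rewrite ltr_pwDl ?sqr_ge0.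
have pV (u : R) : 0 <= (1 + u ^+ 2)^-1 by rewrite invr_ge0 ltW.
have [iP _] := @ge0_integral_prodN R N (fun u => (1 + u ^+ 2)^-1)
  ltac:(measurability) pV (integrable_oneDsqrV R).
apply: (@dominated_integrable _ _ _ lam _
  (fun xi => C ^+ N * \prod_(i < N) (1 + tnth xi i ^+ 2)^-1)); first exact: measurable_symbol.
- move=> xi; rewrite ger0_norm ?symbol_ge0//.
  rewrite prodfV ler_pdivlMr ?prodr_gt0// /symbol.
  have h : \prod_(i < N) (1 + tnth xi i ^+ 2) <=
      \prod_(i < N) (C * expR (t / N.+1%:R * enorm xi `^ theta)).
    apply: ler_prod => i _; rewrite (ltW (p1 _))/=.
    apply: le_trans (HC _ (enorm_ge0 xi)); rewrite lerD2l.
    rewrite -(real_normK (num_real (tnth xi i))) ler_sqr ?nnegrE ?enorm_ge0//.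
    exact: tnth_le_enorm.
  apply: le_trans (ler_wpM2l (expR_ge0 _) h) _.
  rewrite prodr_const card_ord exprMn mulrCA -[leRHS]mulr1.
  rewrite ler_wpM2l ?exprn_ge0 ?(ltW C0)// -expRM_natl -expRD -[leRHS]expR0 ler_expR.
  have r0 : 0 <= enorm xi `^ theta by exact: powR_ge0.
  rewrite addrC subr_le0 mulrA ler_wpM2r// mulrCA ger_pMr//.
  by rewrite ler_pdivrMr// mul1r ler_nat.
- exact: (integrableZl measurableT _ iP).
Qed.

Lemma sqr_symbol_le theta t : 0 < theta -> 0 < t -> exists2 C, 0 < C &
  forall xi, (1 + enorm xi ^+ 2) * symbol theta t xi <= C * symbol theta (t / 2) xi.
Proof.
move=> th0 t0; have [||C C0 HC] := @sqr_le_expR_powR R theta (t / 2) => //.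
  by rewrite divr_gt0.
exists C => // xi; rewrite {1}(splitr t) symbolD mulrA ler_wpM2r ?symbol_ge0//.
rewrite /symbol expRN ler_pdivrMr ?expR_gt0//; exact: HC (enorm_ge0 xi).
Qed.

End fractional_symbol.

Section positive_definite.
Context (R : realType) (N : nat).
Local Notation lam := (lebesgueN R N).
Local Notation mu := (@lebesgue_measure R).

(* [f (|xi| ^ 2)] is a positive-definite symbol: its Fourier transform,
   regularised by a Gaussian, is nonnegative. *)
Definition posdef (f : R -> R) := [/\ measurable_fun setT f,
  exists M : R, forall s, 0 <= s -> `|f s| <= M &
  forall (d : R) (x : N.-tuple R), 0 < d -> 0 <= \int[lam]_xi
    (cos (dot x xi) * f (enorm xi ^+ 2) * expR (- (d * enorm xi ^+ 2)))].

Let dominated_posdef (f : R -> R) (M d : R) x : 0 < d -> measurable_fun setT f ->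
  (forall s, 0 <= s -> `|f s| <= M) ->
  lam.-integrable setT (EFin \o (fun xi =>
    cos (dot x xi) * f (enorm xi ^+ 2) * expR (- (d * enorm xi ^+ 2)))).
Proof.
move=> d0 mf fM; have [iG _] := gauss_fourier 0 x d0.
apply: (@dominated_integrable _ _ _ lam _ (fun xi => M * expR (- (d * enorm xi ^+ 2)))).
- by measurability.
- move=> xi; rewrite !normrM (ger0_norm (expR_ge0 _)) ler_wpM2r ?expR_ge0//.
  by rewrite -[leRHS]mul1r ler_pM ?cos_max ?fM ?sqr_ge0.
- exact: (integrableZl measurableT _ iG).
Qed.

Lemma posdef1 : posdef (fun=> 1).
Proof.
split => [|| d x d0]; first by measurability.
  by exists 1 => s _; rewrite normr1.
have [_ E] := gauss_fourier 0 x d0.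
under eq_Rintegral => xi _ do rewrite mulr1 dotC -[dot xi x]add0r.
by rewrite E cos0 mul1r mulr_ge0 ?expR_ge0 ?exprn_ge0.
Qed.

Lemma posdefZ (c : R) (f : R -> R) : 0 <= c -> posdef f -> posdef (fun s => c * f s).
Proof.
move=> c0 [mf [M fM] pf]; split; first by measurability.
  exists (c * M) => s s0; rewrite normrM ger0_norm// ler_wpM2l//; exact: fM.
move=> d x d0.
under eq_Rintegral => xi _ do rewrite mulrCA -mulrA.
by rewrite RintegralZl ?mulr_ge0 ?pf//; exact: (dominated_posdef _ d0 mf fM).
Qed.

Lemma posdefD f g : posdef f -> posdef g -> posdef (fun s => f s + g s).
Proof.
move=> [mf [M fM] pf] [mg [M' gM] pg]; split; first by measurability.
  by exists (M + M') => s s0; rewrite (le_trans (ler_normD _ _))// lerD ?fM ?gM.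
move=> d x d0.
under eq_Rintegral => xi _ do rewrite mulrDr mulrDl.
rewrite RintegralD ?addr_ge0 ?pf ?pg//; first exact: (dominated_posdef _ d0 mf fM).
exact: (dominated_posdef _ d0 mg gM).
Qed.

Lemma posdef_lim (f_ : nat -> R -> R) (f : R -> R) (M : R) : (forall n, posdef (f_ n)) ->
  measurable_fun setT f ->
  (forall n s, 0 <= s -> `|f_ n s| <= M) ->
  (forall s, 0 <= s -> f_ n s @[n --> \oo] --> f s) -> posdef f.
Proof.
move=> pf mf fM ff; split => //.
  exists M => s s0.
  have cn : `|f_ n s| @[n --> \oo] --> `|f s| by apply: cvg_norm; exact: ff.
  rewrite -(cvg_lim _ cn)//; apply: limr_le; first exact: cvgP cn.
  by apply: nearW => n; exact: fM.
move=> d x d0; have [iG _] := gauss_fourier 0 x d0.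
pose F n xi := cos (dot x xi) * f_ n (enorm xi ^+ 2) * expR (- (d * enorm xi ^+ 2)).
have mf_ n : measurable_fun setT (f_ n) by case: (pf n).
have mF n : measurable_fun setT (F n).
  by have := mf_ n; rewrite /F; move: (f_ n) => g mg; measurability.
have := @dominated_cvg_Rintegral _ _ _ lam F _
  (fun xi => M * expR (- (d * enorm xi ^+ 2))) mF _ _ _
  (integrableZl measurableT M iG).
move=> /(_ (fun xi => cos (dot x xi) * f (enorm xi ^+ 2) * expR (- (d * enorm xi ^+ 2)))).
move=> /(_ ltac:(measurability)) h.
have {}h : \int[lam]_x0 F n x0 @[n --> \oo] --> \int[lam]_xi
    (cos (dot x xi) * f (enorm xi ^+ 2) * expR (- (d * enorm xi ^+ 2))).
  apply: h => [xi|n xi].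
    apply: cvgM; last exact: cvg_cst.
    by apply: cvgM; [exact: cvg_cst|exact: ff (sqr_ge0 _)].
  rewrite /F !normrM (ger0_norm (expR_ge0 _)) ler_wpM2r ?expR_ge0//.
  by rewrite -[leRHS]mul1r ler_pM ?cos_max ?fM ?sqr_ge0.
rewrite -(cvg_lim _ h)//; apply: limr_ge; first exact: cvgP h.
by apply: nearW => n; case: (pf n) => _ _; exact.
Qed.

(** At [s = |xi| ^ 2] each factor [expR (- (s * expR w))] is a Gaussian and merges with the
    regularising one. After Fubini, [f] is tested with the parameter [d + expR w], which is why
    [posdef] asks for every [d]. *)
Lemma posdef_exp_mixture (f k : R -> R) : posdef f -> (forall w, 0 <= k w) ->
  mu.-integrable setT (EFin \o k) ->
  posdef (fun s => (\int[mu]_w (expR (- (s * expR w)) * k w)) * f s).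
Proof.
move=> [mf [M fM] pf] k0 ik.
have mk : measurable_fun setT k by case/integrableP : ik => /measurable_EFinP.
pose J s := \int[mu]_w (expR (- (s * expR w)) * k w).
have mJ : measurable_fun setT J.
  apply: (@measurable_Rintegral _ _ _ _ R mu
    (fun z : R * R => expR (- (z.1 * expR z.2)) * k z.2)).
  by measurability.
have ikJ s : 0 <= s -> mu.-integrable setT (EFin \o (fun w => expR (- (s * expR w)) * k w)).
  move=> s0; apply: (@dominated_integrable _ _ _ mu _ k) => //; first by measurability.
  move=> w; rewrite normrM (ger0_norm (k0 w)) (ger0_norm (expR_ge0 _)).
  by rewrite ler_piMl// -expR0 ler_expR oppr_le0 mulr_ge0 ?expR_ge0.
have J0 s : 0 <= J s.
  by apply: Rintegral_ge0 => w _; rewrite mulr_ge0 ?expR_ge0.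
pose K := \int[mu]_w k w.
have JK s : 0 <= s -> J s <= K.
  move=> s0; apply: le_Rintegral => //; first exact: ikJ.
  by move=> w _; rewrite ler_piMl// -expR0 ler_expR oppr_le0 mulr_ge0 ?expR_ge0.
split; first by measurability.
  exists (K * M) => s s0; rewrite normrM (ger0_norm (J0 s)).
  by rewrite ler_pM ?J0 ?JK ?fM.
move=> d x d0; have [iG _] := gauss_fourier 0 x d0.
have -> : \int[lam]_xi (cos (dot x xi) * (J (enorm xi ^+ 2) * f (enorm xi ^+ 2)) *
      expR (- (d * enorm xi ^+ 2))) =
    \int[lam]_xi \int[mu]_w (k w * (cos (dot x xi) * f (enorm xi ^+ 2) *
      expR (- ((d + expR w) * enorm xi ^+ 2)))).
  apply: eq_Rintegral => xi _.
  have i1 := ikJ _ (sqr_ge0 (enorm xi)).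
  transitivity (J (enorm xi ^+ 2) * (cos (dot x xi) * f (enorm xi ^+ 2) *
      expR (- (d * enorm xi ^+ 2)))); first by ring.
  rewrite /J -(RintegralZr _ measurableT i1).
  apply: eq_Rintegral => w _; rewrite mulrDl opprD expRD.
  by rewrite [expR w * _]mulrC; ring.
have fub := @Rintegral_fubini _ _ _ _ R lam mu (fun z => k z.2 *
    (cos (dot x z.1) * f (enorm z.1 ^+ 2) * expR (- ((d + expR z.2) * enorm z.1 ^+ 2))))
    (fun xi => M * expR (- (d * enorm xi ^+ 2))) k.
rewrite fub//; last 3 first.
- by measurability.
- move=> xi w /=; rewrite normrM (ger0_norm (k0 w)) mulrC ler_wpM2r//.
  rewrite !normrM (ger0_norm (expR_ge0 _)) ler_pM ?mulr_ge0//.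
    by rewrite -[leRHS]mul1r ler_pM ?cos_max ?fM ?sqr_ge0.
  by rewrite ler_expR lerN2 ler_wpM2r ?sqr_ge0// lerDl expR_ge0.
- exact: (integrableZl measurableT M iG).
apply: Rintegral_ge0 => w _ /=.
have dw : 0 < d + expR w by rewrite addr_gt0 ?expR_gt0.
rewrite RintegralZl//; last exact: (dominated_posdef _ dw mf fM).
by rewrite mulr_ge0 ?pf.
Qed.

(** Powers of [J] arise by repeated multiplication, and the partial sums of the exponential series
    combine them with nonnegative coefficients; all of them are bounded by [expR K]. *)
Lemma posdef_expR (J : R -> R) (K : R) : measurable_fun setT J ->
  (forall s, 0 <= s -> 0 <= J s <= K) ->
  (forall f, posdef f -> posdef (fun s => J s * f s)) ->
  posdef (fun s => expR (J s)).
Proof.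
move=> mJ JK HJ.
pose F m s := series (exp_coeff (J s)) m.
have FE m s : F m.+1 s = F m s + m`!%:R^-1 * J s ^+ m.
  by rewrite /F seriesSr /exp_coeff/= mulrC.
have pX m : posdef (fun s => J s ^+ m).
  elim: m => [|m IH]; first exact: posdef1.
  by rewrite (_ : (fun s => _) = (fun s => J s * J s ^+ m)); [exact: HJ|apply/funext => s; rewrite exprS].
have pF m : posdef (F m).
  elim: m => [|m IH].
    rewrite (_ : F 0%N = (fun s => 0 * 1)); first exact: posdefZ posdef1.
    by apply/funext => s; rewrite /F /series/= big_geq// mulr1.
  rewrite (_ : F m.+1 = (fun s => F m s + m`!%:R^-1 * J s ^+ m)); last first.
    by apply/funext => s; exact: FE.
  by apply: posdefD => //; exact: posdefZ.
have Fcvg s : F m s @[m --> \oo] --> expR (J s).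
  exact: is_cvg_series_exp_coeff.
apply: (@posdef_lim F _ (expR K)) => //; first by measurability.
move=> m s s0; have /andP[J0 JKs] := JK s s0.
have nd : nondecreasing_seq (F^~ s).
  apply/nondecreasing_seqP => n; rewrite FE lerDl mulr_ge0 ?exprn_ge0//.
rewrite ger0_norm; last first.
  have := nd 0%N m (leq0n m); rewrite {1}/F /series/= big_geq//.
apply: (@le_trans _ _ (expR (J s))); last by rewrite ler_expR.
rewrite -(cvg_lim _ (Fcvg s))//; apply: nondecreasing_cvgn_le => //.
exact: cvgP (Fcvg s).
Qed.

(** A compound Poisson approximation. The weight [expR (- (alpha * w))] has infinite mass near
    [-oo]; truncated to [w > - n] its mass [K n] is finite, so the integral of
    [1 - expR (- (s * expR w))] splits as [K n - J n s] and the approximating symbol is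
    [expR (- K n) * expR (J n s)]. For [alpha = 1] the symbol is itself Gaussian. *)
Lemma posdef_symbol (alpha t : R) : 0 < alpha <= 1 -> 0 < t ->
  posdef (fun s => expR (- (t * s `^ alpha))).
Proof.
move=> /andP[a0]; rewrite le_eqVlt => /orP[/eqP ->|a1] t0.
  split; first by measurability.
    exists 1 => s s0; rewrite ger0_norm ?expR_ge0// -[leRHS]expR0 ler_expR oppr_le0.
    by rewrite mulr_ge0 ?powR_ge0// ltW.
  move=> d x d0; have td : 0 < t + d by rewrite addr_gt0.
  have [_ E] := gauss_fourier 0 x td.
  have -> : \int[lam]_xi (cos (dot x xi) * expR (- (t * (enorm xi ^+ 2) `^ 1)) *
      expR (- (d * enorm xi ^+ 2))) =
    \int[lam]_xi (cos (0 + dot xi x) * expR (- ((t + d) * enorm xi ^+ 2))).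
    apply: eq_Rintegral => xi _.
    by rewrite powRr1 ?sqr_ge0// add0r dotC -mulrA -expRD mulrDl opprD.
  by rewrite E cos0 mul1r mulr_ge0 ?expR_ge0 ?exprn_ge0.
have a01 : 0 < alpha < 1 by rewrite a0.
have [c c0 Hc] := integral_oneBexp a01.
pose k (n : nat) w := (t / c) * (\1_`]- n%:R, +oo[ w * expR (- (alpha * w))).
have mi n : measurable_fun setT (\1_`]- n%:R, +oo[ : R -> R).
  exact: measurable_indic.
have mk n : measurable_fun setT (k n) by have := mi n; rewrite /k => ?; measurability.
have k0 n w : 0 <= k n w by rewrite mulr_ge0 ?divr_ge0 ?(ltW t0) ?(ltW c0)// mulr_ge0 ?expR_ge0.
have ik n : mu.-integrable setT (EFin \o k n).
  (* For [w > - n], [- alpha * w <= 2 * alpha * n - alpha * |w|]. *)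
  apply: (@dominated_integrable _ _ _ mu _
    (fun w => (t / c * expR (2 * alpha * n%:R)) * expR (- (alpha * `|w|)))).
  - exact: mk.
  - move=> w; rewrite ger0_norm// /k -[leRHS]mulrA ler_wpM2l ?divr_ge0 ?(ltW t0) ?(ltW c0)//.
    rewrite indicE; case: (boolP (w \in _)) => wn; last by rewrite mul0r mulr_ge0 ?expR_ge0.
    rewrite mul1r -expRD ler_expR.
    move: wn; rewrite inE/= in_itv/= andbT => wn.
    have n0 : (0 : R) <= n%:R by [].
    by have [w0|/ltW w0] := leP 0 w; [rewrite ger0_norm|rewrite ler0_norm]; nra.
  - exact: (integrableZl measurableT _ (integrable_expRN_norm a0)).
pose J n s := \int[mu]_w (expR (- (s * expR w)) * k n w).
pose K n := \int[mu]_w k n w.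
have ikJ n s : 0 <= s -> mu.-integrable setT (EFin \o (fun w => expR (- (s * expR w)) * k n w)).
  move=> s0; apply: (@dominated_integrable _ _ _ mu _ (k n)) => //.
    by have mkn := mk n; measurability.
  move=> w; rewrite normrM (ger0_norm (k0 n w)) (ger0_norm (expR_ge0 _)).
  by rewrite ler_piMl// -[leRHS]expR0 ler_expR oppr_le0 mulr_ge0 ?expR_ge0.
have J0 n s : 0 <= J n s by apply: Rintegral_ge0 => w _; rewrite mulr_ge0 ?expR_ge0.
have JK n s : 0 <= s -> J n s <= K n.
  move=> s0; apply: le_Rintegral => //; first exact: ikJ.
  by move=> w _; rewrite ler_piMl// -[leRHS]expR0 ler_expR oppr_le0 mulr_ge0 ?expR_ge0.
have mJ n : measurable_fun setT (J n).
  apply: (@measurable_Rintegral _ _ _ _ R mu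
    (fun z : R * R => expR (- (z.1 * expR z.2)) * k n z.2)).
  by have mkn := mk n; measurability.
apply: (@posdef_lim (fun n s => expR (- K n) * expR (J n s)) _ 1).
- move=> n; apply: posdefZ; first exact: expR_ge0.
  apply: (@posdef_expR _ (K n)) => //.
    by move=> s s0; rewrite J0 JK.
  by move=> f pf; exact: posdef_exp_mixture.
- by measurability.
- move=> n s s0; rewrite ger0_norm ?mulr_ge0 ?expR_ge0// -expRD.
  by rewrite -[leRHS]expR0 ler_expR addrC subr_le0 JK.
move=> s s0; have [is_ Es] := Hc s s0.
have E n : expR (- K n) * expR (J n s) =
    expR (- \int[mu]_w ((1 - expR (- (s * expR w))) * k n w)).
  rewrite -expRD addrC -opprB; congr (expR (- _)).
  rewrite /K /J -RintegralB//; last exact: ikJ.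
  by apply: eq_Rintegral => w _; rewrite mulrBl mul1r.
under eq_fun do rewrite E.
apply: continuous_cvg; first exact: continuous_expR.
apply: cvgN.
have -> : t * s `^ alpha = \int[mu]_w ((1 - expR (- (s * expR w))) * (t / c * expR (- (alpha * w)))).
  under eq_Rintegral => w _ do rewrite mulrCA.
  rewrite RintegralZl// Es; field; exact: lt0r_neq0.
apply: (@dominated_cvg_Rintegral _ _ _ mu _ _
    (fun w => (1 - expR (- (s * expR w))) * (t / c * expR (- (alpha * w))))).
- by move=> n; have mkn := mk n; measurability.
- by measurability.
- move=> w; apply: cvgM; first exact: cvg_cst.
  apply: cvg_near_cst.
  near=> n; rewrite /k; congr (_ * _).
  rewrite indicE mem_set ?mul1r//= in_itv/= andbT.
  rewrite ltrNl; near: n; exact: nbhs_infty_gtr.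
- move=> n w.
  have e0 : 0 <= 1 - expR (- (s * expR w)).
    by rewrite subr_ge0 -[leRHS]expR0 ler_expR oppr_le0 mulr_ge0 ?expR_ge0.
  rewrite (ger0_norm (mulr_ge0 e0 (k0 n w))); apply: ler_wpM2l => //.
  apply: ler_wpM2l; first by rewrite divr_ge0 ?(ltW t0) ?(ltW c0).
  by rewrite ler_piMl ?expR_ge0// indicE; case: (_ \in _).
- under eq_fun => w do rewrite mulrCA.
  exact: (integrableZl measurableT _ is_).
Unshelve. all: by end_near.
Qed.

End positive_definite.

Section heat_kernel_positivity.
Context (R : realType) (N : nat) (theta : R).
Hypothesis htheta : 0 < theta <= 2.
Local Notation lam := (lebesgueN R N).

Let th0 : 0 < theta. Proof. by case/andP : htheta. Qed.

Lemma heat_kernel_symbol (x : N.-tuple R) t : heat_kernel theta x t =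
  (2 * pi) ^- N * \int[lam]_xi (cos (dot x xi) * symbol theta t xi).
Proof.
by rewrite heat_kernelE; congr (_ * _); apply: eq_Rintegral => xi _; rewrite mulrC.
Qed.

(** The damping in [posdef] is removed by dominated convergence. The exponent is [theta / 2] because
    [posdef] sees functions of |xi|^2. *)
Lemma heat_kernel_ge0 (x : N.-tuple R) (t : R) : 0 < t -> 0 <= heat_kernel theta x t.
Proof.
move=> t0; rewrite heat_kernel_symbol mulr_ge0 ?invr_ge0 ?exprn_ge0 ?mulr_ge0 ?pi_ge0//.
pose d n : R := n.+1%:R^-1.
have d0 n : 0 < d n by rewrite invr_gt0.
have hs : 0 < theta / 2 <= 1.
  by case/andP : htheta => *; rewrite divr_gt0//= ler_pdivrMr// mul1r.
have [_ _ pos] := @posdef_symbol R N (theta / 2) t hs t0.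
have sE (xi : N.-tuple R) : expR (- (t * (enorm xi ^+ 2) `^ (theta / 2))) = symbol theta t xi.
  rewrite /symbol -(powR_mulrn 2 (enorm_ge0 xi)) -powRrM; congr (expR (- (_ * _ `^ _))).
  by field.
have h : \int[lam]_xi (cos (dot x xi) * symbol theta t xi *
      expR (- (d n * enorm xi ^+ 2))) @[n --> \oo] -->
    \int[lam]_xi (cos (dot x xi) * symbol theta t xi).
  have ms := @measurable_symbol R N theta t.
  apply: (@dominated_cvg_Rintegral _ _ _ lam _ _ (symbol theta t)).
  - by move=> n; measurability.
  - by measurability.
  - move=> xi; rewrite -[X in _ --> X]mulr1; apply: cvgM; first exact: cvg_cst.
    rewrite -[X in _ --> X]expR0; apply: continuous_cvg; first exact: continuous_expR.
    rewrite -oppr0; apply: cvgN; rewrite -[X in _ --> X](mul0r (enorm xi ^+ 2)).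
    by apply: cvgM; [exact: cvg_harmonic|exact: cvg_cst].
  - move=> n xi; rewrite !normrM (ger0_norm (expR_ge0 _)) (ger0_norm (symbol_ge0 _ _ _)).
    apply: le_trans (_ : `|cos (dot x xi)| * symbol theta t xi <= _).
      rewrite -[leRHS]mulr1; apply: ler_wpM2l.
        by apply: mulr_ge0; [exact: normr_ge0|exact: symbol_ge0].
      rewrite -[leRHS]expR0 ler_expR oppr_le0.
      by apply: mulr_ge0; [exact: ltW (d0 n)|exact: sqr_ge0].
    by rewrite -[leRHS]mul1r; apply: ler_wpM2r; [exact: symbol_ge0|exact: cos_max].
  - exact: integrable_symbol.
rewrite -(cvg_lim _ h)//; apply: limr_ge; first exact: cvgP h.
apply: nearW => n; have := pos (d n) x (d0 n).
by under eq_Rintegral => xi _ do rewrite sE.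
Qed.

End heat_kernel_positivity.

(** * Fourier transform and semigroup property *)

Section affine_algebra.
Context (R : realType) (N : nat).
Implicit Types (x y v : N.-tuple R) (c t : R).

Lemma tnth_affine c v x i : tnth (affine c v x) i = c * tnth x i + tnth v i.
Proof. by rewrite tnth_mktuple. Qed.

Lemma dot_affine y c v x : dot y (affine c v x) = c * dot y x + dot y v.
Proof.
rewrite /dot mulr_sumr -big_split/=; apply: eq_bigr => i _.
by rewrite tnth_affine; ring.
Qed.

Lemma dot0 x : dot x (@vzero R N) = 0.
Proof. by rewrite /dot big1// => i _; rewrite tnth_mktuple mulr0. Qed.

Lemma enorm0 : enorm (@vzero R N) = 0.
Proof.
by rewrite /enorm big1 ?sqrtr0// => i _; rewrite tnth_mktuple expr0n.
Qed.

Lemma enorm_sqr_affine c v x :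
  enorm (affine c v x) ^+ 2 = c ^+ 2 * enorm x ^+ 2 + 2 * c * dot x v + enorm v ^+ 2.
Proof.
rewrite !enorm_sqr /dot !mulr_sumr -!big_split/=; apply: eq_bigr => i _.
by rewrite tnth_affine; ring.
Qed.

Lemma enorm_dilate c x : enorm (affine c (@vzero R N) x) = `|c| * enorm x.
Proof.
apply/eqP; rewrite -(eqrXn2 (n := 2))// ?mulr_ge0 ?enorm_ge0//; apply/eqP.
by rewrite enorm_sqr_affine dot0 enorm0 exprMn real_normK ?num_real//; ring.
Qed.

Lemma vsub_affine x y : vsub x y = affine (-1) x y.
Proof. by apply: eq_from_tnth => i; rewrite !tnth_mktuple; ring. Qed.

Lemma enorm_affine_le c v x :
  enorm (affine c v x) <= N%:R * (`|c| * enorm x + enorm v).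
Proof.
apply: le_trans (enorm_le_sum _) _.
apply: (@le_trans _ _ (\sum_(i < N) (`|c| * enorm x + enorm v))).
  apply: ler_sum => i _; rewrite tnth_affine (le_trans (ler_normD _ _))//.
  by rewrite normrM lerD ?tnth_le_enorm// ler_wpM2l ?tnth_le_enorm.
by rewrite sumr_const card_ord mulr_natl.
Qed.

(** At [l = 0] the power need not be differentiable, so that limit is checked directly. *)
Lemma cvg_powR (u : nat -> R) (l a : R) : 0 < a -> 0 <= l ->
  (forall n, 0 <= u n) -> u n @[n --> \oo] --> l ->
  u n `^ a @[n --> \oo] --> l `^ a.
Proof.
move=> a0; rewrite le_eqVlt => /orP[/eqP <-|l0] u0 ul.
  rewrite powR0 ?gt_eqF//; apply/cvgr0Pnorm_lt => e e0.
  have e1 : 0 < e `^ a^-1 by exact: powR_gt0.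
  have h := cvgr_lt _ ul _ e1; near=> n.
  have un : u n < e `^ a^-1 by near: n; exact: h.
  rewrite ger0_norm ?powR_ge0//.
  have -> : e = (e `^ a^-1) `^ a by rewrite -powRrM mulVf ?gt_eqF// powRr1 ?ltW.
  by apply: gt0_ltr_powR; rewrite ?nnegrE ?u0 ?(ltW e1).
have cf : {for l, continuous (fun x : R => x `^ a)}.
  apply: differentiable_continuous; apply/derivable1_diffP.
  by apply: derivable_powR; rewrite in_itv/= l0.
exact: (cvg_comp _ _ ul cf).
Unshelve. all: end_near.
Qed.

Lemma symbol_sqr theta t (xi : N.-tuple R) :
  symbol theta t xi = expR (- (t * (enorm xi ^+ 2) `^ (theta / 2))).
Proof.
rewrite /symbol -(powR_mulrn 2 (enorm_ge0 xi)) -powRrM.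
by congr (expR (- (_ * _ `^ _))); field.
Qed.

Lemma symbol_reflect theta t (xi : N.-tuple R) :
  symbol theta t (affine (-1) (@vzero R N) xi) = symbol theta t xi.
Proof. by rewrite /symbol enorm_dilate normrN1 mul1r. Qed.

Lemma cvg_symbol theta t (d : nat -> R) v w : 0 < theta ->
  d n @[n --> \oo] --> 0 ->
  symbol theta t (affine (d n) v w) @[n --> \oo] --> symbol theta t v.
Proof.
move=> th0 d0; under eq_fun do rewrite symbol_sqr; rewrite symbol_sqr.
apply: continuous_cvg; first exact: continuous_expR.
apply: cvgN; apply: cvgM; first exact: cvg_cst.
apply: cvg_powR; rewrite ?divr_gt0 ?sqr_ge0//; first by move=> n; exact: sqr_ge0.
rewrite (_ : (fun n => _) = fun n => d n ^+ 2 * enorm w ^+ 2 +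
    2 * d n * dot w v + enorm v ^+ 2); last first.
  by apply/funext => n; exact: enorm_sqr_affine.
rewrite -[X in _ --> X]add0r; apply: cvgD; last exact: cvg_cst.
rewrite -[X in _ --> X]addr0; apply: cvgD.
  rewrite -[X in _ --> X](mul0r (enorm w ^+ 2)); apply: cvgM; last exact: cvg_cst.
  by rewrite -(mulr0 0); apply: (@cvgM _ _ _ _ d d).
rewrite -[X in _ --> X](mul0r (dot w v)); apply: cvgM; last exact: cvg_cst.
by rewrite -(mulr0 2); apply: cvgM => //; exact: cvg_cst.
Qed.

End affine_algebra.

Lemma measurable_heat_kernel (R : realType) (N : nat) (theta : R) d
    (T : measurableType d) (f : T -> N.-tuple R)
    (g : T -> R) : measurable_fun setT f -> measurable_fun setT g ->
  measurable_fun setT (fun z => heat_kernel theta (f z) (g z)).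
Proof.
move=> mf mg; under eq_fun do rewrite heat_kernelE.
apply: measurable_funM; first exact: measurable_cst.
apply: (@measurable_Rintegral _ _ _ _ R (lebesgueN R N)
  (fun z : T * N.-tuple R =>
     expR (- (g z.1 * enorm z.2 `^ theta)) * cos (dot (f z.1) z.2))).
by measurability.
Qed.

Ltac measurability_hook ::=
  lazymatch goal with
  | |- measurable_fun _ (fun x => heat_kernel ?theta (@?f x) (@?g x)) =>
      refine (@measurable_heat_kernel _ _ theta _ _ f g _ _)
  end.

Section heat_kernel_fourier.
Context (R : realType) (N : nat) (theta : R).
Hypothesis htheta : 0 < theta <= 2.
Local Notation lam := (lebesgueN R N).
Local Notation G := (fun x t => heat_kernel theta x t).
Implicit Types (x y v xi eta : N.-tuple R) (b c s t : R).

(* Unification otherwise unfolds these when it compares two integrands. *)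
#[local] Opaque cos sin expR powR enorm dot symbol heat_kernel.

Let th0 : 0 < theta. Proof. by case/andP : htheta. Qed.

Let C0 : R := (2 * pi) ^- N.

Let C0_gt0 : 0 < C0.
Proof. by rewrite invr_gt0 exprn_gt0// mulr_gt0// pi_gt0. Qed.

Let ms t : measurable_fun setT (@symbol R N theta t).
Proof. exact: measurable_symbol. Qed.

Let isym t : 0 < t -> lam.-integrable setT (EFin \o symbol theta t).
Proof. exact: integrable_symbol. Qed.

Let isymcos t (f : N.-tuple R -> R) : 0 < t -> measurable_fun setT f ->
  lam.-integrable setT (EFin \o (fun xi => cos (f xi) * symbol theta t xi)).
Proof.
move=> t0 mf; have mst := ms t.
apply: (@dominated_integrable _ _ _ lam _ (symbol theta t)) (isym t0).
  by measurability.
move=> xi; rewrite normrM (ger0_norm (symbol_ge0 _ _ _)).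
by rewrite -[leRHS]mul1r; apply: ler_wpM2r; [exact: symbol_ge0|exact: cos_max].
Qed.

Lemma heat_kernel_le0 x t : 0 < t -> `|heat_kernel theta x t| <= C0 * \int[lam]_xi symbol theta t xi.
Proof.
move=> t0; rewrite heat_kernel_symbol normrM (ger0_norm (ltW C0_gt0)).
apply: ler_wpM2l; first exact: ltW.
have mst := ms t.
have ic := isymcos t0 (measurable_dot (measurable_cst x) (@measurable_id _ _ setT)).
apply: le_trans (le_normr_Rintegral measurableT ic) _.
apply: le_Rintegral => //; [exact: integrable_norm|exact: isym|move=> xi _].
rewrite normrM (ger0_norm (symbol_ge0 _ _ _)).
by rewrite -[leRHS]mul1r; apply: ler_wpM2r; [exact: symbol_ge0|exact: cos_max].
Qed.

(* The symbol is even, so the sine part of the Fourier integral vanishes. *)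
Lemma heat_kernel_phase b y s : 0 < s ->
  cos b * heat_kernel theta y s =
  C0 * \int[lam]_eta (cos (b + dot y eta) * symbol theta s eta).
Proof.
move=> s0; rewrite heat_kernel_symbol -/C0 mulrCA; congr (_ * _).
have md (c : R) : measurable_fun setT (fun eta => c + dot y eta) by measurability.
have i1 := isymcos s0 (md b).
have i0 := isymcos s0 (md 0).
have [i2 E2] := Rintegral_affine (@vzero R N) (c := -1) ltac:(by rewrite oppr_eq0 oner_eq0) i1.
have {}E2 : \int[lam]_xi (cos (b + dot y (affine (-1) (@vzero R N) xi)) *
      symbol theta s (affine (-1) (@vzero R N) xi)) =
    \int[lam]_xi (cos (b + dot y xi) * symbol theta s xi).
  by apply: (etrans E2); rewrite normrN1 expr1n invr1 mul1r.
have -> : \int[lam]_xi (cos (dot y xi) * symbol theta s xi) =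
    \int[lam]_xi (cos (0 + dot y xi) * symbol theta s xi).
  by apply: eq_Rintegral => xi _; rewrite add0r.
rewrite -RintegralZl; [|exact: measurableT|exact: i0].
have -> : \int[lam]_xi (cos b * (cos (0 + dot y xi) * symbol theta s xi)) =
  \int[lam]_xi (2^-1 * (cos (b + dot y xi) * symbol theta s xi +
   cos (b + dot y (affine (-1) (@vzero R N) xi)) * symbol theta s (affine (-1) (@vzero R N) xi))).
  apply: eq_Rintegral => xi _.
  by rewrite symbol_reflect dot_affine dot0 add0r addr0 mulN1r cosB cosD; field.
have iD : lam.-integrable setT (EFin \o (fun xi => cos (b + dot y xi) * symbol theta s xi +
    cos (b + dot y (affine (-1) (@vzero R N) xi)) *
      symbol theta s (affine (-1) (@vzero R N) xi))).
  exact: (integrableD measurableT i1 i2).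
rewrite RintegralZl; [|exact: measurableT|exact: iD].
rewrite RintegralD; [|exact: measurableT|exact: i1|exact: i2].
by rewrite [X in _ + X]E2; move: (Rintegral _ _ _) => I; field.
Qed.

(* A Gaussian of width [2 / d] in [y] becomes one of width [d] on the Fourier side. *)
Let charfun_gauss b xi s d : 0 < s -> 0 < d ->
  \int[lam]_y (cos (b + dot y xi) * heat_kernel theta y s *
    expR (- (d ^+ 2 / 4 * enorm y ^+ 2))) =
  cos b * ((Num.sqrt pi / pi) ^+ N * \int[lam]_w
    (symbol theta s (affine d (affine (-1) (@vzero R N) xi) w) * expR (- (1 * enorm w ^+ 2)))).
Proof.
move=> s0 d0; set m := affine (-1) (@vzero R N) xi.
have dd0 : 0 < d ^+ 2 / 4 by rewrite divr_gt0 ?exprn_gt0.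
have mst := ms s.
have [iG _] := gauss_fourier 0 xi dd0.
transitivity (\int[lam]_y \int[lam]_eta (C0 * (cos (b + dot y xi + dot y eta) *
    symbol theta s eta * expR (- (d ^+ 2 / 4 * enorm y ^+ 2))))).
  apply: eq_Rintegral => y _; rewrite (heat_kernel_phase _ _ s0).
  have md : measurable_fun setT (fun eta => b + dot y xi + dot y eta) by measurability.
  have i1 := isymcos s0 md.
  rewrite -mulrA -RintegralZr; [|exact: measurableT|exact: i1].
  by rewrite -RintegralZl; [|exact: measurableT|exact: (integrableZr measurableT _ i1)].
pose F (z : N.-tuple R * N.-tuple R) := C0 * (cos (b + dot z.1 xi + dot z.1 z.2) *
    symbol theta s z.2 * expR (- (d ^+ 2 / 4 * enorm z.1 ^+ 2))).
have mF : measurable_fun setT F by rewrite /F; measurability.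
have dF y eta : `|F (y, eta)| <=
    (C0 * expR (- (d ^+ 2 / 4 * enorm y ^+ 2))) * symbol theta s eta.
  rewrite /F !normrM (ger0_norm (ltW C0_gt0)) (ger0_norm (expR_ge0 _)).
  rewrite (ger0_norm (symbol_ge0 _ _ _))/= -!mulrA; apply: ler_wpM2l; first exact: ltW.
  rewrite [leRHS]mulrC -[leRHS]mul1r; apply: ler_wpM2r; last exact: cos_max.
  by apply: mulr_ge0; [exact: symbol_ge0|exact: expR_ge0].
rewrite (Rintegral_fubini mF dF (integrableZl measurableT C0 iG) (isym s0)) /F/=.
have Eeta eta : \int[lam]_y (C0 * (cos (b + dot y xi + dot y eta) *
    symbol theta s eta * expR (- (d ^+ 2 / 4 * enorm y ^+ 2)))) =
    (C0 * (cos b * Num.sqrt (pi / (d ^+ 2 / 4)) ^+ N)) * (symbol theta s eta *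
      expR (- (enorm (affine 1 xi eta) ^+ 2 / (4 * (d ^+ 2 / 4))))).
  have [_ E] := gauss_fourier b (affine 1 xi eta) dd0.
  transitivity (\int[lam]_y ((C0 * symbol theta s eta) *
      (cos (b + dot y (affine 1 xi eta)) * expR (- (d ^+ 2 / 4 * enorm y ^+ 2))))).
    apply: eq_Rintegral => y _; rewrite dot_affine mul1r -[b + _ + _]addrA.
    by rewrite [dot y xi + _]addrC; ring.
  have iE : lam.-integrable setT (EFin \o (fun y =>
      cos (b + dot y (affine 1 xi eta)) * expR (- (d ^+ 2 / 4 * enorm y ^+ 2)))).
    apply: (@dominated_integrable _ _ _ lam _ _ _ _ iG); first by measurability.
    move=> y; rewrite normrM (ger0_norm (expR_ge0 _)).
    by rewrite ler_piMl ?expR_ge0 ?cos_max.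
  by rewrite RintegralZl; [rewrite E; ring|exact: measurableT|exact: iE].
under eq_Rintegral => eta _ do rewrite Eeta.
have iS : lam.-integrable setT (EFin \o (fun eta => symbol theta s eta *
      expR (- (enorm (affine 1 xi eta) ^+ 2 / (4 * (d ^+ 2 / 4)))))).
  apply: (@dominated_integrable _ _ _ lam _ _ _ _ (isym s0)).
    have ma : measurable_fun setT (affine 1 xi).
      by apply: (@measurable_affine R N _ _ (fun=> 1) (fun=> xi) id); measurability.
    by measurability.
  move=> eta; rewrite normrM (ger0_norm (expR_ge0 _)) (ger0_norm (symbol_ge0 _ _ _)).
  rewrite -[leRHS]mulr1; apply: ler_wpM2l; first exact: symbol_ge0.
  by rewrite -[leRHS]expR0 ler_expR oppr_le0 mulr_ge0 ?sqr_ge0// invr_ge0 ltW ?mulr_gt0.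
rewrite RintegralZl; [|exact: measurableT|exact: iS].
(* The substitution [eta = d * w - xi] moves the dependence on [d] into the argument of the
   continuous symbol, where the limit [d] to 0 is pointwise. *)
have [_] := Rintegral_affine m (lt0r_neq0 d0) iS.
have d40 : 4 * (d ^+ 2 / 4) = d ^+ 2 by field.
rewrite d40 gtr0_norm// => Ea.
have -> : \int[lam]_x (symbol theta s x * expR (- (enorm (affine 1 xi x) ^+ 2 / d ^+ 2))) =
    d ^+ N * \int[lam]_w (symbol theta s (affine d m w) * expR (- (1 * enorm w ^+ 2))).
  have -> : \int[lam]_w (symbol theta s (affine d m w) * expR (- (1 * enorm w ^+ 2))) =
     \int[lam]_x (symbol theta s (affine d m x) *
       expR (- (enorm (affine 1 xi (affine d m x)) ^+ 2 / d ^+ 2))).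
    apply: eq_Rintegral => w _; congr (_ * expR (- _)).
    rewrite (_ : affine 1 xi (affine d m w) = affine d (@vzero R N) w); last first.
      by apply: eq_from_tnth => i; rewrite !tnth_affine !tnth_mktuple; ring.
    rewrite enorm_dilate gtr0_norm//; field; exact: lt0r_neq0.
  by rewrite Ea mulrA mulfV ?mul1r// expf_neq0// lt0r_neq0.
rewrite !mulrA; congr (_ * _).
transitivity (cos b * (C0 * (Num.sqrt (pi / (d ^+ 2 / 4)) * d) ^+ N)).
  by rewrite exprMn; ring.
congr (_ * _); rewrite /C0 -exprVn -exprMn; congr (_ ^+ _).
have -> : pi / (d ^+ 2 / 4) = pi * (2 / d) ^+ 2 :> R by field; exact: lt0r_neq0.
rewrite sqrtrM ?pi_ge0// sqrtr_sqr gtr0_norm ?divr_gt0//.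
have pi0 : (pi : R) != 0 by rewrite gt_eqF ?pi_gt0.
by move: (pi : R) pi0 => q q0; field; rewrite q0 (lt0r_neq0 d0).
Qed.

Let cvg_charfun_gauss b xi s : 0 < s ->
  \int[lam]_y (cos (b + dot y xi) * heat_kernel theta y s *
    expR (- (n.+1%:R^-1 ^+ 2 / 4 * enorm y ^+ 2))) @[n --> \oo] -->
  cos b * symbol theta s xi.
Proof.
move=> s0; have mst := ms s.
have d0 n : 0 < n.+1%:R^-1 :> R by rewrite invr_gt0.
under eq_fun => n do rewrite (charfun_gauss _ _ s0 (d0 n)).
have [i1 E1] := gauss_fourier 0 (@vzero R N) (@ltr01 R).
apply: cvgM; first exact: cvg_cst.
have -> : symbol theta s xi = (Num.sqrt pi / pi) ^+ N *
    \int[lam]_w (symbol theta s xi * expR (- (1 * enorm w ^+ 2))).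
  rewrite RintegralZl; [|exact: measurableT|exact: i1].
  have -> : \int[lam]_x expR (- (1 * enorm x ^+ 2)) = Num.sqrt pi ^+ N.
    rewrite divr1 enorm0 expr0n/= mul0r oppr0 expR0 cos0 mul1r mulr1 in E1.
    by rewrite -E1; apply: eq_Rintegral => x _; rewrite dot0 addr0 cos0 [RHS]mul1r.
  rewrite mulrCA -exprMn.
  have -> : Num.sqrt pi / pi * Num.sqrt pi = 1 :> R.
    by rewrite mulrAC -expr2 sqr_sqrtr ?pi_ge0// mulfV// gt_eqF// pi_gt0.
  by rewrite expr1n mulr1.
apply: cvgM; first exact: cvg_cst.
apply: (@dominated_cvg_Rintegral _ _ _ lam _ _ (fun w => expR (- (1 * enorm w ^+ 2)))) i1.
- move=> n; have ma : measurable_fun setT (affine n.+1%:R^-1 (affine (-1) (@vzero R N) xi)).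
    by apply: (@measurable_affine R N _ _ (fun=> n.+1%:R^-1) (fun=> affine (-1) (@vzero R N) xi) id);
      measurability.
  by measurability.
- by measurability.
- move=> w; apply: cvgM; last exact: cvg_cst.
  rewrite -[X in _ --> X]symbol_reflect; apply: cvg_symbol => //.
  exact: cvg_harmonic.
- move=> n w; rewrite normrM (ger0_norm (expR_ge0 _)) (ger0_norm (symbol_ge0 _ _ _)).
  rewrite -[leRHS]mul1r; apply: ler_wpM2r; first exact: expR_ge0.
  by apply: symbol_le1; exact: ltW.
Qed.

(** Since the kernel is nonnegative, its products with the Gaussians [e n] increase to it; by
    monotone convergence its integral is the limit of theirs, namely the symbol at frequency 0. *)
Lemma integrable_heat_kernel s : 0 < s ->
  lam.-integrable setT (EFin \o (fun y => heat_kernel theta y s)).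
Proof.
move=> s0.
have mG : measurable_fun setT (fun y => heat_kernel theta y s).
  by measurability.
have G0 y : 0 <= heat_kernel theta y s by exact: heat_kernel_ge0.
pose e n y := expR (- ((n.+1%:R^-1 : R) ^+ 2 / 4 * enorm y ^+ 2)).
have me n : measurable_fun setT (e n) by rewrite /e; measurability.
have e1 n y : 0 <= e n y <= 1.
  by rewrite expR_ge0 -[leRHS]expR0 ler_expR oppr_le0 mulr_ge0 ?sqr_ge0 ?divr_ge0 ?sqr_ge0.
have ien n : lam.-integrable setT (EFin \o (fun y => heat_kernel theta y s * e n y)).
  have dn : 0 < (n.+1%:R^-1 : R) ^+ 2 / 4 by rewrite divr_gt0// exprn_gt0// invr_gt0.
  have [iG _] := gauss_fourier 0 (@vzero R N) dn.
  apply: (@dominated_integrable _ _ _ lam _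
    (fun y => (C0 * \int[lam]_xi symbol theta s xi) * e n y)).
  - by have := me n => ?; measurability.
  - move=> y; rewrite normrM [`|e n y|]ger0_norm; last by case/andP : (e1 n y).
    by apply: ler_wpM2r; [case/andP : (e1 n y)|exact: heat_kernel_le0].
  - exact: (integrableZl measurableT _ iG).
apply/integrableP; split; first exact/measurable_EFinP.
have -> : (\int[lam]_x `|(EFin \o (fun y => heat_kernel theta y s)) x| =
    \int[lam]_y limn (fun n => (heat_kernel theta y s * e n y)%:E))%E.
  apply: eq_integral => y _; rewrite /= ger0_norm//; apply/esym/cvg_lim => //.
  apply: cvg_EFin; first exact: nearW.
  rewrite -[X in _ --> X]mulr1; apply: cvgM; first exact: cvg_cst.
  rewrite -[X in _ --> X]expR0; apply: continuous_cvg; first exact: continuous_expR.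
  rewrite -oppr0; apply: cvgN; rewrite -[X in _ --> X](mul0r (enorm y ^+ 2)).
  apply: cvgM; last exact: cvg_cst.
  rewrite -[X in _ --> X](mul0r (4^-1)); apply: cvgM; last exact: cvg_cst.
  by rewrite -[X in _ --> X](mulr0 0); apply: cvgM; exact: cvg_harmonic.
rewrite monotone_convergence//.
- have h := @cvg_charfun_gauss 0 (@vzero R N) s s0.
  have {}h : (\int[lam]_y (heat_kernel theta y s * e n y)%:E)%E @[n --> \oo] --> (symbol theta s (@vzero R N))%:E.
    rewrite cos0 mul1r in h.
    rewrite (_ : (fun n => _) = (fun n => (\int[lam]_y (cos (0 + dot y (@vzero R N)) * heat_kernel theta y s * e n y))%:E)).
      by apply: cvg_EFin; [exact: nearW|exact: h].
    apply/funext => n; rewrite -[LHS]fineK; last exact: integrable_fin_num (ien n).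
    by congr EFin; apply: eq_Rintegral => y _; rewrite dot0 addr0 cos0 mul1r.
  by rewrite (cvg_lim _ h)// ltry.
- by move=> n; have := me n => ?; measurability.
- by move=> n y _; rewrite lee_fin mulr_ge0//; case/andP : (e1 n y).
- move=> y _ n m nm; rewrite lee_fin ler_wpM2l// ler_expR lerN2 ler_wpM2r ?sqr_ge0//.
  rewrite ler_wpM2r// ler_sqr ?nnegrE ?invr_ge0// lef_pV2 ?posrE//.
  by rewrite ler_nat ltnS.
Qed.

Lemma heat_kernel_charfun b xi s : 0 < s ->
  \int[lam]_y (cos (b + dot y xi) * heat_kernel theta y s) = cos b * symbol theta s xi.
Proof.
move=> s0; have h := @cvg_charfun_gauss b xi s s0.
have mG : measurable_fun setT (fun y => heat_kernel theta y s).
  by measurability.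
have G0 y : 0 <= heat_kernel theta y s by exact: heat_kernel_ge0.
suff h' : \int[lam]_y (cos (b + dot y xi) * heat_kernel theta y s *
    expR (- (n.+1%:R^-1 ^+ 2 / 4 * enorm y ^+ 2))) @[n --> \oo] -->
    \int[lam]_y (cos (b + dot y xi) * heat_kernel theta y s).
  exact: cvg_unique h' h.
apply: (@dominated_cvg_Rintegral _ _ _ lam _ _ (fun y => heat_kernel theta y s)).
- by move=> n; measurability.
- by measurability.
- move=> y; rewrite -[X in _ --> X]mulr1; apply: cvgM; first exact: cvg_cst.
  rewrite -[X in _ --> X]expR0; apply: continuous_cvg; first exact: continuous_expR.
  rewrite -oppr0; apply: cvgN; rewrite -[X in _ --> X](mul0r (enorm y ^+ 2)).
  apply: cvgM; last exact: cvg_cst.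
  rewrite -[X in _ --> X](mul0r (4^-1)); apply: cvgM; last exact: cvg_cst.
  by rewrite -[X in _ --> X](mulr0 0); apply: cvgM; exact: cvg_harmonic.
- move=> n y; rewrite normrM (ger0_norm (expR_ge0 _)) normrM (ger0_norm (G0 y)).
  rewrite -[leRHS]mulr1; apply: ler_pM; [|exact: expR_ge0| |].
  + by apply: mulr_ge0; [exact: normr_ge0|exact: G0].
  + by rewrite -[leRHS]mul1r; apply: ler_wpM2r; [exact: G0|exact: cos_max].
  by rewrite -[leRHS]expR0 ler_expR oppr_le0 mulr_ge0 ?sqr_ge0 ?divr_ge0 ?sqr_ge0.
- exact: integrable_heat_kernel.
Qed.

(** Only the kernel at time [t] is expanded as a Fourier integral. After Fubini the integral in [y]
    is [heat_kernel_charfun] at frequency [- xi], and the two symbols multiply. *)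
Lemma heat_kernel_semigroup x s t : 0 < s -> 0 < t ->
  \int[lam]_y (heat_kernel theta (vsub x y) t * heat_kernel theta y s) =
  heat_kernel theta x (t + s).
Proof.
move=> s0 t0.
have mG : measurable_fun setT (fun y => heat_kernel theta y s).
  by measurability.
have G0 y : 0 <= heat_kernel theta y s by exact: heat_kernel_ge0.
have mst := ms t.
pose F (z : N.-tuple R * N.-tuple R) := C0 * (cos (dot x z.2 - dot z.1 z.2) *
  symbol theta t z.2 * heat_kernel theta z.1 s).
have mF : measurable_fun setT F by rewrite /F; measurability.
have dF y xi : `|F (y, xi)| <= heat_kernel theta y s * (C0 * symbol theta t xi).
  rewrite /F/= 3!normrM (ger0_norm (ltW C0_gt0)) (ger0_norm (G0 _)).
  rewrite (ger0_norm (symbol_ge0 _ _ _))/= [leRHS]mulrC -[leRHS]mulrA.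
  apply: ler_wpM2l; first exact: ltW.
  apply: ler_wpM2r => //.
  by rewrite -[leRHS]mul1r; apply: ler_wpM2r; [exact: symbol_ge0|exact: cos_max].
transitivity (\int[lam]_y \int[lam]_xi F (y, xi)).
  apply: eq_Rintegral => y _; rewrite heat_kernel_symbol -/C0 /F.
  have md : measurable_fun setT (fun eta => dot x eta - dot y eta) by measurability.
  have i1 := isymcos t0 md.
  have E xi : dot (vsub x y) xi = dot x xi - dot y xi.
    by rewrite vsub_affine dotC dot_affine mulN1r addrC !(dotC xi).
  rewrite (_ : \int[lam]_xi _ = \int[lam]_xi (cos (dot x xi - dot y xi) * symbol theta t xi)).
    rewrite -mulrA -RintegralZr; [|exact: measurableT|exact: i1].
    by rewrite -RintegralZl; [|exact: measurableT|exact: (integrableZr measurableT _ i1)].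
  by apply: eq_Rintegral => xi _; rewrite E.
rewrite (Rintegral_fubini mF dF (integrable_heat_kernel s0)
  (integrableZl measurableT C0 (isym t0))) /F/=.
rewrite heat_kernel_symbol -/C0.
have md : measurable_fun setT (dot x) by apply: (@measurable_dot _ _ _ _ (fun=> x) id); measurability.
have ts0 : 0 < t + s by rewrite addr_gt0.
rewrite -RintegralZl; [|exact: measurableT|exact: (isymcos ts0 md)].
apply: eq_Rintegral => xi _; rewrite symbolD.
have E := @heat_kernel_charfun (dot x xi) (affine (-1) (@vzero R N) xi) s s0.
rewrite symbol_reflect in E.
transitivity (\int[lam]_y ((C0 * symbol theta t xi) *
   (cos (dot x xi + dot y (affine (-1) (@vzero R N) xi)) * heat_kernel theta y s))).
  apply: eq_Rintegral => y _; rewrite dot_affine dot0 addr0 mulN1r.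
  by ring.
have iE : lam.-integrable setT (EFin \o (fun y =>
    cos (dot x xi + dot y (affine (-1) (@vzero R N) xi)) * heat_kernel theta y s)).
  apply: (@dominated_integrable _ _ _ lam _ _ _ _ (integrable_heat_kernel s0)).
    by measurability.
  move=> y; rewrite normrM (ger0_norm (G0 _)) -[leRHS]mul1r.
  by apply: ler_wpM2r; [exact: G0|exact: cos_max].
by rewrite RintegralZl; [rewrite E; ring|exact: measurableT|exact: iE].
Qed.

End heat_kernel_fourier.

(** * Bounds for the heat kernel *)

Section heat_kernel_estimates.
Context (R : realType) (N : nat) (theta : R).
Hypothesis htheta : 0 < theta <= 2.
Local Notation lam := (lebesgueN R N).
Local Notation mu := (@lebesgue_measure R).
Implicit Types (x y z xi : N.-tuple R) (rho s t a : R).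

Let th0 : 0 < theta. Proof. by case/andP : htheta. Qed.

Let G0 y t : 0 < t -> 0 <= heat_kernel theta y t.
Proof. exact: heat_kernel_ge0. Qed.

Lemma heat_kernel_scale rho (w : N.-tuple R) : 0 < rho ->
  heat_kernel theta (affine rho (@vzero R N) w) (rho `^ theta) =
  rho ^- N * heat_kernel theta w 1.
Proof.
move=> r0; rewrite !heat_kernel_symbol mulrCA; congr (_ * _).
have i1 : lam.-integrable setT (EFin \o (fun xi => cos (dot w xi) * symbol theta 1 xi)).
  have ms := @measurable_symbol R N theta 1.
  apply: (@dominated_integrable _ _ _ lam _ (symbol theta 1)).
  - by measurability.
  - move=> xi; rewrite normrM (ger0_norm (symbol_ge0 _ _ _)).
    by rewrite -[leRHS]mul1r; apply: ler_wpM2r; [exact: symbol_ge0|exact: cos_max].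
  - exact: integrable_symbol.
have [_] := Rintegral_affine (@vzero R N) (lt0r_neq0 r0) i1.
rewrite (gtr0_norm r0) => E; apply: etrans E.
have e1 xi : dot (affine rho (@vzero R N) w) xi = dot w (affine rho (@vzero R N) xi).
  by rewrite dotC !dot_affine !dot0 !addr0 dotC.
have e2 xi : symbol theta (rho `^ theta) xi = symbol theta 1 (affine rho (@vzero R N) xi).
  by rewrite /symbol enorm_dilate (gtr0_norm r0) mul1r (powRM _ (ltW r0) (enorm_ge0 xi)).
by apply: eq_Rintegral => xi _; rewrite e1 e2.
Qed.

Let symbol_mass : 0 < \int[lam]_xi symbol theta 1 xi.
Proof.
have [iG E] := gauss_fourier 0 (@vzero R N) (@ltr01 R).
have pos : 0 < \int[lam]_xi expR (- (1 * enorm xi ^+ 2)).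
  have -> : \int[lam]_xi expR (- (1 * enorm xi ^+ 2)) =
      \int[lam]_y (cos (0 + dot y (@vzero R N)) * expR (- (1 * enorm y ^+ 2))).
    by apply: eq_Rintegral => xi _; rewrite dot0 addr0 cos0 [RHS]mul1r.
  by rewrite E cos0 mul1r mulr_gt0 ?expR_gt0// exprn_gt0// sqrtr_gt0 divr_gt0 ?pi_gt0.
apply: (@lt_le_trans _ _ (\int[lam]_xi (expR (-1) * expR (- (1 * enorm xi ^+ 2))))).
  rewrite RintegralZl; [|exact: measurableT|exact: iG].
  by rewrite mulr_gt0 ?expR_gt0.
apply: le_Rintegral; [exact: measurableT|exact: (integrableZl measurableT _ iG)| |].
  exact: integrable_symbol.
move=> xi _; rewrite -expRD /symbol ler_expR !mul1r -opprD lerN2.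
have [r1|/ltW r1] := leP (enorm xi) 1.
  apply: (@le_trans _ _ 1); last by rewrite lerDl sqr_ge0.
  have e : 1 `^ theta = 1 :> R by rewrite powR1.
  rewrite -e; apply: ge0_ler_powR; rewrite ?nnegrE ?enorm_ge0//.
  exact: ltW.
apply: (@le_trans _ _ (enorm xi ^+ 2)); last by rewrite lerDr.
rewrite -(powR_mulrn 2 (enorm_ge0 xi)); apply: ler_powR => //.
by case/andP : htheta.
Qed.

(** At time 1 the bound [1 - cos v <= v ^+ 2] shows that the kernel near the origin loses little of
    its value there; scaling gives the other times. The smallness is required coordinatewise, so
    that cubes can be used later. *)
Lemma heat_kernel_lower_bound : exists2 dc : R * R, 0 < dc.1 /\ 0 < dc.2 &
  forall rho x, 0 < rho -> (forall i, `|tnth x i| <= dc.1 * rho) ->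
  dc.2 * rho ^- N <= heat_kernel theta x (rho `^ theta).
Proof.
pose A := \int[lam]_xi symbol theta 1 xi.
have iS : lam.-integrable setT (EFin \o symbol theta 1) by exact: integrable_symbol.
have ms := @measurable_symbol R N theta 1.
have iB : lam.-integrable setT (EFin \o (fun xi => enorm xi ^+ 2 * symbol theta 1 xi)).
  have [C C0 HC] := @sqr_symbol_le R N theta 1 th0 ltr01.
  apply: (@dominated_integrable _ _ _ lam _ (fun xi => C * symbol theta (1 / 2) xi)).
  - by measurability.
  - move=> xi; rewrite ger0_norm; last by apply: mulr_ge0; [exact: sqr_ge0|exact: symbol_ge0].
    apply: le_trans (HC xi); apply: ler_wpM2r; first exact: symbol_ge0.
    by rewrite lerDr.
  - have h2 : (0 : R) < 1 / 2 by rewrite divr_gt0.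
    exact: (integrableZl measurableT C (@integrable_symbol R N theta (1 / 2) th0 h2)).
pose B := \int[lam]_xi (enorm xi ^+ 2 * symbol theta 1 xi).
have B0 : 0 <= B.
  by apply: Rintegral_ge0 => xi _; apply: mulr_ge0; [exact: sqr_ge0|exact: symbol_ge0].
have A0 : 0 < A := symbol_mass.
(* With [dl ^+ 2 = q] the loss [(dl * N%:R) ^+ 2 * B] is at most [A / 2]. *)
pose q : R := A / (2 * (N%:R ^+ 2 * B + 1)).
have q0 : 0 < q by rewrite divr_gt0// mulr_gt0// ltr_wpDl// mulr_ge0.
pose dl := Num.sqrt q.
have C0 : 0 < (2 * pi : R) ^- N by rewrite invr_gt0 exprn_gt0// mulr_gt0// pi_gt0.
exists (dl, (2 * pi) ^- N * (A / 2)) => /=.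
  by split; [rewrite sqrtr_gt0|rewrite mulr_gt0// divr_gt0].
move=> rho x r0 xr.
pose w := affine rho^-1 (@vzero R N) x.
have xE : x = affine rho (@vzero R N) w.
  apply: eq_from_tnth => i; rewrite !tnth_affine !tnth_mktuple; field; exact: lt0r_neq0.
have wd i : `|tnth w i| <= dl.
  rewrite tnth_affine tnth_mktuple addr0 normrM gtr0_norm ?invr_gt0// ler_pdivrMl//.
  by rewrite mulrC.
rewrite {1}xE heat_kernel_scale// mulrC; apply: ler_wpM2l.
  by rewrite invr_ge0 exprn_ge0// ltW.
rewrite heat_kernel_symbol; apply: ler_wpM2l; first exact: ltW.
apply: (@le_trans _ _ (\int[lam]_xi (symbol theta 1 xi -
    (dl * N%:R) ^+ 2 * (enorm xi ^+ 2 * symbol theta 1 xi)))).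
  have iB' := integrableZl measurableT ((dl * N%:R) ^+ 2) iB.
  rewrite RintegralB; [|exact: measurableT|exact: iS|exact: iB'].
  rewrite RintegralZl; [|exact: measurableT|exact: iB].
  rewrite -/A -/B exprMn sqr_sqrtr; last exact: ltW.
  have h : q * (2 * (N%:R ^+ 2 * B + 1)) = A.
    rewrite /q mulfVK// gt_eqF// mulr_gt0// ltr_wpDl// mulr_ge0//.
  by have := ltW q0; nra.
have icos : lam.-integrable setT (EFin \o (fun xi => cos (dot w xi) * symbol theta 1 xi)).
  apply: (@dominated_integrable _ _ _ lam _ (symbol theta 1)) iS; first by measurability.
  move=> xi; rewrite normrM (ger0_norm (symbol_ge0 _ _ _)).
  by rewrite -[leRHS]mul1r; apply: ler_wpM2r; [exact: symbol_ge0|exact: cos_max].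
apply: le_Rintegral; [exact: measurableT| |exact: icos|].
  exact: (integrableB measurableT iS (integrableZl measurableT ((dl * N%:R) ^+ 2) iB)).
move=> xi _; rewrite mulrA -[X in X - _]mul1r -mulrBl; apply: ler_wpM2r.
  exact: symbol_ge0.
have := oneBcos_le_sqr (dot w xi).
have : dot w xi ^+ 2 <= (dl * N%:R) ^+ 2 * enorm xi ^+ 2.
  rewrite -exprMn -(real_normK (num_real (dot w xi))) ler_sqr ?nnegrE//; last first.
    by rewrite mulr_ge0 ?enorm_ge0// mulr_ge0// sqrtr_ge0.
  apply: le_trans (ler_norm_sum _ _ _) _.
  apply: (@le_trans _ _ (\sum_(i < N) (dl * enorm xi))).
    by apply: ler_sum => i _; rewrite normrM ler_pM ?wd ?tnth_le_enorm.
  by rewrite sumr_const card_ord -[leLHS]mulr_natl mulrCA mulrA.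
lra.
Qed.

Lemma heat_kernel_mass s : 0 < s -> \int[lam]_y heat_kernel theta y s = 1.
Proof.
move=> s0; have := @heat_kernel_charfun R N theta htheta 0 (@vzero R N) s s0.
rewrite cos0 mul1r /symbol enorm0 powR0 ?(lt0r_neq0 th0)// mulr0 oppr0 expR0 => E.
by rewrite -[RHS]E; apply: eq_Rintegral => y _; rewrite dot0 addr0 cos0 mul1r.
Qed.

Let unit_vec (i : 'I_N) (r : R) : N.-tuple R := [tuple if j == i then r else 0 | j < N].

Let dot_unit y i r : dot y (unit_vec i r) = r * tnth y i.
Proof.
rewrite /dot (bigD1 i)//= tnth_mktuple eqxx big1 ?addr0 1?mulrC// => j ji.
by rewrite tnth_mktuple (negbTE ji) mulr0.
Qed.

Let enorm_unit i r : enorm (unit_vec i r) = `|r|.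
Proof.
rewrite /enorm (bigD1 i)//= tnth_mktuple eqxx big1 ?addr0 ?sqrtr_sqr// => j ji.
by rewrite tnth_mktuple (negbTE ji) expr0n.
Qed.

(* [|y_i| ^ a] is a mixture of the functions [1 - cos (r * y_i)], whose integrals
   against the kernel are [1 - expR (- r ^ theta)]. *)
Let coordinate_moment a i : 0 < a -> a < theta ->
  lam.-integrable setT (EFin \o (fun y => `|tnth y i| `^ a * heat_kernel theta y 1)).
Proof.
move=> a0 at_; have iG := @integrable_heat_kernel R N theta htheta 1 ltr01.
have a2 : 0 < a < 2 by rewrite a0 (lt_le_trans at_)//; case/andP : htheta.
have [c c0 Hc] := integral_oneBcos a2.
pose F (z : N.-tuple R * R) := (1 - cos (tnth z.1 i * expR z.2)) * expR (- (a * z.2)) *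
  heat_kernel theta z.1 1.
have mF : measurable_fun setT F by rewrite /F; measurability.
have F0 (q : N.-tuple R * R) : 0 <= F q.
  by apply: mulr_ge0; [rewrite mulr_ge0 ?expR_ge0 ?oneBcos_ge0|exact: G0].
have mG : measurable_fun setT (fun y => heat_kernel theta y 1) by measurability.
apply/integrableP; split; first by measurability.
have E1 y : (`|(`|tnth y i| `^ a * heat_kernel theta y 1)%:E| =
    c^-1%:E * \int[mu]_w (F (y, w))%:E)%E.
  have [iy Ey] := Hc (tnth y i).
  have iF : mu.-integrable setT (EFin \o (fun w => F (y, w))).
    exact: (integrableZr measurableT (heat_kernel theta y 1) iy).
  rewrite -[X in (_ * X)%E]fineK; last exact: (integrable_fin_num measurableT iF).
  rewrite -/(Rintegral mu setT (fun w => F (y, w))) /F/=.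
  rewrite RintegralZr; [|exact: measurableT|exact: iy].
  rewrite Ey ger0_norm; last by apply: mulr_ge0; [exact: powR_ge0|exact: G0].
  by rewrite -EFinM -[c * _ * _]mulrA (mulKf (lt0r_neq0 c0)).
rewrite (eq_integral (fun y => c^-1%:E * \int[mu]_w (F (y, w))%:E)%E); last first.
  by move=> y _; exact: E1.
have mEF : measurable_fun setT (EFin \o F) by exact/measurable_EFinP.
have EF0 (q : N.-tuple R * R) : (0 <= (EFin \o F) q)%E by rewrite lee_fin.
have mI : measurable_fun setT (fun y => (\int[mu]_w (F (y, w))%:E)%E).
  exact: (@measurable_fun_fubini_tonelli_F _ _ _ _ R mu (EFin \o F) mEF EF0).
rewrite ge0_integralZl => [|//|//|y _|]; last 2 first.
- by apply: integral_ge0 => w _; rewrite lee_fin.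
- by rewrite lee_fin invr_ge0 ltW.
apply: lte_mul_pinfty; rewrite ?lee_fin ?invr_ge0 ?(ltW c0)//.
have -> : (\int[lam]_y \int[mu]_w (F (y, w))%:E = \int[mu]_w \int[lam]_y (F (y, w))%:E)%E.
  exact: (@fubini_tonelli _ _ _ _ R lam mu (EFin \o F) mEF EF0).
pose phi s := 1 - expR (- s `^ theta).
have mphi : measurable_fun setT phi by rewrite /phi; measurability.
have iphi : mu.-integrable setT (EFin \o (fun w => phi (expR w) * expR (- (a * w)))).
  have p0 s : 0 <= phi s.
    by rewrite subr_ge0 -[leRHS]expR0 ler_expR oppr_le0 powR_ge0.
  apply: (@integrable_exp_weight R a theta 1); rewrite ?a0//.
  - by move=> s s0; rewrite ger0_norm// /phi lerBlDr lerDl expR_ge0.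
  - move=> s s0; rewrite ger0_norm// mul1r /phi lerBlDr -lerBlDl.
    exact: expR_ge1Dx.
have E2 w : (\int[lam]_y (F (y, w))%:E = (phi (expR w) * expR (- (a * w)))%:E)%E.
  have ic : lam.-integrable setT (EFin \o (fun y =>
      cos (0 + dot y (unit_vec i (expR w))) * heat_kernel theta y 1)).
    apply: (@dominated_integrable _ _ _ lam _ _ _ _ iG); first by measurability.
    move=> y; rewrite normrM (ger0_norm (G0 _ ltr01)) -[leRHS]mul1r.
    by apply: ler_wpM2r; [exact: G0|exact: cos_max].
  have iD := integrableZl measurableT (expR (- (a * w))) (integrableB measurableT iG ic).
  have FE y : F (y, w) = expR (- (a * w)) * (heat_kernel theta y 1 -
      cos (0 + dot y (unit_vec i (expR w))) * heat_kernel theta y 1).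
    by rewrite /F/= add0r dot_unit [expR w * _]mulrC; ring.
  rewrite (eq_integral (fun y => (expR (- (a * w)) * (heat_kernel theta y 1 -
      cos (0 + dot y (unit_vec i (expR w))) * heat_kernel theta y 1))%:E)); last first.
    by move=> y _; rewrite FE.
  rewrite -[LHS]fineK; last exact: (integrable_fin_num measurableT iD).
  congr EFin; rewrite -/(Rintegral lam setT (fun y => expR (- (a * w)) * (heat_kernel theta y 1 -
      cos (0 + dot y (unit_vec i (expR w))) * heat_kernel theta y 1))).
  rewrite RintegralZl; [|exact: measurableT|exact: (integrableB measurableT iG ic)].
  rewrite RintegralB; [|exact: measurableT|exact: iG|exact: ic].
  rewrite heat_kernel_mass// heat_kernel_charfun// cos0 mul1r /symbol enorm_unit.
  by rewrite mul1r (ger0_norm (expR_ge0 _)) mulrC.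
have -> : (\int[mu]_w \int[lam]_y (F (y, w))%:E =
    \int[mu]_w (phi (expR w) * expR (- (a * w)))%:E)%E.
  by apply: eq_integral => w _; exact: E2.
exact: (integrable_lty measurableT iphi).
Qed.

Let powR_sum_le a y : 0 < a -> enorm y `^ a <= N%:R `^ a * \sum_(i < N) `|tnth y i| `^ a.
Proof.
move=> a0; have s0 : 0 <= \sum_(i < N) `|tnth y i| `^ a.
  by apply: sumr_ge0 => i _; exact: powR_ge0.
have [[i0]|/forallNP h] := pselect (exists i : 'I_N, true); last first.
  have -> : enorm y = 0.
    by rewrite /enorm big1 ?sqrtr0// => i; case: (h i).
  by rewrite powR0 ?gt_eqF// mulr_ge0// powR_ge0.
move=> _; have [i _ imax] := @arg_maxP _ _ _ i0 xpredT (fun i => `|tnth y i|) isT.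
have h : enorm y <= N%:R * `|tnth y i|.
  apply: le_trans (enorm_le_sum _) _; apply: (@le_trans _ _ (\sum_(j < N) `|tnth y i|)).
    by apply: ler_sum => j _; exact: imax.
  by rewrite sumr_const card_ord mulr_natl.
apply: (@le_trans _ _ ((N%:R * `|tnth y i|) `^ a)).
  by apply: ge0_ler_powR; rewrite ?nnegrE ?enorm_ge0 ?mulr_ge0// ltW.
rewrite powRM//; apply: ler_wpM2l; first exact: powR_ge0.
by rewrite (bigD1 i)//= lerDl; apply: sumr_ge0 => j _; exact: powR_ge0.
Qed.

(** For [theta < 2] the coordinate moments are summed; at [theta = 2] the kernel is an explicit
    Gaussian and every order is allowed. *)
Lemma heat_kernel_moment a : 0 < a -> (theta < 2 -> a < theta) ->
  lam.-integrable setT (EFin \o (fun y => enorm y `^ a * heat_kernel theta y 1)).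
Proof.
move=> a0 ha; have [t2|t2] := ltP theta 2.
  have at_ := ha t2.
  have [iS _] := Rintegral_sum (index_enum 'I_N)
    (fun i => coordinate_moment i a0 at_).
  apply: (@dominated_integrable _ _ _ lam _ _ _ _ (integrableZl measurableT (N%:R `^ a) iS)).
    by measurability.
  move=> y; rewrite ger0_norm; last by apply: mulr_ge0; [exact: powR_ge0|exact: G0].
  apply: (@le_trans _ _ (N%:R `^ a * (\sum_(i < N) `|tnth y i| `^ a) * heat_kernel theta y 1)).
    by apply: ler_wpM2r; [exact: G0|exact: powR_sum_le].
  by rewrite -mulrA mulr_suml.
have t2E : theta = 2 by apply/eqP; rewrite eq_le t2 andbT; case/andP : htheta.
pose K : R := (2 * pi) ^- N * Num.sqrt pi ^+ N.
have GE y : heat_kernel theta y 1 = K * expR (- (enorm y ^+ 2 / 4)).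
  have [_ E] := gauss_fourier 0 y (@ltr01 R).
  rewrite heat_kernel_symbol /K -mulrA; congr (_ * _).
  rewrite divr1 cos0 mul1r mulr1 in E; rewrite -E; apply: eq_Rintegral => xi _.
  rewrite add0r dotC; congr (cos _ * _).
  by rewrite /symbol t2E (powR_mulrn 2 (enorm_ge0 xi)).
have K0 : 0 <= K by rewrite mulr_ge0 ?exprn_ge0// invr_ge0 exprn_ge0// mulr_ge0// pi_ge0.
(* The bound for exponent [2 / a], applied to [r = |y| ^ a], costs [expR (|y| ^+ 2 / 8)], half of
   the Gaussian rate [1 / 4]. *)
have e8 : (0 : R) < 1 / 8 by rewrite divr_gt0.
have a20 : 0 < 2 / a by rewrite divr_gt0.
have [C C0 HC] := sqr_le_expR_powR a20 e8.
have [iG _] := gauss_fourier 0 (@vzero R N) e8.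
apply: (@dominated_integrable _ _ _ lam _ (fun y => (C * K) * expR (- (1 / 8 * enorm y ^+ 2)))).
- by measurability.
- move=> y; rewrite ger0_norm; last by apply: mulr_ge0; [exact: powR_ge0|exact: G0].
  apply: (@le_trans _ _ (K * (C * expR (- (1 / 8 * enorm y ^+ 2))))); last first.
    by rewrite mulrA [K * C]mulrC.
  rewrite GE mulrCA; apply: ler_wpM2l => //.
  have := HC (enorm y `^ a) (powR_ge0 _ _).
  have -> : (enorm y `^ a) `^ (2 / a) = enorm y ^+ 2.
    by rewrite -powRrM mulrCA divff ?mulr1 ?gt_eqF// (powR_mulrn 2 (enorm_ge0 y)).
  move=> h; apply: (@le_trans _ _ (C * expR (1 / 8 * enorm y ^+ 2) * expR (- (enorm y ^+ 2 / 4)))).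
    apply: ler_wpM2r; first exact: expR_ge0.
    by apply: le_trans h; have := sqr_ge0 (enorm y `^ a - 1); nra.
  rewrite -mulrA -expRD; apply: ler_wpM2l; first exact: ltW.
  by rewrite ler_expR; lra.
- exact: (integrableZl measurableT _ iG).
Qed.

(** Substituting [y = z - rho * w] reduces to time 1, where |z - rho * w|^a is at most a constant
    times (|z| + rho)^a * (1 + |w|^a) and the moment of order [a] is finite. *)
Lemma heat_kernel_weight_bound a : 0 < a -> (theta < 2 -> a < theta) ->
  exists2 W, 0 < W & forall z rho, 0 < rho ->
  (\int[lam]_y (heat_kernel theta (vsub z y) (rho `^ theta) * enorm y `^ a)%:E
     <= (W * (enorm z + rho) `^ a)%:E)%E.
Proof.
move=> a0 ha; have iM := heat_kernel_moment a0 ha.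
have iG := @integrable_heat_kernel R N theta htheta 1 ltr01.
pose M := \int[lam]_y (enorm y `^ a * heat_kernel theta y 1).
have M0 : 0 <= M.
  by apply: Rintegral_ge0 => y _; apply: mulr_ge0; [exact: powR_ge0|exact: G0].
pose k : R := (2 * N%:R) `^ a.
have k0 : 0 <= k by exact: powR_ge0.
exists (k * (1 + M) + 1).
  by rewrite ltr_wpDl// mulr_ge0// addr_ge0.
move=> z rho r0.
pose f y := (heat_kernel theta (vsub z y) (rho `^ theta) * enorm y `^ a)%:E.
have mf : measurable_fun setT f by rewrite /f; measurability.
have rt0 : 0 < rho `^ theta by exact: powR_gt0.
have f0 y : (0 <= f y)%E.
  by rewrite lee_fin; apply: mulr_ge0; [exact: G0|exact: powR_ge0].
have nr0 : - rho != 0 by rewrite oppr_eq0 lt0r_neq0.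
have := ge0_integral_affine z nr0 mf f0.
rewrite normrN gtr0_norm// => E.
have -> : (\int[lam]_x f x = (rho ^+ N)%:E * \int[lam]_x f (affine (- rho) z x))%E.
  by rewrite E muleA -EFinM mulfV ?mul1e// expf_neq0// lt0r_neq0.
pose P := (enorm z + rho) `^ a.
have P0 : 0 <= P by exact: powR_ge0.
have iS : lam.-integrable setT (EFin \o (fun w => heat_kernel theta w 1 +
    enorm w `^ a * heat_kernel theta w 1)).
  exact: (integrableD measurableT iG iM).
have iT := integrableZl measurableT (k * P) iS.
have fle w : (f (affine (- rho) z w) <= (rho ^- N)%:E * (k * P *
    (heat_kernel theta w 1 + enorm w `^ a * heat_kernel theta w 1))%:E)%E.
  rewrite -EFinM lee_fin.
  have -> : vsub z (affine (- rho) z w) = affine rho (@vzero R N) w.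
    by apply: eq_from_tnth => i; rewrite !tnth_mktuple; ring.
  rewrite (heat_kernel_scale _ r0) -[leLHS]mulrA; apply: ler_wpM2l.
    by rewrite invr_ge0 exprn_ge0// ltW.
  have h : enorm (affine (- rho) z w) `^ a <= k * P * (1 + enorm w `^ a).
    have e0 := enorm_ge0 w; have z0 := enorm_ge0 z.
    apply: (@le_trans _ _ ((N%:R * (enorm z + rho) * (1 + enorm w)) `^ a)).
      apply: ge0_ler_powR; rewrite ?nnegrE ?enorm_ge0 ?(ltW a0)//.
        by rewrite !mulr_ge0 ?addr_ge0 ?(ltW r0).
      apply: le_trans (enorm_affine_le _ _ _) _; rewrite normrN gtr0_norm//.
      rewrite -mulrA ler_wpM2l//; have := ltW r0; nra.
    have h1 : (1 + enorm w) `^ a <= 2 `^ a * (1 + enorm w `^ a).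
      have p1 : 0 <= enorm w `^ a by exact: powR_ge0.
      have [w1|/ltW w1] := leP (enorm w) 1.
        apply: (@le_trans _ _ (2 `^ a)); last by rewrite ler_peMr ?powR_ge0// lerDl.
        by apply: ge0_ler_powR; rewrite ?nnegrE ?addr_ge0 ?(ltW a0)//; lra.
      apply: (@le_trans _ _ ((2 * enorm w) `^ a)).
        by apply: ge0_ler_powR; rewrite ?nnegrE ?addr_ge0 ?mulr_ge0 ?(ltW a0)//; lra.
      by rewrite powRM// ler_wpM2l ?powR_ge0// lerDr.
    rewrite !powRM ?mulr_ge0 ?addr_ge0 ?(ltW r0)// /k powRM// -/P.
    rewrite [2 `^ a * _]mulrC -!mulrA ler_wpM2l ?powR_ge0//.
    by rewrite [leRHS]mulrCA ler_wpM2l.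
  rewrite mulrC -[X in X + _]mul1r -mulrDl mulrA; apply: ler_wpM2r => //.
  exact: G0.
apply: (@le_trans _ _ ((rho ^+ N)%:E * \int[lam]_w ((rho ^- N)%:E * (k * P *
    (heat_kernel theta w 1 + enorm w `^ a * heat_kernel theta w 1))%:E))%E).
  apply: lee_wpmul2l; first by rewrite lee_fin exprn_ge0// ltW.
  exact: ge0_le_integral_nomeas.
have mT : measurable_fun setT (fun w : N.-tuple R => (k * P *
    (heat_kernel theta w 1 + enorm w `^ a * heat_kernel theta w 1))%:E).
  by measurability.
rewrite ge0_integralZl => [|//|//|w _|]; last 2 first.
- rewrite lee_fin; apply: mulr_ge0; first by rewrite mulr_ge0.
  by apply: addr_ge0; [exact: G0|apply: mulr_ge0; [exact: powR_ge0|exact: G0]].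
- by rewrite lee_fin invr_ge0 exprn_ge0// ltW.
rewrite muleA -EFinM mulfV ?mul1e; last by rewrite expf_neq0// lt0r_neq0.
rewrite -[leLHS]fineK; last exact: (integrable_fin_num measurableT iT).
rewrite lee_fin -/(Rintegral lam setT (fun w => k * P *
    (heat_kernel theta w 1 + enorm w `^ a * heat_kernel theta w 1))).
rewrite RintegralZl; [|exact: measurableT|exact: iS].
rewrite RintegralD; [|exact: measurableT|exact: iG|exact: iM].
rewrite heat_kernel_mass// -/M mulrAC; apply: ler_wpM2r => //.
by rewrite lerDl.
Qed.

Lemma heat_kernel_semigroupE x z s t : 0 < s -> 0 < t ->
  (\int[lam]_y (heat_kernel theta (vsub x y) t * heat_kernel theta (vsub y z) s)%:E =
   (heat_kernel theta (vsub x z) (t + s))%:E)%E.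
Proof.
move=> s0 t0.
pose f y := (heat_kernel theta (vsub x y) t * heat_kernel theta (vsub y z) s)%:E.
have mf : measurable_fun setT f by rewrite /f; measurability.
have f0 y : (0 <= f y)%E.
  by rewrite lee_fin; apply: mulr_ge0; exact: G0.
have := ge0_integral_affine z (oner_neq0 R) mf f0.
rewrite normr1 expr1n invr1 mul1e => <-.
have iG := @integrable_heat_kernel R N theta htheta s s0.
have e1 y : vsub x (affine 1 z y) = vsub (vsub x z) y.
  by apply: eq_from_tnth => i; rewrite !tnth_mktuple; ring.
have e2 y : vsub (affine 1 z y) z = y.
  by apply: eq_from_tnth => i; rewrite !tnth_mktuple; ring.
have E1 y : f (affine 1 z y) =
    (heat_kernel theta (vsub (vsub x z) y) t * heat_kernel theta y s)%:E.
  by rewrite /f e1 e2.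
rewrite (eq_integral (fun y =>
  (heat_kernel theta (vsub (vsub x z) y) t * heat_kernel theta y s)%:E)); last first.
  by move=> y _; exact: E1.
rewrite -(heat_kernel_semigroup htheta (vsub x z) s0 t0) fineK//.
have iP : lam.-integrable setT (EFin \o (fun y =>
    heat_kernel theta (vsub (vsub x z) y) t * heat_kernel theta y s)).
  apply: (@dominated_integrable _ _ _ lam _ _ _ _ (integrableZl measurableT
    ((2 * pi) ^- N * \int[lam]_xi symbol theta t xi) iG)).
    by measurability.
  move=> y; rewrite normrM [X in _ * X]ger0_norm; last exact: G0.
  by apply: ler_wpM2r; [exact: G0|exact: heat_kernel_le0].
exact: (integrable_fin_num measurableT iP).
Qed.

End heat_kernel_estimates.

(** * Borel representatives and null slices *)

Section completed_measurability.
Context d (T : measurableType d) (R : realType) (m : {measure set T -> \bar R}).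

(** Each superlevel set of [u] is Borel up to a null set. The supremum of the rational levels over
    the Borel parts stays below [u] everywhere on [D] and can miss a finite value of [u] only on the
    union of the null parts. *)
Lemma completed_measurable_fun_borel (D : set T) (u : T -> \bar R) :
  completed_measurable_fun m D u -> (forall z, D z -> 0 <= u z)%E ->
  exists w : T -> R, [/\ measurable_fun setT w, forall z, 0 <= w z,
    (forall z, D z -> ((w z)%:E <= u z)%E) &
    {ae m, forall z, D z -> (u z < +oo)%E -> u z = (w z)%:E}].
Proof.
move=> mu u0.
(* Absolute values keep the levels nonnegative while still enumerating every nonnegative
   rational. *)
pose q (n : nat) : R := `|ratr (odflt (0%R : rat) (unpickle n))|.
have hq n : exists AN : set T * set T, [/\ measurable AN.1, m.-negligible AN.2 &
    AN.1 `|` AN.2 = D `&` u @^-1` `](q n)%:E, +oo[].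
  have [A mA [B nB AB]] := mu _ (emeasurable_itv `](q n)%:E, +oo[).
  by exists (A, B).
have [AN hAN] := choice hq.
have mA n : measurable (AN n).1 by case: (hAN n).
pose f n z : \bar R := (q n * \1_((AN n).1) z)%:E.
have f0 n z : (0 <= f n z)%E.
  rewrite /f lee_fin indicE; apply: mulr_ge0; [exact: normr_ge0|exact: ler0n].
pose v z := esups (f ^~ z) 0%N.
have mv : measurable_fun setT v.
  apply: measurable_fun_esups => n; apply/measurable_EFinP.
  by apply: measurable_funM; [exact: measurable_cst|exact: measurable_indic].
have fv n z : (f n z <= v z)%E by apply: ereal_sup_ubound; exists n.
have v0 z : (0 <= v z)%E by apply: le_trans (fv 0%N z).
have vu z : D z -> (v z <= u z)%E.
  move=> Dz; apply: ub_ereal_sup => _ [n _ <-]; rewrite /f indicE.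
  case: (boolP (z \in _)) => [|_]; last by rewrite mulr0 u0.
  rewrite inE => Az; rewrite mulr1.
  have : (D `&` u @^-1` `](q n)%:E, +oo[) z by case: (hAN n) => _ _ <-; left.
  by case=> _ /=; rewrite in_itv/= andbT; exact: ltW.
exists (fun z => fine (v z)); split.
- exact: measurableT_comp.
- by move=> z; exact: fine_ge0.
- move=> z Dz; have := vu z Dz; have := v0 z.
  (* Where [v] is infinite [fine] gives 0, which is still below [u]. *)
  by case: (v z) => [r _|_ _|//]//=; exact: u0.
have nB : m.-negligible (\bigcup_n (AN n).2).
  by apply: negligible_bigcup => n; case: (hAN n).
apply: negligibleS nB => z /= /not_implyP[Dz /not_implyP[uoo uv]].
apply: contrapT => zB; apply: uv.
have vuz := vu z Dz; have vfin : v z \is a fin_num.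
  by rewrite ge0_fin_numE// (le_lt_trans vuz).
rewrite fineK//; apply/eqP; rewrite eq_le vuz andbT leNgt; apply/negP => vltu.
have ufin : u z \is a fin_num by rewrite ge0_fin_numE ?u0.
move: vltu; rewrite -(fineK vfin) -(fineK ufin) lte_fin => /rat_in_itvoo[c].
rewrite in_itv/= => /andP[vc cu].
have c0 : 0 <= ratr c :> R by apply: le_trans (ltW vc); exact: fine_ge0.
have qc : q (pickle c) = ratr c by rewrite /q pickleK/= ger0_norm.
have : (D `&` u @^-1` `](q (pickle c))%:E, +oo[) z.
  by split => //=; rewrite in_itv/= andbT qc -(fineK ufin) lte_fin.
case: (hAN (pickle c)) => _ _ <- [Az|Bz]; last by apply: zB; exists (pickle c).
have := fv (pickle c) z; rewrite /f indicE mem_set// mulr1 qc -(fineK vfin) lee_fin.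
by rewrite leNgt vc.
Qed.

End completed_measurability.

Section null_slices.
Context d1 d2 (T1 : measurableType d1) (T2 : measurableType d2) (R : realType).
Variables (m1 : {sigma_finite_measure set T1 -> \bar R})
  (m2 : {sigma_finite_measure set T2 -> \bar R}).

Lemma ae_product_slices (Q : T1 * T2 -> Prop) :
  {ae (m1 \x m2)%E, forall z, Q z} ->
  {ae m2, forall s, {ae m1, forall x, Q (x, s)}}.
Proof.
move=> [Z [mZ Z0 QZ]].
have mI : measurable_fun setT (EFin \o \1_Z : T1 * T2 -> \bar R).
  exact/measurable_EFinP/measurable_indic.
have I0 z : (0 <= (EFin \o \1_Z) z :> \bar R)%E by rewrite lee_fin.
pose G s := (\int[m1]_x (EFin \o \1_Z) (x, s))%E.
have mG : measurable_fun setT G.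
  exact: (@measurable_fun_fubini_tonelli_G _ _ _ _ R m1 (EFin \o \1_Z) mI I0).
have G0 s : (0 <= G s)%E by exact: integral_ge0.
have GE : (\int[m2]_s `|G s| = 0)%E.
  rewrite -[RHS]Z0 -[Z in RHS]setIT -integral_indic//.
  rewrite (@fubini_tonelli2 _ _ _ _ R m1 m2 (EFin \o \1_Z) mI I0).
  by apply: eq_integral => s _; rewrite gee0_abs.
have /ae_eq_integral_abs := GE.
move=> /(_ measurableT mG); apply: filterS => s /(_ I) /= Gs.
exists (ysection Z s); split.
- exact: measurable_ysection.
- move: Gs; rewrite /G.
  rewrite (eq_integral (EFin \o \1_(ysection Z s))); last first.
    by move=> x _ /=; rewrite !indicE; congr (_%:R%:E); rewrite mem_ysection.
  by rewrite integral_indic ?setIT//; exact: measurable_ysection.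
- by move=> x /= nQ; rewrite /ysection/= inE; exact: QZ.
Qed.

End null_slices.

(** * Discrete differential inequalities *)

Section growth_lemmas.
Context (R : realType).

Lemma powR_invE (y r : R) : 0 <= y -> y^-1 `^ r = (y `^ r)^-1.
Proof. by move=> y0; rewrite -powR_inv1// -powRrM mulN1r powRN. Qed.

Lemma powR_divE (x y r : R) : 0 <= x -> 0 <= y -> (x / y) `^ r = x `^ r / y `^ r.
Proof. by move=> x0 y0; rewrite powRM ?invr_ge0// powR_invE. Qed.

Lemma powR_exprn (x r : R) n : 0 <= x -> (x ^+ n) `^ r = (x `^ r) ^+ n.
Proof.
by move=> x0; rewrite -(powR_mulrn n x0) -(powR_mulrn n (powR_ge0 x r)) powRAC.
Qed.

Lemma powR_gt1M (p x : R) : 1 < p -> 0 <= x -> x `^ p = x * x `^ (p - 1).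
Proof. by move=> p1 x0; rewrite mulr_powRB1// (lt_trans _ p1). Qed.

Lemma young_lower_bound (p f W g : R) : 1 < p -> 0 <= f -> 0 < W -> 0 <= g ->
  (forall L, 0 < L -> f <= L * W + (L `^ (p - 1))^-1 * g) ->
  f `^ p / (2 `^ p * W `^ (p - 1)) <= g.
Proof.
move=> p1 f0 W0 g0 h.
have W10 : 0 < W `^ (p - 1) by exact: powR_gt0.
have p2 : 0 < (2 : R) `^ (p - 1) by exact: powR_gt0.
move: f0; rewrite le_eqVlt => /orP[/eqP <-|f0].
  by rewrite powR0 ?mul0r// gt_eqF// (lt_trans _ p1).
(* This [L] makes [L * W] half of [f]; the other half bounds [g] from below. *)
have L0 : 0 < f / (2 * W) by rewrite divr_gt0// mulr_gt0.
have := h _ L0; set L := f / (2 * W).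
have Lp : 0 < L `^ (p - 1) by exact: powR_gt0.
have -> : L * W = f / 2 by rewrite /L; field; rewrite gt_eqF.
rewrite -lerBlDl (_ : f - f / 2 = f / 2); last by field.
rewrite ler_pdivlMl// => hg; apply: le_trans hg.
rewrite /L powR_divE ?(ltW f0) ?mulr_ge0 ?(ltW W0)// powRM ?(ltW W0)//.
rewrite (powR_gt1M p1 (ltW f0)) (powR_gt1M p1 (ler0n R 2)).
rewrite le_eqVlt; apply/orP; left; apply/eqP.
by field; rewrite !gt_eqF.
Qed.

(* From the level [2 ^ k * F s] the function doubles within time [d * q ^ k],
   and these times are summable. *)
Lemma blowup_bound (p kappa A K : R) (F : R -> R) : 1 < p -> 0 < kappa ->
  (forall s, 0 < s < A -> 0 <= F s <= K) ->
  (forall s t, 0 < s -> s < t -> t < A -> F s + (t - s) * kappa * F s `^ p <= F t) ->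
  forall s, 0 < s < A ->
  kappa * (A - s) * F s `^ (p - 1) <= (1 - 2 `^ (1 - p))^-1.
Proof.
move=> p1 k0 FK FF s /andP[s0 sA].
set q : R := 2 `^ (1 - p).
have q0 : 0 < q by exact: powR_gt0.
have q1 : q < 1.
  have l2 : 0 < ln (2 : R) by rewrite ln_gt0 ?ltr1n.
  by rewrite /q /powR gt_eqF// -[ltRHS]expR0 ltr_expR; nra.
have F0 : 0 <= F s by have := FK s; rewrite s0 sA => /(_ isT)/andP[].
have b0 : 0 < (1 - q)^-1 by rewrite invr_gt0 subr_gt0.
move: F0; rewrite le_eqVlt => /orP[/eqP <-|F0].
  by rewrite powR0 ?mulr0 ?(ltW b0)// subr_eq0 gt_eqF.
have Fp0 : 0 < F s `^ (p - 1) by exact: powR_gt0.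
rewrite leNgt; apply/negP => h.
pose d : R := (kappa * F s `^ (p - 1))^-1.
have d0 : 0 < d by rewrite invr_gt0 mulr_gt0.
(* The negated claim says that all doublings together fit before [A], which contradicts the bound
   [K]. *)
have hA : d * (1 - q)^-1 < A - s.
  by rewrite ltr_pdivrMl ?mulr_gt0// mulrAC.
pose t k := s + d * ((1 - q ^+ k) / (1 - q)).
have tA k : t k < A.
  rewrite /t -ltrBrDl (le_lt_trans _ hA)// ler_wpM2l ?(ltW d0)//.
  by rewrite ler_piMl ?(ltW b0)// lerBlDr lerDl exprn_ge0// ltW.
have tS k : t k.+1 = t k + d * q ^+ k.
  by rewrite /t exprS; field; rewrite subr_eq0 gt_eqF.
have ts k : 0 < t k.
  rewrite /t ltr_pwDl// !mulr_ge0 ?(ltW d0) ?(ltW b0)// subr_ge0.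
  by rewrite exprn_ile1 ?(ltW q0)// ltW.
have qk k : 0 < q ^+ k by rewrite exprn_gt0.
have grow k : 2 ^+ k * F s <= F (t k).
  elim: k => [|k IH]; first by rewrite /t expr0 mul1r subrr mul0r mulr0 addr0.
  have tt : t k < t k.+1 by rewrite tS ltrDl mulr_gt0.
  apply: le_trans (FF _ _ (ts k) tt (tA k.+1)).
  have -> : t k.+1 - t k = d * q ^+ k by rewrite tS addrAC subrr add0r.
  have e0 : 0 <= 2 ^+ k * F s by rewrite mulr_ge0 ?exprn_ge0// ltW.
  have h1 : (2 ^+ k * F s) `^ p <= F (t k) `^ p.
    have IH' := le_trans e0 IH.
    by apply: ge0_ler_powR; rewrite ?nnegrE//; lra.
  have h2 : d * q ^+ k * kappa * (2 ^+ k * F s) `^ p = 2 ^+ k * F s.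
    rewrite powRM ?exprn_ge0 ?(ltW F0)// powR_exprn// (powR_gt1M p1 (ltW F0)).
    have -> : d * q ^+ k * kappa * ((2 `^ p) ^+ k * (F s * F s `^ (p - 1))) =
       (d * (kappa * F s `^ (p - 1))) * (q ^+ k * (2 `^ p) ^+ k) * F s by ring.
    rewrite mulVf ?gt_eqF ?mulr_gt0// mul1r -exprMn /q -powRD; last first.
      by apply/implyP => _; rewrite pnatr_eq0.
    by rewrite subrK powRr1.
  apply: (@le_trans _ _ (2 ^+ k * F s + 2 ^+ k * F s)).
    by rewrite exprS; lra.
  apply: lerD IH _; rewrite -{1}h2; apply: ler_wpM2l h1.
  by rewrite !mulr_ge0 ?(ltW d0) ?(ltW k0) ?(ltW (qk k)).
have K0 : 0 <= K / F s.
  rewrite divr_ge0 ?(ltW F0)//; have := FK s; rewrite s0 sA => /(_ isT)/andP[].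
  exact: le_trans.
have := grow (Num.bound (K / F s)); set n := Num.bound _.
rewrite leNgt => /negP; apply.
have /andP[_ Fn] : 0 <= F (t n) <= K by apply: FK; rewrite ts tA.
apply: le_lt_trans Fn _; rewrite -ltr_pdivrMr//.
apply: lt_le_trans (archi_boundP K0) _.
by rewrite -natrX ler_nat ltnW// ltn_expl.
Qed.

Lemma ln1D_ge (x : R) : 0 <= x -> x / (1 + x) <= ln (1 + x).
Proof.
move=> x0; have x1 : 0 < 1 + x by rewrite ltr_pwDl.
have v0 : 0 < (1 + x)^-1 by rewrite invr_gt0.
have := @le_ln1Dx R ((1 + x)^-1 - 1).
rewrite (addrC 1 (_ - 1)) subrK lnV ?posrE// => h.
have : - ln (1 + x) <= (1 + x)^-1 - 1 by apply: h; rewrite ltrBDl subrr.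
have -> : x / (1 + x) = 1 - (1 + x)^-1 by field; rewrite gt_eqF.
lra.
Qed.

(** A discrete form of e' >= c * e^(1 + q), for which e^(-q) decreases at a constant rate. The bound
    [C] keeps the decrement of [v k = e k ^ (- q)] uniform; since [v n >= 0], [n] decrements fit
    into [v 0]. *)
Lemma discrete_decay (q c C : R) : 0 < q -> 0 < c -> 0 < C ->
  exists2 D, 0 < D & forall (e : nat -> R) n,
  (forall k, (k <= n)%N -> 0 <= e k <= C) ->
  (forall k, (k < n)%N -> e k + c * e k `^ (1 + q) <= e k.+1) ->
  n%:R * e 0%N `^ q <= D.
Proof.
move=> q0 c0 C0; pose B := C `^ q; have B0 : 0 < B by exact: powR_gt0.
(* With [P = e k ^ q <= B], the growth factor (1 + c * P)^q is at least 1 + q * ln (1 + c * P),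
   hence at least [1 + r * P]. *)
pose r := q * c / (1 + c * B).
have cB : 0 < 1 + c * B by rewrite ltr_pwDl// mulr_ge0 ?ltW.
have r0 : 0 < r by rewrite divr_gt0// mulr_gt0.
have rB : 0 < 1 + r * B by rewrite ltr_pwDl// mulr_ge0 ?ltW.
exists ((1 + r * B) / r); first by rewrite divr_gt0.
move=> e n eC eS; have /andP[e00 _] := eC 0%N (leq0n n).
move: e00; rewrite le_eqVlt => /orP[/eqP <-|e00].
  by rewrite powR0 ?gt_eqF// mulr0 divr_ge0 ?(ltW rB) ?(ltW r0).
have epos k : (k <= n)%N -> 0 < e k.
  elim: k => [//|k IH] kn; apply: lt_le_trans (eS k kn).
  by rewrite ltr_wpDr ?IH 1?ltnW// mulr_ge0 ?powR_ge0 ?(ltW c0).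
pose v k := (e k `^ q)^-1.
have vS k : (k < n)%N -> v k.+1 <= v k - r / (1 + r * B).
  move=> kn; have ek := epos k (ltnW kn).
  pose P := e k `^ q; have P0 : 0 < P by exact: powR_gt0.
  have PB : P <= B.
    have /andP[e0 eC'] := eC k (ltnW kn).
    by apply: ge0_ler_powR; rewrite ?nnegrE ?(ltW q0) ?(ltW C0).
  have x0 : 0 <= c * P by rewrite mulr_ge0 ?ltW.
  have x1 : 0 < 1 + c * P by rewrite ltr_pwDl.
  have grow : P * (1 + r * P) <= e k.+1 `^ q.
    apply: (@le_trans _ _ ((e k * (1 + c * P)) `^ q)); last first.
      apply: ge0_ler_powR; rewrite ?nnegrE ?(ltW q0) ?mulr_ge0 ?(ltW ek) ?(ltW x1)//.
        exact: ltW (epos _ kn).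
      apply: le_trans (eS k kn); rewrite mulrDr mulr1 mulrCA.
      rewrite powRD; last by apply/implyP => _; rewrite gt_eqF.
      by rewrite powRr1 ?(ltW ek).
    rewrite powRM ?(ltW ek) ?(ltW x1)//; apply: ler_wpM2l; first exact: ltW.
    rewrite /powR gt_eqF//; apply: le_trans (expR_ge1Dx _); rewrite lerD2l.
    apply: (@le_trans _ _ (q * (c * P / (1 + c * P)))); last first.
      by rewrite ler_wpM2l ?(ltW q0)// ln1D_ge.
    rewrite /r -!mulrA ler_wpM2l ?(ltW q0)// ler_wpM2l ?(ltW c0)//.
    rewrite mulrC ler_wpM2l ?(ltW P0)// lef_pV2 ?posrE// lerD2l ler_wpM2l ?(ltW c0)//.
  have rP : 0 < 1 + r * P by rewrite ltr_pwDl// mulr_ge0 ?ltW.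
  apply: (@le_trans _ _ (P * (1 + r * P))^-1).
    by rewrite /v lef_pV2 ?posrE ?mulr_gt0// powR_gt0// epos.
  have -> : (P * (1 + r * P))^-1 = P^-1 - r / (1 + r * P).
    by field; rewrite !gt_eqF.
  rewrite lerD2l lerN2 ler_wpM2l ?(ltW r0)// lef_pV2 ?posrE// lerD2l.
  by rewrite ler_wpM2l ?(ltW r0).
have vn k : (k <= n)%N -> v k <= v 0%N - k%:R * (r / (1 + r * B)).
  elim: k => [|k IH] kn; first by rewrite mul0r subr0.
  apply: le_trans (vS k kn) _; have := IH (ltnW kn).
  rewrite -[k.+1%:R]natr1 mulrDl mul1r; lra.
have := vn n (leqnn n).
have : 0 <= v n by rewrite invr_ge0 powR_ge0.
move=> v0 h; have {}h : n%:R * (r / (1 + r * B)) <= v 0%N by lra.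
rewrite -ler_pdivlMr ?powR_gt0// -/(v 0%N).
have : n%:R <= v 0%N * ((1 + r * B) / r).
  have -> : (1 + r * B) / r = (r / (1 + r * B))^-1 by rewrite (invf_div r (1 + r * B)).
  by rewrite ler_pdivlMr; [exact: h|exact: divr_gt0].
by rewrite mulrC.
Qed.

End growth_lemmas.

(** * Cubes and balls *)

Section cubes.
Context (R : realType) (N : nat).
Local Notation lam := (lebesgueN R N).
Implicit Types (x y z : N.-tuple R) (r : R).

(** Balls of the maximum norm replace Euclidean ones wherever a volume is needed: by [lebesgueN_box]
    theirs is a product of lengths. *)
Definition cube z r : set (N.-tuple R) :=
  [set x | forall i, `|tnth x i - tnth z i| <= r].

Lemma measurable_box (A : 'I_N -> set R) : (forall i, measurable (A i)) ->
  measurable [set x : N.-tuple R | forall i, A i (tnth x i)].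
Proof.
move=> mA; rewrite (_ : mkset _ =
    \bigcap_(i in [set: 'I_N]) ((fun x : N.-tuple R => tnth x i) @^-1` A i)).
  apply: fin_bigcap_measurable => // i _; rewrite -[X in measurable X]setTI.
  exact: measurable_tnth.
by apply/seteqP; split => x /= Ax i => [_|]; exact: Ax.
Qed.

Lemma cubeE z r :
  cube z r = [set x | forall i, `[(tnth z i - r), (tnth z i + r)]%classic (tnth x i)].
Proof.
apply/seteqP; split => x /= h i; have := h i; rewrite /= in_itv/= ler_norml.
  by move=> /andP[h1 h2]; apply/andP; split; lra.
by move=> /andP[h1 h2]; apply/andP; split; lra.
Qed.

Lemma measurable_cube z r : measurable (cube z r).
Proof.
rewrite cubeE.
apply: (@measurable_box (fun i => `[(tnth z i - r), (tnth z i + r)]%classic)) => i.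
exact: measurable_itv.
Qed.

Lemma lebesgueN_cube z r : 0 <= r -> lam (cube z r) = ((2 * r) ^+ N)%:E.
Proof.
move=> r0; rewrite cubeE.
rewrite (@lebesgueN_box R N (fun i => `[(tnth z i - r), (tnth z i + r)]%classic));
  last by move=> i; exact: measurable_itv.
rewrite (eq_bigr (fun=> (2 * r)%:E)) => [|i _]; last first.
  rewrite lebesgue_measure_itv/= lte_fin.
  move: r0; rewrite le_eqVlt => /orP[/eqP <-|r0].
    by rewrite subr0 addr0 ltxx mulr0.
  by rewrite ifT; [rewrite -EFinD; congr EFin; ring|lra].
by rewrite prodEFin prodr_const card_ord.
Qed.

Lemma eball_cube z r : eball z r `<=` cube z r.
Proof.
move=> x /= xz i; rewrite distrC; apply: ltW; apply: le_lt_trans xz.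
apply: le_trans (tnth_le_enorm _ i).
by rewrite tnth_mktuple.
Qed.

Lemma measurable_eball z r : measurable (eball z r).
Proof.
have mf : measurable_fun setT (fun y => enorm (vsub z y)) by measurability.
rewrite (_ : eball z r = (fun y => enorm (vsub z y)) @^-1` `]-oo, r[).
  by rewrite -[X in measurable X]setTI; exact: mf.
by apply/seteqP; split => x /=; rewrite in_itv.
Qed.

End cubes.

Section tonelli.
Context d1 d2 (T1 : measurableType d1) (T2 : measurableType d2) (R : realType).
Local Open Scope ereal_scope.

Lemma measurable_ge0_integral (m : {sigma_finite_measure set T2 -> \bar R})
    (f : T1 -> T2 -> \bar R) :
  measurable_fun setT (fun z => f z.1 z.2) -> (forall x y, 0 <= f x y) ->
  measurable_fun setT (fun x => \int[m]_y f x y).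
Proof.
move=> mf f0; have := @measurable_fun_fubini_tonelli_F _ _ _ _ R m
  (fun z => f z.1 z.2) mf (fun z => f0 z.1 z.2).
by rewrite /fubini_F.
Qed.

Lemma ge0_integral_swap (m1 : {sigma_finite_measure set T1 -> \bar R})
    (m2 : {sigma_finite_measure set T2 -> \bar R}) (f : T1 -> T2 -> \bar R) :
  measurable_fun setT (fun z => f z.1 z.2) -> (forall x y, 0 <= f x y) ->
  \int[m1]_x \int[m2]_y f x y = \int[m2]_y \int[m1]_x f x y.
Proof.
move=> mf f0; exact: (@fubini_tonelli _ _ _ _ R m1 m2
  (fun z => f z.1 z.2) mf (fun z => f0 z.1 z.2)).
Qed.

End tonelli.

(** * Causal kernel and heat potentials *)

Section causal_heat_kernel.
Context (R : realType) (N : nat) (theta : R).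
Hypothesis htheta : 0 < theta <= 2.
Local Notation lam := (lebesgueN R N).
Implicit Types (x y z : N.-tuple R) (s t r A : R).

(** Extension by 0 makes the kernel nonnegative at all times and lets time integrals range over the
    whole line. *)
Definition heat_pos x t : R := if 0 < t then heat_kernel theta x t else 0.

Lemma heat_posE x t : 0 < t -> heat_pos x t = heat_kernel theta x t.
Proof. by rewrite /heat_pos => ->. Qed.

Lemma heat_pos0 x t : t <= 0 -> heat_pos x t = 0.
Proof. by rewrite /heat_pos ltNge => ->. Qed.

Lemma heat_pos_ge0 x t : 0 <= heat_pos x t.
Proof.
by rewrite /heat_pos; case: ifPn => // t0; exact: heat_kernel_ge0.
Qed.

Lemma measurable_heat_pos d (T : measurableType d) (f : T -> N.-tuple R)
    (g : T -> R) : measurable_fun setT f -> measurable_fun setT g ->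
  measurable_fun setT (fun w : T => heat_pos (f w) (g w)).
Proof.
move=> mf mg; rewrite /heat_pos.
apply: (@measurable_fun_ifT _ _ _ _ (fun w : T => heat_kernel theta (f w) (g w))
  (fun=> 0) (fun w : T => 0 < g w)).
- exact: measurable_fun_ltr.
- exact: measurable_heat_kernel.
- exact: measurable_cst.
Qed.

Lemma heat_pos_semigroup x z s t : 0 < s -> 0 < t ->
  (\int[lam]_y (heat_pos (vsub x y) t * heat_pos (vsub y z) s)%:E =
   (heat_pos (vsub x z) (t + s))%:E)%E.
Proof.
move=> s0 t0; rewrite (heat_posE _ (addr_gt0 t0 s0)).
rewrite -(heat_kernel_semigroupE htheta x z s0 t0).
have -> : (\int[lam]_y (heat_pos (vsub x y) t * heat_pos (vsub y z) s)%:E =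
  \int[lam]_y (heat_kernel theta (vsub x y) t * heat_kernel theta (vsub y z) s)%:E)%E.
  by apply: eq_integral => y _; rewrite (heat_posE _ s0) (heat_posE _ t0).
by [].
Qed.

End causal_heat_kernel.

Arguments heat_pos {R N} theta x t.

Ltac measurability_hook ::=
  lazymatch goal with
  | |- measurable_fun _ (fun x => heat_kernel ?theta (@?f x) (@?g x)) =>
      refine (@measurable_heat_kernel _ _ theta _ _ f g _ _)
  | |- measurable_fun _ (fun x => heat_pos ?theta (@?f x) (@?g x)) =>
      refine (@measurable_heat_pos _ _ theta _ _ f g _ _)
  end.

Section heat_potential.
Context (R : realType) (N : nat) (theta : R).
Hypothesis htheta : 0 < theta <= 2.
Local Notation lam := (lebesgueN R N).
Local Notation leb := (@lebesgue_measure R).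
Implicit Types (mu : {sigma_finite_measure set (N.-tuple R) -> \bar R}).
Implicit Types (x y z : N.-tuple R) (s t r A : R).
Implicit Type q : N.-tuple R * measurableTypeR R -> R.

#[local] Opaque heat_pos.

Let P0 y t : 0 <= heat_pos theta y t.
Proof. exact: heat_pos_ge0. Qed.

Definition source_term q z A r : \bar R :=
  (\int[lam]_y (heat_pos theta (vsub z y) (A - r) * q (y, r))%:E)%E.

(** The right-hand side of the integral equation for a given source [q]. The causal kernel ends the
    time integral at [A]; for supersolutions the source itself vanishes at nonpositive times. *)
Definition heat_potential mu q z A : \bar R :=
  (\int[mu]_y (heat_pos theta (vsub z y) A)%:E + \int[leb]_r source_term q z A r)%E.

Lemma source_term_ge0 q z A r : (forall v, 0 <= q v) -> (0 <= source_term q z A r)%E.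
Proof.
move=> q0; apply: integral_ge0 => y _; rewrite lee_fin; exact: mulr_ge0.
Qed.

Lemma measurable_source_term q d (T : measurableType d) (f : T -> N.-tuple R)
    (g h : T -> R) : measurable_fun setT q -> (forall v, 0 <= q v) ->
  measurable_fun setT f -> measurable_fun setT g -> measurable_fun setT h ->
  measurable_fun setT (fun w : T => source_term q (f w) (g w) (h w)).
Proof.
move=> mq q0 mf mg mh; apply: (@measurable_ge0_integral _ _ _ _ R lam
  (fun (w : T) y => (heat_pos theta (vsub (f w) y) (g w - h w) * q (y, h w))%:E)).
  by cbv beta; measurability.
by move=> z y; rewrite lee_fin; exact: mulr_ge0.
Qed.

Lemma initial_term_ge0 mu z A : (0 <= \int[mu]_y (heat_pos theta (vsub z y) A)%:E)%E.
Proof. by apply: integral_ge0 => y _; rewrite lee_fin. Qed.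

Lemma heat_potential_ge0 mu q z A : (forall v, 0 <= q v) ->
  (0 <= heat_potential mu q z A)%E.
Proof.
move=> q0; apply: adde_ge0; first exact: initial_term_ge0.
by apply: integral_ge0 => r _; exact: source_term_ge0.
Qed.

Lemma measurable_initial_term mu d (T : measurableType d) (f : T -> N.-tuple R)
    (g : T -> R) : measurable_fun setT f -> measurable_fun setT g ->
  measurable_fun setT (fun w : T => \int[mu]_y (heat_pos theta (vsub (f w) y) (g w))%:E)%E.
Proof.
move=> mf mg; apply: (@measurable_ge0_integral _ _ _ _ R mu
  (fun (w : T) y => (heat_pos theta (vsub (f w) y) (g w))%:E)).
  by cbv beta; measurability.
by move=> z y; rewrite lee_fin.
Qed.

Lemma measurable_heat_potential mu q d (T : measurableType d)
    (f : T -> N.-tuple R) (g : T -> R) :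
  measurable_fun setT q -> (forall v, 0 <= q v) ->
  measurable_fun setT f -> measurable_fun setT g ->
  measurable_fun setT (fun w : T => heat_potential mu q (f w) (g w)).
Proof.
move=> mq q0 mf mg; apply: emeasurable_funD; first exact: measurable_initial_term.
apply: (@measurable_ge0_integral _ _ _ _ R leb
  (fun (w : T) r => source_term q (f w) (g w) r)); last first.
  by move=> z r; exact: source_term_ge0.
by apply: measurable_source_term => //; measurability.
Qed.

Lemma source_term_late q z A r : A <= r -> source_term q z A r = 0%E.
Proof.
move=> Ar; rewrite /source_term -[RHS](@integral0 _ _ _ lam setT).
apply: eq_integral => y _; rewrite heat_pos0 ?mul0r//; lra.
Qed.

Lemma source_term_no_source q z A r : (forall y, q (y, r) = 0) ->
  source_term q z A r = 0%E.
Proof.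
move=> q0; rewrite /source_term -[RHS](@integral0 _ _ _ lam setT).
by apply: eq_integral => y _; rewrite q0 mulr0.
Qed.

Lemma initial_term_semigroup mu z s A : 0 < s < A ->
  (\int[lam]_x ((heat_pos theta (vsub z x) (A - s))%:E *
     \int[mu]_y (heat_pos theta (vsub x y) s)%:E) =
   \int[mu]_y (heat_pos theta (vsub z y) A)%:E)%E.
Proof.
move=> /andP[s0 sA].
have e1 : (\int[lam]_x ((heat_pos theta (vsub z x) (A - s))%:E *
     \int[mu]_y (heat_pos theta (vsub x y) s)%:E) =
   \int[lam]_x \int[mu]_y
     (heat_pos theta (vsub z x) (A - s) * heat_pos theta (vsub x y) s)%:E)%E.
  apply: eq_integral => x _.
  have mh : measurable_fun setT (fun y => (heat_pos theta (vsub x y) s)%:E).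
    by measurability.
  have h0 y : setT y -> (0 <= (heat_pos theta (vsub x y) s)%:E)%E by rewrite lee_fin.
  rewrite -(ge0_integralZl mu measurableT mh h0); first by [].
  by rewrite lee_fin.
rewrite e1 (ge0_integral_swap lam mu).
- apply: eq_integral => y _.
  have As : 0 < A - s by rewrite subr_gt0.
  by rewrite (heat_pos_semigroup htheta z y s0 As) subrK.
- by cbv beta; measurability.
- by move=> x y; rewrite lee_fin; exact: mulr_ge0.
Qed.

Lemma source_term_semigroup q z s r A : measurable_fun setT q ->
  (forall v, 0 <= q v) -> r < s -> s < A ->
  (\int[lam]_x ((heat_pos theta (vsub z x) (A - s))%:E * source_term q x s r) =
   source_term q z A r)%E.
Proof.
move=> mq q0 rs sA.
have e1 : (\int[lam]_x ((heat_pos theta (vsub z x) (A - s))%:E * source_term q x s r) =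
   \int[lam]_x \int[lam]_y
     (heat_pos theta (vsub z x) (A - s) * (heat_pos theta (vsub x y) (s - r) * q (y, r)))%:E)%E.
  apply: eq_integral => x _.
  have mh : measurable_fun setT
      (fun y => (heat_pos theta (vsub x y) (s - r) * q (y, r))%:E).
    by measurability.
  have h0 y : setT y -> (0 <= (heat_pos theta (vsub x y) (s - r) * q (y, r))%:E)%E.
    by move=> _; rewrite lee_fin; exact: mulr_ge0.
  rewrite -(ge0_integralZl lam measurableT mh h0); first by [].
  by rewrite lee_fin.
rewrite e1 (ge0_integral_swap lam lam).
- apply: eq_integral => y _.
  have mh : measurable_fun setT (fun x =>
      (heat_pos theta (vsub z x) (A - s) * heat_pos theta (vsub x y) (s - r))%:E).
    by measurability.
  have h0 x : setT x -> (0 <= (heat_pos theta (vsub z x) (A - s) *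
      heat_pos theta (vsub x y) (s - r))%:E)%E.
    by move=> _; rewrite lee_fin; exact: mulr_ge0.
  have qy : (0 <= (q (y, r))%:E)%E by rewrite lee_fin.
  have -> : (\int[lam]_x (heat_pos theta (vsub z x) (A - s) *
        (heat_pos theta (vsub x y) (s - r) * q (y, r)))%:E =
      \int[lam]_x ((q (y, r))%:E * (heat_pos theta (vsub z x) (A - s) *
        heat_pos theta (vsub x y) (s - r))%:E))%E.
    by apply: eq_integral => x _; rewrite mulrA mulrC EFinM.
  rewrite (ge0_integralZl lam measurableT mh h0 qy).
  have As : 0 < A - s by rewrite subr_gt0.
  have sr : 0 < s - r by rewrite subr_gt0.
  rewrite (heat_pos_semigroup htheta z y sr As).
  by rewrite -EFinM mulrC addrA subrK.
- by cbv beta; measurability.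
- by move=> x y; rewrite lee_fin; apply: mulr_ge0; [|exact: mulr_ge0].
Qed.

(** Sources acting after [s] would count at time [A] but not at [s]; with [q] vanishing from [s] on,
    evolving the potential from [s] to [A] is exact. *)
Lemma heat_potential_semigroup mu q z s A : measurable_fun setT q ->
  (forall v, 0 <= q v) -> (forall y r, s <= r -> q (y, r) = 0) -> 0 < s < A ->
  (\int[lam]_x ((heat_pos theta (vsub z x) (A - s))%:E * heat_potential mu q x s) =
   heat_potential mu q z A)%E.
Proof.
move=> mq q0 qs sA; have /andP[s0 sA'] := sA.
have c0 x : (0 <= (heat_pos theta (vsub z x) (A - s))%:E)%E by rewrite lee_fin.
have S0 x : (0 <= \int[leb]_r source_term q x s r)%E.
  by apply: integral_ge0 => r _; exact: source_term_ge0.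
have mS : measurable_fun setT (fun x => \int[leb]_r source_term q x s r)%E.
  apply: (@measurable_ge0_integral _ _ _ _ R leb (fun x r => source_term q x s r)).
    by apply: measurable_source_term => //; measurability.
  by move=> x r; exact: source_term_ge0.
have mI := @measurable_initial_term mu _ _ (@id (N.-tuple R)) (fun=> s)
  (@measurable_id _ _ _) (measurable_cst _).
have -> : (\int[lam]_x ((heat_pos theta (vsub z x) (A - s))%:E * heat_potential mu q x s) =
  \int[lam]_x ((heat_pos theta (vsub z x) (A - s))%:E *
     \int[mu]_y (heat_pos theta (vsub x y) s)%:E +
     (heat_pos theta (vsub z x) (A - s))%:E * \int[leb]_r source_term q x s r))%E.
  apply: eq_integral => x _; rewrite /heat_potential ge0_muleDr//.
  exact: initial_term_ge0.
rewrite ge0_integralD//; last 4 first.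
- by move=> x _; apply: mule_ge0 => //; exact: initial_term_ge0.
- by apply: emeasurable_funM => //; measurability.
- by move=> x _; exact: mule_ge0.
- by apply: emeasurable_funM => //; measurability.
rewrite initial_term_semigroup// /heat_potential; congr (_ + _)%E.
have -> : (\int[lam]_x ((heat_pos theta (vsub z x) (A - s))%:E *
     \int[leb]_r source_term q x s r) =
   \int[lam]_x \int[leb]_r ((heat_pos theta (vsub z x) (A - s))%:E * source_term q x s r))%E.
  apply: eq_integral => x _.
  have mh : measurable_fun setT (fun r => source_term q x s r).
    by apply: measurable_source_term => //; measurability.
  have h0 r : setT r -> (0 <= source_term q x s r)%E.
    by move=> _; exact: source_term_ge0.
  by rewrite -(ge0_integralZl leb measurableT mh h0 (c0 x)).
rewrite (ge0_integral_swap lam leb).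
- apply: eq_integral => r _; have [rs|sr] := ltP r s.
    exact: source_term_semigroup.
  rewrite source_term_no_source; last by move=> y; exact: qs.
  rewrite -[RHS](@integral0 _ _ _ lam setT).
  by apply: eq_integral => x _; rewrite source_term_late// mule0.
- apply: emeasurable_funM; first by cbv beta; measurability.
  by apply: measurable_source_term => //; measurability.
- by move=> x r; apply: mule_ge0 => //; exact: source_term_ge0.
Qed.

End heat_potential.

(** * Supersolutions *)

(* Unlike [filterS], this needs no measure structure on [m], which the type
   class search does not find for [lebesgue_measure]. *)
Lemma ae_mono d (T : measurableType d) (R : realType) (m : set T -> \bar R)
    (P Q : T -> Prop) : (forall x, P x -> Q x) ->
  {ae m, forall x, P x} -> {ae m, forall x, Q x}.
Proof.
move=> PQ [Z [mZ Z0 hZ]]; exists Z; split => // x nQ; apply: hZ => /= Px.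
by apply: nQ; exact: PQ.
Qed.

Lemma powR_root_le (R : realType) (q f K A B : R) :
  0 < q -> 0 <= f -> 0 <= K -> 0 < A -> 0 <= B ->
  f `^ q <= K * A^-1 * B `^ q -> f <= K `^ q^-1 * A `^ (- q^-1) * B.
Proof.
move=> q0 f0 K0 A0 B0 h.
have A1 : 0 <= A^-1 by rewrite invr_ge0 ltW.
have KA : 0 <= K * A^-1 by exact: mulr_ge0.
have : (f `^ q) `^ q^-1 <= (K * A^-1 * B `^ q) `^ q^-1.
  apply: ge0_ler_powR => //; rewrite ?nnegrE ?powR_ge0//.
    by rewrite invr_ge0 ltW.
  by apply: mulr_ge0; rewrite ?powR_ge0.
rewrite -powRrM mulfV ?gt_eqF// powRr1//.
rewrite powRM ?powR_ge0// -powRrM mulfV ?gt_eqF// powRr1//.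
by rewrite powRM// powR_invE ?powRN// ltW.
Qed.

Section supersolutions.
Context (R : realType) (N : nat) (theta gamma p : R).
Hypotheses (htheta : 0 < theta <= 2) (hN : (1 <= N)%N).
Hypotheses (hp : 1 < p) (hgamma : 0 < gamma).
Hypothesis hfrac : theta < 2 -> gamma < theta * (p - 1).
Local Notation lam := (lebesgueN R N).
Local Notation leb := (@lebesgue_measure R).
Local Notation X := (N.-tuple R).
Implicit Types (mu : {sigma_finite_measure set X -> \bar R}).
Implicit Types (x y z : X) (s t r A T : R).
Implicit Type q w : X * measurableTypeR R -> R.

Let P0 y t : 0 <= heat_pos theta y t.
Proof. exact: heat_pos_ge0. Qed.

Let p0 : 0 < p. Proof. exact: lt_trans hp. Qed.

Let powR2_lt1 : 2 `^ (1 - p) < 1 :> R.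
Proof.
have p1 : 0 < p - 1 by rewrite subr_gt0.
have l2 : 0 < ln (2 : R) by rewrite ln_gt0 ?ltr1n.
by rewrite /powR gt_eqF// -[ltRHS]expR0 ltr_expR; nra.
Qed.

Definition weighted_power w (v : X * measurableTypeR R) : R :=
  enorm v.1 `^ (- gamma) * w v `^ p.

Lemma weighted_power_ge0 w v : 0 <= weighted_power w v.
Proof. by apply: mulr_ge0; exact: powR_ge0. Qed.

Lemma measurable_weighted_power w : measurable_fun setT w ->
  measurable_fun setT (weighted_power w).
Proof.
move=> mw.
have mf : measurable_fun setT (fun v : X * measurableTypeR R => enorm v.1 `^ (- gamma)).
  by measurability.
have mg : measurable_fun setT (fun v : X * measurableTypeR R => w v `^ p).
  exact: (measurableT_comp (@measurable_powR _ p) mw).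
exact: (measurable_funM mf mg).
Qed.

Lemma weighted_power0 w v : w v = 0 -> weighted_power w v = 0.
Proof. by move=> w0; rewrite /weighted_power w0 powR0 ?mulr0// gt_eqF. Qed.

(** The potential increases with its source, so an inequality survives when a solution is replaced
    by a smaller Borel function. Vanishing outside the time interval allows integration over all
    times. *)
Definition supersolution T mu w := [/\ measurable_fun setT w,
  (forall v, 0 <= w v), (forall v, ~ spacetime T v -> w v = 0) &
  {ae @spacetime_measure R N, forall v, spacetime T v ->
    (heat_potential theta mu (weighted_power w) v.1 v.2 <= (w v)%:E)%E}].

Lemma solution_supersolution T mu u : is_solution theta gamma p T mu u ->
  exists w, supersolution T mu w.
Proof.
move=> [mu_ u0 sol].
have [w0 [mw0 w00 w0u w0E]] := @completed_measurable_fun_borel _ _ R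
  (lam \x leb)%E (@spacetime R N T) u mu_ u0.
pose w v : R := if (0 < v.2 < T) then w0 v else 0.
exists w.
have w_ge0 v : 0 <= w v by rewrite /w; case: ifP.
have wS v : ~ spacetime T v -> w v = 0 by rewrite /spacetime/= /w; case: ifP.
split=> //.
  rewrite /w; apply: (@measurable_fun_ifT _ _ _ _ w0 (fun=> 0)
    (fun v : X * measurableTypeR R => 0 < v.2 < T)) => //.
  apply: measurable_and; apply: measurable_fun_ltr => //;
    by [exact: measurable_cst|exact: measurable_snd].
move: sol w0E; apply: filterS2 => -[x t] sol w0E /= Dv.
have [uoo uE] := sol Dv.
have -> : w (x, t) = w0 (x, t) by rewrite /w Dv.
rewrite -(w0E Dv uoo) uE /duhamel /= /heat_potential.
have /andP[/= t0 tT] := Dv.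
apply: leeD.
  rewrite le_eqVlt; apply/orP; left; apply/eqP.
  by apply: eq_integral => y _; rewrite heat_posE.
(* Times after [t] are removed by the causal kernel, nonpositive times by the vanishing of [w]. *)
have -> : (\int[leb]_r source_term theta (weighted_power w) x t r =
    \int[leb]_(r in `]0%R, t[) source_term theta (weighted_power w) x t r)%E.
  rewrite [RHS]integral_mkcond; apply: eq_integral => r _; rewrite patchE.
  case: ifPn => // /negP rt; have [tr|rt'] := leP t r; first exact: source_term_late.
  apply: source_term_no_source => y; apply: weighted_power0; apply: wS.
  by move=> /andP[/= r0 rT]; apply: rt; rewrite inE/= in_itv/= r0.
apply: ge0_le_integral_nomeas => r /= rt.
  by apply: source_term_ge0 => // v; exact: weighted_power_ge0.
move: rt; rewrite in_itv/= => /andP[r0 rt].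
have tr : 0 < t - r by rewrite subr_gt0.
apply: ge0_le_integral_nomeas => y _.
  by rewrite lee_fin; apply: mulr_ge0; [|exact: weighted_power_ge0].
have Dr : spacetime T (y, r : measurableTypeR R).
  by apply/andP; split => //=; exact: lt_trans tT.
rewrite EFinM heat_posE//; apply: lee_wpmul2l.
  by rewrite lee_fin; exact: heat_kernel_ge0.
rewrite /weighted_power EFinM; apply: lee_wpmul2l; first by rewrite lee_fin powR_ge0.
have -> : w (y, r) = w0 (y, r) by rewrite /w ifT.
rewrite -poweR_EFin; apply: gt0_ler_poweR.
- exact: ltW.
- by rewrite in_itv/= lee_fin w00 leey.
- by rewrite in_itv/= u0 ?leey.
- exact: w0u.
Qed.

Lemma supersolution_slices T mu w : supersolution T mu w ->
  {ae leb, forall s, 0 < s < T -> {ae lam, forall x,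
    (heat_potential theta mu (weighted_power w) x s <= (w (x, s))%:E)%E}}.
Proof.
move=> [_ _ _ h]; have := @ae_product_slices _ _ _ _ R lam leb _ h.
apply: filterS => s hs sT; move: hs; apply: filterS => x; apply.
exact: sT.
Qed.

(** The potential of [past s q] at [(z, A)] is the function [F s] of the differential inequality:
    the source stops at [s] while the kernel runs on to [A]. *)
Definition past s q (v : X * measurableTypeR R) : R := if v.2 < s then q v else 0.

Lemma past_ge0 s q : (forall v, 0 <= q v) -> forall v, 0 <= past s q v.
Proof. by move=> q0 v; rewrite /past; case: ifP. Qed.

Lemma measurable_past s q : measurable_fun setT q -> measurable_fun setT (past s q).
Proof.
move=> mq; apply: (@measurable_fun_ifT _ _ _ _ q (fun=> 0)
  (fun v : X * measurableTypeR R => v.2 < s)) => //.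
exact: measurable_fun_ltr.
Qed.

Lemma source_term_past s q z A r :
  source_term theta (past s q) z A r = if r < s then source_term theta q z A r else 0%E.
Proof.
case: ifP => rs; first by apply: eq_integral => y _; rewrite /past/= rs.
by apply: source_term_no_source => y; rewrite /past/= rs.
Qed.

Lemma heat_potential_past mu q z A :
  heat_potential theta mu (past A q) z A = heat_potential theta mu q z A.
Proof.
rewrite /heat_potential; congr (_ + _)%E; apply: eq_integral => r _.
rewrite source_term_past; case: ltP => // Ar.
by rewrite source_term_late.
Qed.

(** The integrated form of a lower bound on a derivative; it serves both the potential at a point
    and the mass in the parabolic region. *)
Lemma cumulative_increment (g : R -> \bar R) s t c : measurable_fun setT g ->
  (forall r, 0 <= g r)%E -> s <= t -> 0 <= c ->
  {ae leb, forall r, s <= r < t -> (c%:E <= g r)%E} ->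
  ((\int[leb]_r (if (r < s)%R then g r else 0)) + (c * (t - s))%:E <=
   \int[leb]_r (if (r < t)%R then g r else 0))%E.
Proof.
move=> mg g0 st c0 hc.
pose f r : \bar R := (c * \1_(`[s, t[%classic : set R) r)%:E.
have mf : measurable_fun setT f.
  apply/measurable_EFinP; apply: measurable_funM; first exact: measurable_cst.
  exact: measurable_indic.
have f0 r : (0 <= f r)%E by rewrite lee_fin; apply: mulr_ge0.
have -> : (c * (t - s))%:E = (\int[leb]_r f r)%E.
  rewrite /f; under eq_integral do rewrite EFinM.
  rewrite ge0_integralZl//; last first.
    by apply/measurable_EFinP; exact: measurable_indic.
  rewrite integral_indic// setIT EFinM; congr (_ * _)%E.
  suff : leb `[s, t[%classic = (t - s)%:E by move=> <-.
  rewrite lebesgue_measure_itv/= lte_fin.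
  by move: st; rewrite le_eqVlt => /orP[/eqP ->|->//]; rewrite ltxx subrr.
have mS s' : measurable_fun setT (fun r => if (r < s')%R then g r else 0)%E.
  by apply: (@measurable_fun_ifT _ _ _ _ g (fun=> 0%E) (fun r => r < s'));
    [exact: measurable_fun_ltr|exact: mg|exact: measurable_cst].
have S0 s' r : (0 <= if (r < s')%R then g r else 0)%E by case: ifP.
rewrite -ge0_integralD//; last exact: mS.
apply: ae_ge0_le_integral => //.
- by move=> r _; exact: adde_ge0.
- by apply: emeasurable_funD; [exact: mS|exact: mf].
- exact: mS.
apply: ae_mono hc => r hc _; rewrite /f indicE.
case: (ltP r s) => rs.
  rewrite (lt_le_trans rs st) memNset ?mulr0 ?adde0//=.
  by rewrite in_itv/= => /andP[]; rewrite leNgt rs.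
case: (ltP r t) => rt.
  by rewrite mem_set/= ?in_itv/= ?rs// mulr1 add0e; apply: hc; rewrite rs.
rewrite memNset ?mulr0 ?adde0//=.
by rewrite in_itv/= => /andP[_]; rewrite ltNge rt.
Qed.

Lemma heat_potential_increment mu q z A s t c : measurable_fun setT q ->
  (forall v, 0 <= q v) -> s <= t -> 0 <= c ->
  {ae leb, forall r, s <= r < t -> (c%:E <= source_term theta q z A r)%E} ->
  (heat_potential theta mu (past s q) z A + (c * (t - s))%:E <=
   heat_potential theta mu (past t q) z A)%E.
Proof.
move=> mq q0 st c0 hc; rewrite /heat_potential -addeA; apply: leeD2l.
have pE s' : (\int[leb]_r source_term theta (past s' q) z A r =
    \int[leb]_r (if (r < s')%R then source_term theta q z A r else 0))%E.
  by apply: eq_integral => r _; rewrite source_term_past.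
rewrite !pE; apply: cumulative_increment => //.
  by apply: measurable_source_term => //; measurability.
by move=> r; exact: source_term_ge0.
Qed.

Lemma heat_potential_past_le mu q z A s : measurable_fun setT q ->
  (forall v, 0 <= q v) -> s <= A ->
  (heat_potential theta mu (past s q) z A <= heat_potential theta mu q z A)%E.
Proof.
move=> mq q0 sA; rewrite -[leRHS]heat_potential_past -[leLHS]adde0.
have := @heat_potential_increment mu q z A s A 0 mq q0 sA (lexx _).
rewrite mul0r; apply.
by apply: aeW => r _; exact: source_term_ge0.
Qed.

Lemma ae_enorm_gt0 : {ae lam, forall x, 0 < enorm x}.
Proof.
exists (cube (@vzero R N) 0); split.
- exact: measurable_cube.
- by rewrite lebesgueN_cube// mulr0 expr0n; case: N hN.
- move=> x /= /negP; rewrite -leNgt => x0 i; rewrite tnth_mktuple subr0.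
  exact: le_trans (tnth_le_enorm x i) x0.
Qed.

(* Where [w <= L |x|^a] fails, [w^(p-1) >= L^(p-1) |x|^gamma]. *)
Lemma weighted_power_young w x s L : 0 < L -> 0 < enorm x -> 0 <= w (x, s) ->
  w (x, s) <= L * enorm x `^ (gamma / (p - 1)) +
    (L `^ (p - 1))^-1 * weighted_power w (x, s).
Proof.
move=> L0 x0 w0; have p1 : 0 < p - 1 by rewrite subr_gt0.
have L1 : 0 < L `^ (p - 1) by exact: powR_gt0.
have [wL|Lw] := leP (w (x, s)) (L * enorm x `^ (gamma / (p - 1))).
  rewrite -[leLHS]addr0; apply: lerD => //.
  by apply: mulr_ge0; [rewrite invr_ge0; exact: ltW|exact: weighted_power_ge0].
rewrite -[leLHS]add0r; apply: lerD.
  by apply: mulr_ge0; [exact: ltW|exact: powR_ge0].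
rewrite /weighted_power/= (powR_gt1M hp w0).
have h : L `^ (p - 1) * enorm x `^ gamma <= w (x, s) `^ (p - 1).
  have -> : enorm x `^ gamma = (enorm x `^ (gamma / (p - 1))) `^ (p - 1).
    by rewrite -powRrM divfK// gt_eqF.
  rewrite -powRM; [|exact: ltW|exact: powR_ge0].
  apply: ge0_ler_powR; [exact: ltW| | |exact: ltW]; rewrite nnegrE//.
  by apply: mulr_ge0; [exact: ltW|exact: powR_ge0].
rewrite powRN ler_pdivlMl// mulrC; move: h; set e := enorm x `^ gamma; set W1 := w (x, s) `^ (p - 1) => h.
have e0 : 0 < e by exact: powR_gt0.
rewrite [leRHS](_ : _ = w (x, s) * (W1 / e)); last by ring.
by apply: ler_wpM2l => //; rewrite ler_pdivlMr// mulrC.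
Qed.

Local Notation a := (gamma / (p - 1)).

Section one_point.
Variables (W T : R) (mu : {sigma_finite_measure set X -> \bar R})
  (w : X * measurableTypeR R -> R) (z : X) (A : R).
Hypothesis W0 : 0 < W.
Hypothesis hW : forall z rho, 0 < rho ->
  (\int[lam]_y (heat_kernel theta (vsub z y) (rho `^ theta) * enorm y `^ a)%:E <=
   (W * (enorm z + rho) `^ a)%:E)%E.
Hypotheses (hw : supersolution T mu w) (A0 : 0 < A) (AT : A <= T).
Let q := weighted_power w.
Hypothesis finA : (heat_potential theta mu q z A < +oo)%E.

(** By [weight_le] this bounds the kernel average of |y|^a for all remaining times [A - s], so that
    [kappa] below does not depend on [s]. *)
Let W' := W * (enorm z + A `^ theta^-1) `^ a.

Let mw : measurable_fun setT w. Proof. by case: hw. Qed.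
Let w0 v : 0 <= w v. Proof. by case: hw. Qed.
Let mq : measurable_fun setT q. Proof. exact: measurable_weighted_power. Qed.
Let q0 v : 0 <= q v. Proof. exact: weighted_power_ge0. Qed.
Let th0 : 0 < theta. Proof. by case/andP : htheta. Qed.
Let a0 : 0 < a. Proof. by apply: divr_gt0 => //; rewrite subr_gt0. Qed.

Let W'0 : 0 < W'.
Proof.
apply: mulr_gt0 => //; apply: powR_gt0; apply: ltr_wpDl; first exact: enorm_ge0.
exact: powR_gt0.
Qed.

Let weight_le s : 0 < s < A ->
  (\int[lam]_y (heat_pos theta (vsub z y) (A - s) * enorm y `^ a)%:E <= W'%:E)%E.
Proof.
move=> /andP[s0 sA]; have As : 0 < A - s by rewrite subr_gt0.
have -> : (\int[lam]_y (heat_pos theta (vsub z y) (A - s) * enorm y `^ a)%:E =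
  \int[lam]_y (heat_kernel theta (vsub z y) (((A - s) `^ theta^-1) `^ theta) *
     enorm y `^ a)%:E)%E.
  have e : ((A - s) `^ theta^-1) `^ theta = A - s.
    by rewrite -powRrM mulVf ?gt_eqF// powRr1//; exact: ltW.
  by apply: eq_integral => y _; rewrite e (heat_posE theta (vsub z y) As).
apply: le_trans (hW z (powR_gt0 theta^-1 As)) _.
rewrite lee_fin; apply: ler_wpM2l; first exact: ltW.
apply: ge0_ler_powR; [exact: ltW| | |]; rewrite ?nnegrE.
- by apply: addr_ge0; [exact: enorm_ge0|exact: powR_ge0].
- by apply: addr_ge0; [exact: enorm_ge0|exact: powR_ge0].
apply: lerD => //; apply: ge0_ler_powR; rewrite ?nnegrE.
- by rewrite invr_ge0 ltW.
- exact: ltW.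
- exact: ltW.
- lra.
Qed.

Let F s := fine (heat_potential theta mu (past s q) z A).

Let FE s : s <= A -> heat_potential theta mu (past s q) z A = (F s)%:E.
Proof.
move=> sA; rewrite fineK// ge0_fin_numE.
  exact: le_lt_trans (heat_potential_past_le _ _ _ _ sA) finA.
by apply: heat_potential_ge0 => //; exact: past_ge0.
Qed.

Let F0 s : 0 <= F s.
Proof. by apply: fine_ge0; apply: heat_potential_ge0 => //; exact: past_ge0. Qed.

Let F_le s t : s <= t -> t <= A -> F s <= F t.
Proof.
move=> st tA.
suff : (heat_potential theta mu (past s q) z A <= heat_potential theta mu (past t q) z A)%E.
  by rewrite (FE (le_trans st tA)) (FE tA) lee_fin.
have := @heat_potential_increment mu q z A s t 0 mq q0 st (lexx _).
rewrite mul0r adde0; apply.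
by apply: aeW => r _; exact: source_term_ge0.
Qed.

(* The semigroup property turns the supersolution inequality at time [s] into
   a bound of [F s] by an integral of [w], hence by Young and the moment bound. *)
Let F_le_source : {ae leb, forall s, 0 < s < A -> forall L, 0 < L ->
  ((F s)%:E <= (L * W')%:E + ((L `^ (p - 1))^-1)%:E * source_term theta q z A s)%E}.
Proof.
apply: ae_mono (supersolution_slices hw) => s hs sA L L0.
have /andP[s0 sA'] := sA.
have {}hs := hs (introT andP (conj s0 (lt_le_trans sA' AT))).
have c0 x : 0 <= heat_pos theta (vsub z x) (A - s) by exact: P0.
have Lp : 0 <= (L `^ (p - 1))^-1 by rewrite invr_ge0 powR_ge0.
rewrite -FE; last exact: ltW.
rewrite -(heat_potential_semigroup htheta mu z (measurable_past _ mq) (past_ge0 s q0) _ sA);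
  last by move=> y r sr; rewrite /past/= ltNge sr.
pose f1 x : \bar R := (heat_pos theta (vsub z x) (A - s) * enorm x `^ a)%:E.
pose f2 x : \bar R := (heat_pos theta (vsub z x) (A - s) * q (x, s))%:E.
have mf1 : measurable_fun setT f1 by rewrite /f1; measurability.
have mf2 : measurable_fun setT f2 by rewrite /f2; measurability.
have f10 x : setT x -> (0 <= f1 x)%E.
  by move=> _; rewrite lee_fin; apply: mulr_ge0; [exact: P0|exact: powR_ge0].
have f20 x : setT x -> (0 <= f2 x)%E.
  by move=> _; rewrite lee_fin; apply: mulr_ge0; [exact: P0|exact: q0].
have Le0 : (0 <= L%:E)%E by rewrite lee_fin ltW.
have Lpe0 : (0 <= ((L `^ (p - 1))^-1)%:E)%E by rewrite lee_fin.
apply: (@le_trans _ _ (\int[lam]_x (L%:E * f1 x + ((L `^ (p - 1))^-1)%:E * f2 x))%E).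
  apply: ae_ge0_le_integral => //.
  - move=> x _; apply: mule_ge0; first by rewrite lee_fin.
    by apply: heat_potential_ge0 => //; exact: past_ge0.
  - apply: emeasurable_funM; first by measurability.
    apply: (@measurable_heat_potential _ _ _ htheta mu (past s q) _ _ id (fun=> s)) => //.
      exact: measurable_past.
    exact: past_ge0.
  - by move=> x xT; apply: adde_ge0; apply: mule_ge0 => //; [exact: f10|exact: f20].
  - by apply: emeasurable_funD; apply: emeasurable_funM => //; exact: measurable_cst.
  move: ae_enorm_gt0 hs; apply: filterS2 => x x0 hs _.
  rewrite heat_potential_past -!EFinM -EFinD.
  have h := weighted_power_young L0 x0 (w0 (x, s)).
  apply: (@le_trans _ _ ((heat_pos theta (vsub z x) (A - s))%:E * (w (x, s))%:E)%E).
    by apply: lee_wpmul2l; [rewrite lee_fin; exact: c0|exact: hs].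
  rewrite -EFinM lee_fin.
  rewrite [leRHS](_ : _ = heat_pos theta (vsub z x) (A - s) *
     (L * enorm x `^ a + (L `^ (p - 1))^-1 * q (x, s))).
    by apply: ler_wpM2l; [exact: c0|exact: h].
  move: (heat_pos _ _ _) (enorm x `^ a) (L `^ (p - 1))^-1 (q (x, s)) => c1 c2 c3 c4.
  by ring.
rewrite ge0_integralD//; last 4 first.
- by move=> x xT; apply: mule_ge0 => //; exact: f10.
- by apply: emeasurable_funM => //; exact: measurable_cst.
- by move=> x xT; apply: mule_ge0 => //; exact: f20.
- by apply: emeasurable_funM => //; exact: measurable_cst.
rewrite (ge0_integralZl lam measurableT mf1 f10 Le0).
rewrite (ge0_integralZl lam measurableT mf2 f20 Lpe0).
apply: leeD2r; rewrite EFinM; apply: lee_wpmul2l => //.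
exact: weight_le.
Qed.

Let kappa := (2 `^ p * W' `^ (p - 1))^-1.

Let kappa0 : 0 < kappa.
Proof. by rewrite invr_gt0; apply: mulr_gt0; exact: powR_gt0. Qed.

Let source_lower : {ae leb, forall s, 0 < s < A ->
  ((kappa * F s `^ p)%:E <= source_term theta q z A s)%E}.
Proof.
apply: ae_mono F_le_source => s hs sA; have {}hs := hs sA.
have := @source_term_ge0 R N theta htheta q z A s q0.
case E : (source_term theta q z A s) => [g| |] //; last by move=> _; rewrite leey.
rewrite !lee_fin => g0; rewrite mulrC; apply: young_lower_bound => // L L0.
by have := hs L L0; rewrite E -EFinM -EFinD lee_fin.
Qed.

Lemma heat_potential_decay_at : (heat_potential theta mu (past (A / 2) q) z A <=
  ((2 `^ (p + 1) / (1 - 2 `^ (1 - p))) `^ (p - 1)^-1 * A `^ (- (p - 1)^-1) * W')%:E)%E.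
Proof.
have p1 : 0 < p - 1 by rewrite subr_gt0.
have hA0 := A0; have A2 : A / 2 <= A by lra.
rewrite FE// lee_fin.
(* [F] is bounded by [F A], finite by [finA]; this is what excludes blow-up before [A]. *)
have hb := @blowup_bound R p kappa A (F A) F hp kappa0.
have {}hb : kappa * (A - A / 2) * F (A / 2) `^ (p - 1) <= (1 - 2 `^ (1 - p))^-1.
  apply: hb; last by lra.
    move=> s /andP[s0 sA]; rewrite F0/=; apply: F_le => //; exact: ltW.
  move=> s t s0 st tA; have tA' := ltW tA; have st' := ltW st.
  rewrite -lee_fin -FE// EFinD -FE; last exact: le_trans tA'.
  rewrite -mulrA [(t - s) * _]mulrC.
  apply: heat_potential_increment => //.
    by apply: mulr_ge0; [exact: ltW|exact: powR_ge0].
  apply: ae_mono source_lower => r hr /andP[sr rt].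
  apply: le_trans (hr _); last by rewrite (lt_le_trans s0 sr) (lt_trans rt tA).
  rewrite lee_fin; apply: ler_wpM2l; first exact: ltW.
  apply: ge0_ler_powR; rewrite ?nnegrE; [exact: ltW|exact: F0|exact: F0|].
  by apply: F_le => //; apply: ltW; exact: lt_trans tA.
set c := (1 - 2 `^ (1 - p))^-1 in hb *.
have c0 : 0 < c.
  by rewrite invr_gt0 subr_gt0; exact: powR2_lt1.
(* In [2 ^ (p + 1)] the power [2 ^ p] comes from [kappa] and the remaining 2 from the elapsed time
   [A / 2]. *)
have hF : F (A / 2) `^ (p - 1) <= 2 `^ (p + 1) * c * A^-1 * W' `^ (p - 1).
  have -> : 2 `^ (p + 1) = 2 * 2 `^ p :> R.
    rewrite addrC powRD; last by apply/implyP => _; rewrite pnatr_eq0.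
    by rewrite powRr1.
  have aux (D B c1 A1 f : R) : 0 < D -> 0 < B -> 0 < A1 ->
      (D * B)^-1 * (A1 - A1 / 2) * f <= c1 -> f <= 2 * D * c1 * A1^-1 * B.
    move=> D0 B0 A10; have DB0 : 0 < D * B by exact: mulr_gt0.
    rewrite -mulrA ler_pdivrMl// => h.
    rewrite (_ : 2 * D * c1 * A1^-1 * B = (D * B * c1) / (A1 / 2)); last first.
      by field; lra.
    by rewrite ler_pdivlMr; lra.
  exact: (aux _ _ _ _ _ (powR_gt0 _ _) (powR_gt0 _ _) A0 hb).
apply: (powR_root_le p1 (F0 _) _ A0 (ltW W'0) hF).
by apply: mulr_ge0; [exact: powR_ge0|exact: ltW].
Qed.

End one_point.

Lemma heat_potential_decay : exists2 C, 0 < C & forall T mu w z A,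
  supersolution T mu w -> 0 < A <= T ->
  (heat_potential theta mu (weighted_power w) z A < +oo)%E ->
  (heat_potential theta mu (past (A / 2) (weighted_power w)) z A <=
   (C * A `^ (- (p - 1)^-1) * (enorm z + A `^ theta^-1) `^ a)%:E)%E.
Proof.
have p1 : 0 < p - 1 by rewrite subr_gt0.
have a0 : 0 < a by exact: divr_gt0.
(* The restriction on [gamma] is exactly the finiteness of the kernel moment of order [a]. *)
have ath : theta < 2 -> a < theta by move=> /hfrac; rewrite ltr_pdivrMr.
have [W W0 hW] := @heat_kernel_weight_bound R N theta htheta a a0 ath.
exists ((2 `^ (p + 1) / (1 - 2 `^ (1 - p))) `^ (p - 1)^-1 * W).
  apply: mulr_gt0 => //; apply: powR_gt0; apply: divr_gt0; first exact: powR_gt0.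
  by rewrite subr_gt0; exact: powR2_lt1.
move=> T mu w z A hw /andP[A0 AT] fin.
apply: le_trans (heat_potential_decay_at W0 hW hw A0 AT fin) _.
rewrite lee_fin le_eqVlt; apply/orP; left; apply/eqP.
by rewrite mulrA; congr (_ * _); rewrite mulrAC.
Qed.

End supersolutions.

Lemma ae_exists_itv (R : realType) (P : R -> Prop) (a b : R) : a < b ->
  {ae @lebesgue_measure R, forall s, P s} -> exists2 s, a < s < b & P s.
Proof.
move=> ab [Z [mZ Z0 hZ]]; apply: contrapT => nP.
have abZ : `]a, b[%classic `<=` Z.
  move=> s /=; rewrite in_itv/= => sab; apply: hZ => /= Ps.
  by apply: nP; exists s.
have : (@lebesgue_measure R `]a, b[%classic <= @lebesgue_measure R Z)%E.
  by apply: le_measure; rewrite ?inE//; exact: measurable_itv.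
rewrite Z0 lebesgue_measure_itv/= lte_fin ab -EFinB lee_fin.
by rewrite leNgt subr_gt0 ab.
Qed.

(** * First claim: from the potential to the mass of balls *)

Section initial_trace.
Context (R : realType) (N : nat) (theta gamma p : R).
Hypotheses (htheta : 0 < theta <= 2) (hN : (1 <= N)%N).
Hypotheses (hp : 1 < p) (hgamma : 0 < gamma).
Hypothesis hfrac : theta < 2 -> gamma < theta * (p - 1).
Local Notation lam := (lebesgueN R N).
Local Notation leb := (@lebesgue_measure R).
Local Notation X := (N.-tuple R).
Local Notation a := (gamma / (p - 1)).
Implicit Types (mu : {sigma_finite_measure set X -> \bar R}).
Implicit Types (x y z : X) (s t r A T : R).
Implicit Type w : X * measurableTypeR R -> R.

Let P0 y t : 0 <= heat_pos theta y t.
Proof. exact: heat_pos_ge0. Qed.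

Let th0 : 0 < theta. Proof. by case/andP : htheta. Qed.

Lemma ge0_integral_cst_indic d (S : measurableType d) (m : {measure set S -> \bar R})
    (c : R) (D : set S) : measurable D -> 0 <= c ->
  (\int[m]_x (c * \1_D x)%:E = c%:E * m D)%E.
Proof.
move=> mD c0; under eq_integral do rewrite EFinM.
rewrite ge0_integralZl//; last by apply/measurable_EFinP; exact: measurable_indic.
by rewrite integral_indic// setIT.
Qed.

Lemma integral_cube_indic z (r c : R) : 0 <= r -> 0 <= c ->
  (\int[lam]_x (c * \1_(cube z r) x)%:E = (c * (2 * r) ^+ N)%:E)%E.
Proof.
move=> r0 c0; rewrite EFinM -(lebesgueN_cube z r0).
by apply: ge0_integral_cst_indic => //; exact: measurable_cube.
Qed.

Lemma enorm_le_cube z x r : 0 <= r -> cube z r x ->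
  enorm x <= N%:R * (N%:R * r + enorm z).
Proof.
move=> r0 zx; have -> : x = affine 1 z (vsub x z).
  by apply: eq_from_tnth => i; rewrite !tnth_mktuple; ring.
apply: le_trans (enorm_affine_le _ _ _) _.
apply: ler_wpM2l => //; rewrite normr1 mul1r; apply: lerD => //.
apply: le_trans (enorm_le_sum _) _.
apply: (@le_trans _ _ (\sum_(i < N) r)).
  by apply: ler_sum => i _; rewrite tnth_mktuple; exact: zx.
by rewrite big_const_ord iter_addr_0 mulr_natl.
Qed.

(* Fubini on [cube z (2 rho)]: every [y] of the ball lies in a cube of side of
   order [rho] on which the kernel is at least of order [rho^-N]. *)
Lemma initial_mass_le : exists2 c, 0 < c & forall mu z rho sigma B,
  0 < rho -> rho <= sigma -> 0 <= B ->
  {ae lam, forall x, cube z (2 * sigma) x ->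
     (\int[mu]_y (heat_pos theta (vsub x y) (rho `^ theta))%:E <= B%:E)%E} ->
  (mu (eball z sigma) <= (c * sigma ^+ N * B)%:E)%E.
Proof.
have [[d1 d2] /= [d10 d20] hd] := @heat_kernel_lower_bound R N theta htheta.
(* [d <= 1] keeps the small cubes around points of the ball inside [cube z (2 * sigma)]. *)
pose d := Num.min d1 1; have d0 : 0 < d by rewrite lt_min d10 ltr01.
have dN : 0 < (2 * d) ^+ N by apply: exprn_gt0; apply: mulr_gt0.
exists (4 ^+ N / (d2 * (2 * d) ^+ N)).
  by apply: divr_gt0; [exact: exprn_gt0|exact: mulr_gt0].
move=> mu z rho sigma B r0 rs B0 hB.
have s0 : 0 < sigma by exact: lt_le_trans rs.
pose t := rho `^ theta; have t0 : 0 < t by exact: powR_gt0.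
pose K := cube z (2 * sigma); have mK : measurable K by exact: measurable_cube.
pose f x y : \bar R := (\1_K x * heat_pos theta (vsub x y) t)%:E.
have f0 x y : (0 <= f x y)%E by rewrite lee_fin; exact: mulr_ge0.
have mI : measurable_fun setT (\1_K : X -> R) by exact: measurable_indic.
have mf : measurable_fun setT (fun v => f v.1 v.2) by rewrite /f; measurability.
have upper : (\int[lam]_x \int[mu]_y f x y <= (B * (4 * sigma) ^+ N)%:E)%E.
  have -> : (B * (4 * sigma) ^+ N)%:E = (\int[lam]_x (B * \1_K x)%:E)%E.
    have s2 : 0 <= 2 * sigma by apply: mulr_ge0 => //; exact: ltW.
    rewrite (integral_cube_indic z s2 B0) mulrA -natrM.
    by [].
  apply: ae_ge0_le_integral => //.
  - by move=> x _; exact: integral_ge0.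
  - exact: (@measurable_ge0_integral _ _ _ _ R mu f mf f0).
  - by move=> x _; rewrite lee_fin; exact: mulr_ge0.
  - by apply/measurable_EFinP; apply: measurable_funM => //; exact: measurable_cst.
  apply: ae_mono hB => x hx _.
  have [xK|xK] := boolP (x \in K).
    rewrite indicE xK mulr1; apply: le_trans (hx (set_mem xK)).
    by apply: ge0_le_integral_nomeas => y _ //; rewrite /f indicE xK mul1r.
  have -> : (\int[mu]_y f x y = 0)%E.
    by apply: integral0_eq => y _; rewrite /f indicE (negbTE xK) mul0r.
  by rewrite lee_fin; exact: mulr_ge0.
have lower : ((d2 * (2 * d) ^+ N)%:E * mu (eball z sigma) <=
    \int[lam]_x \int[mu]_y f x y)%E.
  rewrite (ge0_integral_swap lam mu mf f0).
  rewrite -ge0_integral_cst_indic; last 2 first.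
  - exact: measurable_eball.
  - by apply: mulr_ge0; exact: ltW.
  apply: ge0_le_integral_nomeas => y _.
    by rewrite lee_fin; apply: mulr_ge0 => //; apply: mulr_ge0; exact: ltW.
  rewrite indicE; case: (boolP (y \in _)) => yB; last by rewrite mulr0; exact: integral_ge0.
  rewrite mulr1.
  have drho : 0 <= d * rho by apply: mulr_ge0; exact: ltW.
  have -> : (d2 * (2 * d) ^+ N)%:E =
      (\int[lam]_x ((d2 * rho ^- N) * \1_(cube y (d * rho)) x)%:E)%E.
    rewrite integral_cube_indic//; last first.
      by apply: mulr_ge0; [exact: ltW|rewrite invr_ge0 exprn_ge0// ltW].
    congr EFin; rewrite !exprMn; have : rho ^+ N != 0 by rewrite expf_neq0// gt_eqF.
    by move: (rho ^+ N) (2 ^+ N) (d ^+ N) => x1 x2 x3 h; field.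
  apply: ge0_le_integral_nomeas => x _.
    rewrite lee_fin; apply: mulr_ge0 => //.
    by apply: mulr_ge0; [exact: ltW|rewrite invr_ge0 exprn_ge0// ltW].
  rewrite [\1_(cube y _) x]indicE; case: (boolP (x \in _)) => [|_]; last by rewrite mulr0.
  rewrite inE => xy; have xK : K x.
    move=> i; have yz : cube z sigma y by apply: eball_cube; exact: set_mem.
    have -> : tnth x i - tnth z i = (tnth x i - tnth y i) + (tnth y i - tnth z i) by ring.
    apply: le_trans (ler_normD _ _) _; rewrite [leRHS](_ : _ = sigma + sigma); last by ring.
    apply: lerD; last exact: yz.
    apply: le_trans (xy i) _; apply: le_trans rs; rewrite ger_pMl//.
    by rewrite ge_min lexx orbT.
  rewrite mulr1 /f indicE mem_set// mul1r lee_fin (heat_posE _ _ t0).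
  apply: hd => // i; rewrite tnth_mktuple; apply: le_trans (xy i) _.
  by apply: ler_wpM2r; [exact: ltW|rewrite ge_min lexx].
have := le_trans lower upper.
rewrite -lee_pdivlMl; last exact: mulr_gt0.
move=> h; apply: le_trans h _; rewrite -EFinM lee_fin le_eqVlt.
apply/orP; left; apply/eqP; rewrite [(4 * sigma) ^+ N]exprMn.
by move: (d2 * _)^-1 (4 ^+ N) (sigma ^+ N) => x1 x2 x3; ring.
Qed.

(** The decay bound needs a finite potential, available at almost every point of almost every slice;
    so [A] is picked between [(sigma / 2) ^ theta] and [sigma ^ theta], and almost every point of
    the cube is used. *)
Lemma initial_mass_decay : exists2 C, 0 < C & forall T mu w z sigma,
  0 < T -> supersolution theta gamma p T mu w -> 0 < sigma < T `^ theta^-1 ->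
  (mu (eball z sigma) <=
   (C * sigma `^ (N%:R - theta / (p - 1)) * (enorm z + sigma) `^ a)%:E)%E.
Proof.
have p1 : 0 < p - 1 by rewrite subr_gt0.
have a0 : 0 < a by exact: divr_gt0.
have [c c0 hc] := initial_mass_le.
have [C C0 hC] := @heat_potential_decay R N theta gamma p htheta hN hp hgamma hfrac.
have N1 : 1 <= N%:R :> R by rewrite ler1n.
(* [K] bounds [enorm x + rho] by a multiple of [enorm z + sigma] on the cube of half-side
   [2 * sigma]: [enorm_le_cube] gives the first term, [rho <= sigma] the 1. *)
pose K : R := N%:R * (N%:R * 2) + 1.
have K0 : 0 < K by rewrite /K; nra.
exists (c * (C * 2 `^ (theta / (p - 1)) * K `^ a)).
  by repeat (apply: mulr_gt0 => //); exact: powR_gt0.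
move=> T mu w z sigma T0 hw /andP[s0 sT].
have th1 : 0 <= theta^-1 by rewrite invr_ge0 ltW.
have hab : (sigma / 2) `^ theta < sigma `^ theta.
  by apply: gt0_ltr_powR => //; rewrite ?nnegrE; lra.
have [A /andP[A1 A2] hA] := ae_exists_itv hab (supersolution_slices hw).
have A0 : 0 < A by apply: le_lt_trans A1; exact: powR_ge0.
have sT' : sigma `^ theta < T.
  have -> : T = (T `^ theta^-1) `^ theta by rewrite -powRrM mulVf ?gt_eqF// powRr1// ltW.
  by apply: gt0_ltr_powR => //; rewrite ?nnegrE ?powR_ge0// ltW.
have AT : A < T by exact: lt_trans sT'.
have {}hA := hA (introT andP (conj A0 AT)).
pose rho := A `^ theta^-1.
have rho0 : 0 < rho by exact: powR_gt0.
have rhoA : rho `^ theta = A by rewrite -powRrM mulVf ?gt_eqF// powRr1// ltW.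
have rs : rho <= sigma.
  have -> : sigma = (sigma `^ theta) `^ theta^-1.
    by rewrite -powRrM mulfV ?gt_eqF// powRr1// ltW.
  by apply: ge0_ler_powR; rewrite ?nnegrE ?powR_ge0// ltW.
pose D := (sigma / 2) `^ theta `^ (- (p - 1)^-1).
have D0 : 0 <= D by exact: powR_ge0.
have hD : A `^ (- (p - 1)^-1) <= D.
  have Q1 : 0 < (sigma / 2) `^ theta by apply: powR_gt0; lra.
  rewrite /D !powRN lef_pV2; last 2 first.
  - by rewrite posrE; exact: powR_gt0.
  - by rewrite posrE; exact: powR_gt0.
  by apply: ge0_ler_powR; rewrite ?nnegrE ?powR_ge0 ?invr_ge0//; exact: ltW.
have zs0 : 0 <= enorm z + sigma by apply: addr_ge0; [exact: enorm_ge0|exact: ltW].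
pose B := C * D * (K `^ a * (enorm z + sigma) `^ a).
have B0 : 0 <= B.
  by apply: mulr_ge0; apply: mulr_ge0; rewrite ?powR_ge0//; exact: ltW.
have hB : {ae lam, forall x, cube z (2 * sigma) x ->
    (\int[mu]_y (heat_pos theta (vsub x y) (rho `^ theta))%:E <= B%:E)%E}.
  rewrite rhoA; apply: ae_mono hA => x hx zx.
  (* The initial term is part of the potential with the source stopped at [A / 2], to which the
     decay bound applies. *)
  apply: (@le_trans _ _ (heat_potential theta mu (past (A / 2) (weighted_power gamma p w)) x A)).
    rewrite leeDl//; apply: integral_ge0 => r _; apply: source_term_ge0 => //.
    by apply: past_ge0; exact: weighted_power_ge0.
  have fin : (heat_potential theta mu (weighted_power gamma p w) x A < +oo)%E.
    by apply: le_lt_trans hx _; rewrite ltry.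
  have A0T : 0 < A <= T by rewrite A0 ltW.
  apply: le_trans (hC T mu w x A hw A0T fin) _.
  rewrite lee_fin -/rho /B; apply: ler_pM.
  - by apply: mulr_ge0; [exact: ltW|exact: powR_ge0].
  - exact: powR_ge0.
  - by apply: ler_wpM2l; [exact: ltW|].
  rewrite -powRM//; last exact: ltW.
  have x0 := enorm_ge0 x; have z0 := enorm_ge0 z.
  apply: ge0_ler_powR; rewrite ?nnegrE; [exact: ltW|by lra| |].
    by apply: mulr_ge0 => //; exact: ltW.
  have := enorm_le_cube (_ : 0 <= 2 * sigma) zx => /(_ (mulr_ge0 (ler0n _ _) (ltW s0))).
  move: N1; rewrite /K; set n := N%:R => n1 h.
  apply: le_trans (lerD h rs) _.
  have n0 : 0 <= n by lra.
  have n2 : n <= n * n by nra.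
  have : n * enorm z <= n * n * enorm z by apply: ler_wpM2r.
  have : 0 <= n * n * enorm z by apply: mulr_ge0 => //; nra.
  have : 0 <= n * n * sigma by apply: mulr_ge0; [nra|exact: ltW].
  nra.
apply: le_trans (hc mu z rho sigma B rho0 rs B0 hB) _.
rewrite lee_fin le_eqVlt; apply/orP; left; apply/eqP.
rewrite /B /D -powRrM powR_divE//; last exact: ltW.
rewrite powRD; last by apply/implyP => _; rewrite gt_eqF.
rewrite powR_mulrn; last exact: ltW.
have -> : theta * - (p - 1)^-1 = - (theta / (p - 1)) by rewrite mulrN.
rewrite [2 `^ (- _)]powRN invrK.
move: (_ `^ a) (_ `^ a) (sigma ^+ N) (_ `^ _) (_ `^ _) => x1 x2 x3 x4 x5.
by ring.
Qed.

End initial_trace.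

(** * Radon measures are sigma-finite *)

Section radon_measures.
Context (R : realType) (N : nat).
Local Notation X := (N.-tuple R).
Variable mu : {measure set X -> \bar R}.
Hypothesis rmu : radon_measure mu.

Lemma radon_cube_fin z r : (mu (cube z r) < +oo)%E.
Proof.
apply: rmu; rewrite /tuple_compact.
have cI (i : 'I_N) : compact `[(tnth z i - r), (tnth z i + r)]%classic.
  exact: segment_compact.
have := rV_compact cI; congr compact; apply/seteqP; split => [v /= hv|_ /= [x zx <-]].
  exists [tuple v ord0 i | i < N]; last by apply/rowP => i; rewrite mxE tnth_mktuple.
  by rewrite cubeE /= => i; rewrite tnth_mktuple; exact: hv.
by move: zx; rewrite cubeE /= => h i; rewrite mxE; exact: h.
Qed.

Lemma radon_sigma_finite : sigma_finite setT mu.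
Proof.
exists (fun n => cube (@vzero R N) n%:R) => [|n]; last first.
  by split; [exact: measurable_cube|exact: radon_cube_fin].
apply/seteqP; split => // x _.
have [n hn] : exists n : nat, enorm x <= n%:R.
  by exists (Num.trunc (enorm x)).+1; apply: ltW; exact: truncnS_gt.
exists n => // i; rewrite tnth_mktuple subr0.
exact: le_trans (tnth_le_enorm x i) hn.
Qed.

(* [mu] with the structure of a sigma-finite measure *)
Definition radon_copy of radon_measure mu : set X -> \bar R := mu.

Let copy0 : radon_copy rmu set0 = 0%E.
Proof. exact: measure0. Qed.

Let copy_ge0 A : (0 <= radon_copy rmu A)%E.
Proof. exact: measure_ge0. Qed.

Let copy_sigma_additive : semi_sigma_additive (radon_copy rmu).
Proof. exact: measure_semi_sigma_additive. Qed.

HB.instance Definition _ := isMeasure.Build _ _ _ (radon_copy rmu)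
  copy0 copy_ge0 copy_sigma_additive.

HB.instance Definition _ := Measure_isSigmaFinite.Build _ _ _ (radon_copy rmu)
  radon_sigma_finite.

End radon_measures.

(** * Averages of powers of the norm over balls *)

Section weight_average.
Context (R : realType) (N : nat).
Hypothesis hN : (1 <= N)%N.
Local Notation lam := (lebesgueN R N).
Local Notation X := (N.-tuple R).
Implicit Types (x y z : X) (r a : R).

Let N0 : 0 < N%:R :> R. Proof. by rewrite ltr0n. Qed.

Lemma enorm_le_max_coord z : exists i : 'I_N, enorm z <= N%:R * `|tnth z i|.
Proof.
pose i0 : 'I_N := Ordinal hN.
pose i := [arg max_(i > i0) `|tnth z i|]%O.
exists i; apply: le_trans (enorm_le_sum z) _.
apply: (@le_trans _ _ (\sum_(j < N) `|tnth z i|)).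
  by apply: ler_sum => j _; rewrite /i; case: arg_maxP => // k _; apply.
by rewrite big_const_ord iter_addr_0 mulr_natl.
Qed.

(* [z] is shifted away from 0 along its largest coordinate. *)
Lemma eball_outer_cube z r : 0 < r -> exists z', cube z' (r / (8 * N%:R)) `<=`
  eball z r `&` [set x | (enorm z + r) / (4 * N%:R) <= enorm x].
Proof.
move=> r0; have [i hi] := enorm_le_max_coord z.
have n0 := N0; set n := N%:R in n0 hi *.
pose e := r / (2 * n); have e0 : 0 < e by apply: divr_gt0 => //; exact: mulr_gt0.
have re : r = 2 * n * e by rewrite /e mulrCA divff ?mulr1// gt_eqF// mulr_gt0.
have re4 : r / (8 * n) = e / 4 by rewrite re; field; rewrite gt_eqF.
pose sg : R := if 0 <= tnth z i then 1 else -1.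
(* A shift by [3 / 4 * e] with half-side [e / 4] moves coordinate [i] outwards by at least [e / 2],
   and no coordinate by more than [e]; since [e = r / (2 * N)], the ball is not left. *)
exists [tuple tnth z j + (if j == i then sg * (3 / 4 * e) else 0) | j < N] => x.
rewrite re4 => hx.
have hx' j : `|tnth x j - tnth z j - (if j == i then sg * (3 / 4 * e) else 0)| <= e / 4.
  by have := hx j; rewrite tnth_mktuple opprD addrA.
split=> /=.
  apply: (@le_lt_trans _ _ (n * e)); last by rewrite re; nra.
  apply: le_trans (enorm_le_sum _) _.
  apply: (@le_trans _ _ (\sum_(j < N) e)).
    apply: ler_sum => j _; rewrite tnth_mktuple distrC.
    have := hx' j; rewrite /sg !ler_norml.
    by case: (j == i); [case: ifP => _|]; move=> /andP[? ?]; apply/andP; split; lra.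
  by rewrite big_const_ord iter_addr_0 mulr_natl.
apply: (@le_trans _ _ `|tnth x i|); last exact: tnth_le_enorm.
rewrite ler_pdivrMr; last by apply: mulr_gt0.
have : `|tnth z i| + e / 2 <= `|tnth x i|.
  have := hx' i; rewrite eqxx /sg ler_norml; case: ifP => [zi|/negbT] /=.
    move=> /andP[h1 h2]; rewrite (ger0_norm zi); apply: le_trans (ler_norm _); lra.
  rewrite -ltNge => zi /andP[h1 h2]; rewrite (ltr0_norm zi) -normrN.
  by apply: le_trans (ler_norm _); lra.
have := normr_ge0 (tnth z i).
rewrite {1}re; set u := `|tnth x i|; set v := `|tnth z i| in hi * => v0 h.
apply: (@le_trans _ _ ((v + e / 2) * (4 * n))); first by nra.
by apply: ler_wpM2r => //; nra.
Qed.

(** On the cube of [eball_outer_cube] the integrand is already of order [(enorm z + r) ^ a], and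
    that cube fills at least the fraction [(8 * N) ^- N] of the cube enclosing the ball. *)
Lemma weight_average_ge a : 0 < a -> exists2 c, 0 < c & forall z r, 0 < r ->
  c * (enorm z + r) `^ a <= weight_average a z r.
Proof.
move=> a0; have n0 := N0.
have c10 : 0 < (4 * N%:R)^-1 :> R by rewrite invr_gt0 mulr_gt0.
exists ((4 * N%:R)^-1 `^ a * (8 * N%:R) ^- N).
  by apply: mulr_gt0; [exact: powR_gt0|rewrite invr_gt0 exprn_gt0// mulr_gt0].
move=> z r r0; have [z' hz'] := eball_outer_cube z r0.
have r8 : 0 < r / (8 * N%:R) by apply: divr_gt0 => //; exact: mulr_gt0.
set e := r / (8 * N%:R) in hz' r8.
have zr0 : 0 <= enorm z + r by apply: addr_ge0; [exact: enorm_ge0|exact: ltW].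
pose m := ((enorm z + r) / (4 * N%:R)) `^ a.
pose B := (N%:R * (N%:R * r + enorm z)) `^ a.
have mE := @measurable_eball R N z r.
have lamE : (lam (eball z r) <= ((2 * r) ^+ N)%:E)%E.
  rewrite -(lebesgueN_cube z (ltW r0)); apply: le_measure; rewrite ?inE//.
    exact: measurable_cube.
  exact: eball_cube.
have lamE0 : (((2 * e) ^+ N)%:E <= lam (eball z r))%E.
  rewrite -(lebesgueN_cube z' (ltW r8)); apply: le_measure; rewrite ?inE//.
    exact: measurable_cube.
  by move=> x /hz'[].
have finE : lam (eball z r) \is a fin_num.
  by rewrite ge0_fin_numE// (le_lt_trans lamE)// ltry.
(* The upper bound gives finiteness: a divergent integral would be turned into 0 by [Rintegral]. *)
have upI : (\int[lam]_(x in eball z r) (enorm x `^ a)%:E <= (B * (2 * r) ^+ N)%:E)%E.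
  rewrite -(integral_cube_indic z (ltW r0) (powR_ge0 _ _)) integral_mkcond.
  apply: ge0_le_integral_nomeas => x _; rewrite patchE; case: ifPn => // xE.
  - by rewrite lee_fin powR_ge0.
  - have xc : cube z r x by apply: eball_cube; exact: set_mem.
    rewrite indicE mem_set// mulr1 lee_fin; apply: ge0_ler_powR; rewrite ?nnegrE.
    + exact: ltW.
    + exact: enorm_ge0.
    + by apply: mulr_ge0 => //; apply: addr_ge0; [apply: mulr_ge0 => //; exact: ltW|exact: enorm_ge0].
    + by apply: enorm_le_cube xc; exact: ltW.
  - by rewrite lee_fin; apply: mulr_ge0 => //; exact: powR_ge0.
have lowI : ((m * (2 * e) ^+ N)%:E <= \int[lam]_(x in eball z r) (enorm x `^ a)%:E)%E.
  rewrite -(integral_cube_indic z' (ltW r8) (powR_ge0 _ _)) [leRHS]integral_mkcond.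
  apply: ge0_le_integral_nomeas => x _.
    by rewrite lee_fin; apply: mulr_ge0 => //; exact: powR_ge0.
  rewrite indicE; case: (boolP (x \in _)) => [|_].
    rewrite inE => /hz'[xE /= hx]; rewrite mulr1 patchE mem_set// lee_fin.
    apply: ge0_ler_powR; rewrite ?nnegrE//; first exact: ltW.
      by apply: mulr_ge0 => //; rewrite invr_ge0 mulr_ge0.
    exact: enorm_ge0.
  by rewrite mulr0 patchE; case: ifP => // _; rewrite lee_fin powR_ge0.
have finI : (\int[lam]_(x in eball z r) (enorm x `^ a)%:E)%E \is a fin_num.
  rewrite ge0_fin_numE; first by rewrite (le_lt_trans upI)// ltry.
  by apply: integral_ge0 => x _; rewrite lee_fin powR_ge0.
rewrite /weight_average /Rintegral.
have l1 : 0 < fine (lam (eball z r)).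
  rewrite -lte_fin fineK//; apply: lt_le_trans lamE0; rewrite lte_fin.
  by apply: exprn_gt0; exact: mulr_gt0.
have l2 : fine (lam (eball z r)) <= (2 * r) ^+ N by rewrite -lee_fin fineK.
rewrite ler_pdivlMr//.
apply: (@le_trans _ _ (m * (2 * e) ^+ N)); last first.
  by rewrite -lee_fin fineK.
apply: (@le_trans _ _ ((4 * N%:R)^-1 `^ a * (8 * N%:R) ^- N * (enorm z + r) `^ a * (2 * r) ^+ N)).
  apply: ler_wpM2l => //; apply: mulr_ge0; last exact: powR_ge0.
  by apply: mulr_ge0; [exact: powR_ge0|rewrite invr_ge0 exprn_ge0// mulr_ge0].
rewrite /m powRM; [|exact: zr0|exact: (ltW c10)].
have -> : (2 * e) ^+ N = (2 * r) ^+ N * (8 * N%:R) ^- N.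
  by rewrite -exprVn -exprMn /e mulrA.
rewrite le_eqVlt; apply/orP; left; apply/eqP.
have aux (x1 x2 x3 x4 : R) : x1 * x3 * x2 * x4 = x2 * x1 * (x4 * x3) by ring.
exact: aux.
Qed.

End weight_average.

(** * Concentration at the origin *)

Section concentration.
Context (R : realType) (N : nat) (theta gamma p : R).
Hypotheses (htheta : 0 < theta <= 2) (hN : (1 <= N)%N).
Hypotheses (hp : 1 < p) (hgamma : 0 < gamma).
Hypothesis hfrac : theta < 2 -> gamma < theta * (p - 1).
Hypothesis hcrit : N%:R * (p - 1) = theta - gamma.
Local Notation lam := (lebesgueN R N).
Local Notation leb := (@lebesgue_measure R).
Local Notation X := (N.-tuple R).
Local Notation a := (gamma / (p - 1)).
Implicit Types (mu : {sigma_finite_measure set X -> \bar R}).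
Implicit Types (x y z : X) (s t r A T tau sigma : R).
Implicit Type w q : X * measurableTypeR R -> R.

Let P0 y t : 0 <= heat_pos theta y t.
Proof. exact: heat_pos_ge0. Qed.

Let th0 : 0 < theta. Proof. by case/andP : htheta. Qed.

Let N0 : 0 < N%:R :> R. Proof. by rewrite ltr0n. Qed.

Let p1 : 0 < p - 1. Proof. by rewrite subr_gt0. Qed.

(** For [t / 2 <= s <= t] the lengths [s ^ theta^-1] and [t ^ theta^-1] agree up to the factor
    [2^-1 ^ theta^-1], so one pair of constants serves all these times. *)
Lemma heat_pos_lower_bound : exists2 ce : R * R, 0 < ce.1 /\ 0 < ce.2 <= 1 &
  forall t s x y, 0 < t -> t / 2 <= s <= t ->
  enorm x <= ce.2 * t `^ theta^-1 -> enorm y <= ce.2 * t `^ theta^-1 ->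
  ce.1 * t `^ (- (N%:R / theta)) <= heat_pos theta (vsub x y) s.
Proof.
have [[d c] /= [d0 c0] hd] := @heat_kernel_lower_bound R N theta htheta.
have th1 : 0 < theta^-1 by rewrite invr_gt0.
have q0 : 0 < (2 : R)^-1 `^ theta^-1 by apply: powR_gt0; rewrite invr_gt0.
(* Each of the two points may use half of the radius [d * rho] of the kernel bound. *)
pose e := Num.min (d / 2 * 2^-1 `^ theta^-1) 1.
have e0 : 0 < e by rewrite lt_min ltr01 andbT mulr_gt0// divr_gt0.
exists (c, e) => /=; first by rewrite c0 e0 ge_min lexx orbT.
move=> t s x y t0 /andP[ts st] hx hy.
have s0 : 0 < s by apply: lt_le_trans ts; exact: divr_gt0.
pose rho := s `^ theta^-1; have rho0 : 0 < rho by exact: powR_gt0.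
have tt0 : 0 < t `^ theta^-1 by exact: powR_gt0.
have rt : rho <= t `^ theta^-1.
  by apply: ge0_ler_powR; rewrite ?nnegrE//; exact: ltW.
have rt2 : 2^-1 `^ theta^-1 * t `^ theta^-1 <= rho.
  rewrite -powRM; [|by rewrite invr_ge0|exact: ltW].
  by apply: ge0_ler_powR; rewrite ?nnegrE; [exact: ltW|lra|exact: ltW|lra].
have sE : s = rho `^ theta by rewrite -powRrM mulVf ?gt_eqF// powRr1// ltW.
rewrite (heat_posE _ _ s0).
have h i : `|tnth (vsub x y) i| <= d * rho.
  rewrite tnth_mktuple; apply: le_trans (ler_normB _ _) _.
  have hxi := le_trans (tnth_le_enorm x i) hx.
  have hyi := le_trans (tnth_le_enorm y i) hy.
  apply: le_trans (lerD hxi hyi) _.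
  apply: (@le_trans _ _ (d * (2^-1 `^ theta^-1 * t `^ theta^-1))); last first.
    by apply: ler_wpM2l => //; exact: ltW.
  have he : e <= d / 2 * 2^-1 `^ theta^-1 by rewrite ge_min lexx.
  by have := ler_wpM2r (ltW tt0) he; clearbody e; lra.
have := hd rho (vsub x y) rho0 h; rewrite -sE; apply: le_trans.
apply: ler_wpM2l; first exact: ltW.
have -> : t `^ (- (N%:R / theta)) = (t `^ theta^-1) ^- N.
  by rewrite powRN mulrC powRrM powR_mulrn// ltW.
rewrite lef_pV2 ?posrE ?exprn_gt0//.
by apply: lerXn2r; rewrite ?nnegrE//; exact: ltW.
Qed.

Lemma ae_exists_cube (Q : X -> Prop) z r : 0 < r ->
  {ae lam, forall x, Q x} -> exists2 x, cube z r x & Q x.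
Proof.
move=> r0 [Z [mZ Z0 hZ]]; apply: contrapT => nQ.
have cZ : cube z r `<=` Z.
  by move=> x xz; apply: hZ => /= Qx; apply: nQ; exists x.
have : (lam (cube z r) <= lam Z)%E.
  by apply: le_measure; rewrite ?inE//; exact: measurable_cube.
rewrite Z0 (lebesgueN_cube z (ltW r0)) lee_fin leNgt.
by rewrite exprn_gt0// mulr_gt0.
Qed.

Lemma enorm_le_cube0 x r : cube (@vzero R N) (r / N%:R) x -> enorm x <= r.
Proof.
move=> hx; apply: le_trans (enorm_le_sum x) _.
apply: (@le_trans _ _ (\sum_(i < N) (r / N%:R))).
  by apply: ler_sum => i _; have := hx i; rewrite tnth_mktuple subr0.
by rewrite big_const_ord iter_addr_0 -[(r / _) *+ _]mulr_natr divfK// gt_eqF.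
Qed.

Definition slice_mass q r : \bar R := (\int[lam]_y (q (y, r))%:E)%E.

Lemma slice_mass_ge0 q r : (forall v, 0 <= q v) -> (0 <= slice_mass q r)%E.
Proof. by move=> q0; apply: integral_ge0 => y _; rewrite lee_fin. Qed.

Lemma measurable_slice_mass q : measurable_fun setT q -> (forall v, 0 <= q v) ->
  measurable_fun setT (slice_mass q).
Proof.
move=> mq q0; apply: (@measurable_ge0_integral _ _ _ _ R lam
  (fun (r : measurableTypeR R) y => (q (y, r))%:E)).
  by cbv beta; measurability.
by move=> r y; rewrite lee_fin.
Qed.

Definition cumulative_mass (m : \bar R) q tau : \bar R :=
  (m + \int[leb]_r (if (r < tau)%R then slice_mass q r else 0))%E.

Lemma cumulative_mass_ge0 m q tau : (0 <= m)%E -> (forall v, 0 <= q v) ->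
  (0 <= cumulative_mass m q tau)%E.
Proof.
move=> m0 q0; apply: adde_ge0 => //; apply: integral_ge0 => r _.
by case: ifP => // _; exact: slice_mass_ge0.
Qed.

Lemma cumulative_mass_increment m q s t c : measurable_fun setT q ->
  (forall v, 0 <= q v) -> s <= t -> 0 <= c ->
  {ae leb, forall r, s <= r < t -> (c%:E <= slice_mass q r)%E} ->
  (cumulative_mass m q s + (c * (t - s))%:E <= cumulative_mass m q t)%E.
Proof.
move=> mq q0 st c0 hc; rewrite /cumulative_mass -addeA; apply: leeD2l.
apply: cumulative_increment => //; first exact: measurable_slice_mass.
by move=> r; exact: slice_mass_ge0.
Qed.

Lemma cumulative_mass_le m q s t : measurable_fun setT q ->
  (forall v, 0 <= q v) -> s <= t ->
  (cumulative_mass m q s <= cumulative_mass m q t)%E.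
Proof.
move=> mq q0 st.
have := @cumulative_mass_increment m q s t 0 mq q0 st (lexx _).
rewrite mul0r adde0; apply.
by apply: aeW => r _; exact: slice_mass_ge0.
Qed.

(** In this region two points at comparable times are joined by a kernel of full size, of order
    t^(-N / theta). *)
Definition parabolic_source eta t0 q (v : X * measurableTypeR R) : R :=
  if (t0 < v.2) && (enorm v.1 <= eta * v.2 `^ theta^-1) then q v else 0.

Lemma parabolic_source_ge0 eta t0 q : (forall v, 0 <= q v) ->
  forall v, 0 <= parabolic_source eta t0 q v.
Proof. by move=> q0 v; rewrite /parabolic_source; case: ifP. Qed.

Lemma measurable_parabolic_source eta t0 q : measurable_fun setT q ->
  measurable_fun setT (parabolic_source eta t0 q).
Proof.
move=> mq; apply: (@measurable_fun_ifT _ _ _ _ q (fun=> 0)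
  (fun v : X * measurableTypeR R => (t0 < v.2) && (enorm v.1 <= eta * v.2 `^ theta^-1))) => //.
apply: measurable_and.
  exact: measurable_fun_ltr.
by apply: measurable_fun_ler; measurability.
Qed.

Section parabolic_region.
Variables (c eta : R).
Hypotheses (c0 : 0 < c) (eta0 : 0 < eta) (eta1 : eta <= 1).
Hypothesis hG : forall t s x y, 0 < t -> t / 2 <= s <= t ->
  enorm x <= eta * t `^ theta^-1 -> enorm y <= eta * t `^ theta^-1 ->
  c * t `^ (- (N%:R / theta)) <= heat_pos theta (vsub x y) s.

(** Sources before [t / 2] have elapsed time between [t / 2] and [t] and lie within
    [eta * t ^ theta^-1] of the origin, as does [x]; the kernel is bounded below there by a constant
    that leaves the integrals. The initial ball is treated alike, with elapsed time [t]. *)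
Lemma heat_potential_ge_cumulative mu q t0 t x : measurable_fun setT q ->
  (forall v, 0 <= q v) -> 0 < t0 -> t0 <= t -> enorm x <= eta * t `^ theta^-1 ->
  ((c * t `^ (- (N%:R / theta)))%:E *
     cumulative_mass (mu (eball (@vzero R N) (eta * t0 `^ theta^-1)))
       (parabolic_source eta t0 q) (t / 2) <=
   heat_potential theta mu (past (t / 2) q) x t)%E.
Proof.
move=> mq q0 t00 t0t hx.
have t0' : 0 < t by exact: lt_le_trans t0t.
pose k0 := parabolic_source eta t0 q.
have mk0 : measurable_fun setT k0 by exact: measurable_parabolic_source.
have k00 : forall v, 0 <= k0 v by exact: parabolic_source_ge0.
have powt r : 0 < r -> r <= t -> eta * r `^ theta^-1 <= eta * t `^ theta^-1.
  move=> r0 rt; apply: ler_wpM2l; first exact: ltW.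
  by apply: ge0_ler_powR; rewrite ?nnegrE ?invr_ge0//; exact: ltW.
have := hG t0'; set b := c * t `^ (- (N%:R / theta)) => hb.
have b0 : 0 <= b by apply: mulr_ge0; [exact: ltW|exact: powR_ge0].
rewrite /cumulative_mass ge0_muleDr//; last first.
  apply: integral_ge0 => r _; case: ifP => // _; exact: slice_mass_ge0.
apply: leeD.
  rewrite -ge0_integral_cst_indic//; last exact: measurable_eball.
  apply: ge0_le_integral_nomeas => y _.
    by rewrite lee_fin; exact: mulr_ge0.
  rewrite lee_fin indicE; case: (boolP (y \in _)) => [yB|_]; last by rewrite mulr0.
  rewrite mulr1; apply: hb => //; first by apply/andP; split; lra.
  apply: le_trans (powt t0 t00 t0t); apply: ltW.
  have := set_mem yB; rewrite /eball /=.
  rewrite (_ : enorm (vsub _ y) = enorm y)//.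
  have -> : vsub (@vzero R N) y = affine (-1) (@vzero R N) y by rewrite vsub_affine.
  by rewrite enorm_dilate normrN1 mul1r.
pose S r : \bar R := (if (r < t / 2)%R then slice_mass k0 r else 0)%E.
have mS : measurable_fun setT S.
  apply: (@measurable_fun_ifT _ _ _ _ (slice_mass k0) (fun=> 0%E) (fun r => r < t / 2)).
  - exact: measurable_fun_ltr.
  - exact: measurable_slice_mass.
  - exact: measurable_cst.
have S0 r : (0 <= S r)%E by rewrite /S; case: ifP => // _; exact: slice_mass_ge0.
have b0e : (0 <= b%:E)%E by rewrite lee_fin.
rewrite -(ge0_integralZl leb measurableT mS (fun r _ => S0 r) b0e).
apply: ge0_le_integral_nomeas => r _; first exact: mule_ge0.
rewrite source_term_past /S; case: ifPn => rt; last by rewrite mule0.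
have mkr : measurable_fun setT (fun y => (k0 (y, r))%:E) by measurability.
have kr0 y : setT y -> (0 <= (k0 (y, r))%:E)%E by rewrite lee_fin.
rewrite /slice_mass -(ge0_integralZl lam measurableT mkr kr0 b0e).
apply: ge0_le_integral_nomeas => y _.
  by rewrite -EFinM lee_fin; exact: mulr_ge0.
rewrite -EFinM lee_fin /k0 /parabolic_source /=.
case: ifPn => [/andP[tr hy]|_]; last by rewrite mulr0; exact: mulr_ge0.
apply: ler_wpM2r => //; apply: hb => //; first by apply/andP; split; lra.
by apply: le_trans hy (powt r _ _); lra.
Qed.

Let region_mass mu w t0 tau : \bar R :=
  cumulative_mass (mu (eball (@vzero R N) (eta * t0 `^ theta^-1)))
    (parabolic_source eta t0 (weighted_power gamma p w)) tau.

Let mk0 T mu w t0 : supersolution theta gamma p T mu w ->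
  measurable_fun setT (parabolic_source eta t0 (weighted_power gamma p w)).
Proof.
by move=> [mw _ _ _]; apply: measurable_parabolic_source; exact: measurable_weighted_power.
Qed.

Let k00 w t0 v : 0 <= parabolic_source eta t0 (weighted_power gamma p w) v.
Proof. by apply: parabolic_source_ge0; exact: weighted_power_ge0. Qed.

(** The potential at a point near the origin and at a time [A > 2 * tau] is bounded below by the
    mass and above by the decay bound. By [hcrit] the three powers of [A] cancel ([eE]), which
    leaves a bound uniform in time. *)
Lemma cumulative_mass_bounded : exists2 C2, 0 < C2 & forall T mu w t0 tau,
  supersolution theta gamma p T mu w -> 0 < t0 -> t0 <= 2 * tau -> 2 * tau < T ->
  (region_mass mu w t0 tau <= C2%:E)%E.
Proof.
have [C C0 hC] := @heat_potential_decay R N theta gamma p htheta hN hp hgamma hfrac.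
have a0 : 0 < a by exact: divr_gt0.
exists (c^-1 * (C * 2 `^ a)).
  by rewrite mulr_gt0 ?invr_gt0// mulr_gt0// powR_gt0.
move=> T mu w t0 tau hw t00 t0tau tauT.
have [A /andP[A1 A2] hA] := ae_exists_itv tauT (supersolution_slices hw).
have A0 : 0 < A by lra.
have {}hA := hA (introT andP (conj A0 A2)).
have S0 : 0 < A `^ theta^-1 by exact: powR_gt0.
have r0 : 0 < eta * A `^ theta^-1 / N%:R by rewrite divr_gt0// mulr_gt0.
have [x hx xA] := ae_exists_cube (@vzero R N) r0 hA.
have {}hx := enorm_le_cube0 hx.
have mq : measurable_fun setT (weighted_power gamma p w).
  by case: hw => mw _ _ _; exact: measurable_weighted_power.
have q0 := @weighted_power_ge0 R N gamma p w.
have fin : (heat_potential theta mu (weighted_power gamma p w) x A < +oo)%E.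
  by apply: le_lt_trans xA _; rewrite ltry.
have A0T : 0 < A <= T by rewrite A0 ltW.
have upper := hC T mu w x A hw A0T fin.
have t0A : t0 <= A by lra.
have lower := @heat_potential_ge_cumulative mu _ t0 A x mq q0 t00 t0A hx.
have tauA : tau <= A / 2 by lra.
apply: le_trans (cumulative_mass_le _ (mk0 _ hw) (@k00 w t0) tauA) _.
have := le_trans lower upper; rewrite -lee_pdivlMl; last first.
  by apply: mulr_gt0 => //; exact: powR_gt0.
move=> h; apply: le_trans h _; rewrite -EFinM lee_fin.
have xle : (enorm x + A `^ theta^-1) `^ a <= 2 `^ a * A `^ (a / theta).
  rewrite [a / theta]mulrC [A `^ (_ * _)]powRrM -powRM//; last exact: ltW.
  apply: ge0_ler_powR; rewrite ?nnegrE; [exact: ltW| | |].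
  - by apply: addr_ge0; [exact: enorm_ge0|exact: ltW].
  - by apply: mulr_ge0 => //; exact: ltW.
  - by have := ler_wpM2r (ltW S0) eta1; lra.
have eE : A `^ (N%:R / theta) * A `^ (- (p - 1)^-1) * A `^ (a / theta) = 1.
  rewrite -!powRD; try (by apply/implyP => _; rewrite gt_eqF).
  rewrite (_ : _ + _ = 0) ?powRr0//.
  have pn : p - 1 != 0 by rewrite gt_eqF.
  have tn : theta != 0 by rewrite gt_eqF.
  have := hcrit; move: (p - 1) pn => P Pn hP.
  have -> : N%:R = (theta - gamma) / P by rewrite -hP mulfK.
  by field; rewrite Pn tn.
rewrite invfM [A `^ (- (N%:R / theta))]powRN invrK.
apply: (@le_trans _ _ (c^-1 * A `^ (N%:R / theta) *
    (C * A `^ (- (p - 1)^-1) * (2 `^ a * A `^ (a / theta))))).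
  apply: ler_wpM2l; first by rewrite mulr_ge0 ?powR_ge0// invr_ge0 ltW.
  by apply: ler_wpM2l => //; rewrite mulr_ge0 ?powR_ge0// ltW.
rewrite le_eqVlt; apply/orP; left; apply/eqP.
have aux (x1 x2 x3 x4 x5 x6 : R) : x2 * x4 * x6 = 1 ->
    x1 * x2 * (x3 * x4 * (x5 * x6)) = x1 * (x3 * x5).
  by move=> h1; rewrite -[RHS]mulr1 -h1; ring.
exact: aux.
Qed.

(** On a ball of radius of order r^(1 / theta), [w] is at least of order r^(-N / theta) * e and the
    weight at least of order r^(-gamma / theta), while the volume is of order r^(N / theta). At
    critical [p] these combine to [e ^ p / r], the origin of the logarithm. *)
Lemma slice_mass_ge_power : exists2 c3, 0 < c3 & forall T mu w t0,
  supersolution theta gamma p T mu w -> 0 < t0 ->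
  {ae leb, forall r, t0 < r < T -> forall e, 0 <= e ->
    (e%:E <= region_mass mu w t0 (r / 2))%E ->
    ((c3 * e `^ p / r)%:E <=
     slice_mass (parabolic_source eta t0 (weighted_power gamma p w)) r)%E}.
Proof.
have p0 : 0 < p by have := hp; lra.
exists (eta `^ (- gamma) * c `^ p * (2 * eta / N%:R) ^+ N).
  rewrite mulr_gt0 ?exprn_gt0 ?divr_gt0 ?mulr_gt0 ?powR_gt0//.
move=> T mu w t0 hw t00.
have mq : measurable_fun setT (weighted_power gamma p w).
  by case: hw => mw _ _ _; exact: measurable_weighted_power.
have q0 := @weighted_power_ge0 R N gamma p w.
apply: ae_mono (supersolution_slices hw) => r hr /andP[t0r rT] e e0 he.
have r0 : 0 < r by exact: lt_trans t0r.
have {}hr := hr (introT andP (conj r0 rT)).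
pose S := r `^ theta^-1; have S0 : 0 < S by exact: powR_gt0.
pose b := c * r `^ (- (N%:R / theta)).
have b0 : 0 < b by rewrite mulr_gt0 ?powR_gt0.
pose m0 := (eta * S) `^ (- gamma) * (b * e) `^ p.
have m00 : 0 <= m0 by rewrite mulr_ge0 ?powR_ge0.
have eS0 : 0 < eta * S by exact: mulr_gt0.
have rN0 : 0 <= eta * S / N%:R by rewrite divr_ge0 ?ltW.
have -> : eta `^ (- gamma) * c `^ p * (2 * eta / N%:R) ^+ N * e `^ p / r =
    m0 * (2 * (eta * S / N%:R)) ^+ N.
  have -> : 2 * (eta * S / N%:R) = 2 * eta / N%:R * S by ring.
  rewrite [(2 * eta / N%:R * S) ^+ N]exprMn /m0 /b powRM ?(ltW eta0) ?(ltW S0)// powRM ?(ltW b0)//.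
  rewrite powRM ?(ltW c0) ?powR_ge0//.
  have -> : r^-1 = S `^ (- gamma) * (r `^ (- (N%:R / theta))) `^ p * S ^+ N.
    rewrite -powR_mulrn ?(ltW S0)// /S -!powRrM -!powRD;
      try (by apply/implyP => _; rewrite gt_eqF).
    rewrite -powR_inv1 ?(ltW r0)//; congr (_ `^ _).
    have tn : theta != 0 by rewrite gt_eqF.
    have := hcrit; move: (N%:R) => n hn.
    apply: (mulfI tn); rewrite !mulrDr mulrN1.
    have -> : theta * (theta^-1 * - gamma) + theta * (- (n / theta) * p) + theta * (theta^-1 * n)
      = - gamma - n * (p - 1) by field.
    by rewrite hn; ring.
  have aux (x1 x2 x3 x4 x5 x6 x7 : R) : x1 * x2 * x3 * x4 * (x5 * x6 * x7) =
    x1 * x5 * (x2 * x6 * x4) * (x3 * x7) by ring.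
  exact: aux.
rewrite -(integral_cube_indic (@vzero R N) rN0 m00).
apply: ae_ge0_le_integral => //.
- by move=> y _; rewrite lee_fin; exact: mulr_ge0.
- apply/measurable_EFinP; apply: measurable_funM; first exact: measurable_cst.
  by apply: measurable_indic; exact: measurable_cube.
- by move=> y _; rewrite lee_fin; exact: k00.
- have mk := mk0 t0 hw.
  by measurability.
move: (ae_enorm_gt0 R hN) hr; apply: filterS2 => y y0 hr _.
rewrite indicE lee_fin; case: (boolP (y \in _)) => [|_]; last by rewrite mulr0; exact: k00.
rewrite inE => /enorm_le_cube0 hy; rewrite mulr1 /parabolic_source /= t0r hy /=.
rewrite /weighted_power /=; apply: ler_pM; [exact: powR_ge0|exact: powR_ge0| |].
  rewrite !powRN lef_pV2 ?posrE ?powR_gt0//.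
  by apply: ge0_ler_powR; rewrite ?nnegrE//; exact: ltW.
have bw : b * e <= w (y, r).
  rewrite -lee_fin; apply: le_trans hr.
  have r2 : r / 2 <= r by lra.
  apply: le_trans (heat_potential_past_le htheta _ _ mq q0 r2).
  apply: le_trans (@heat_potential_ge_cumulative mu _ t0 r y mq q0 t00 (ltW t0r) hy).
  by rewrite EFinM; apply: lee_wpmul2l => //; rewrite lee_fin ltW.
apply: ge0_ler_powR; rewrite ?nnegrE ?(ltW p0)//.
  by rewrite mulr_ge0// ltW.
by case: hw.
Qed.

(** For [r] between [2 * tau] and [4 * tau] the mass at [r / 2] is at least that at [tau], hence at
    least [e]; integrating a rate of order [1 / r] over this block gives a constant free of
    [tau]. *)
Lemma cumulative_mass_step : exists2 c4, 0 < c4 & forall T mu w t0 tau e,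
  supersolution theta gamma p T mu w -> 0 < t0 -> t0 <= tau -> 4 * tau <= T ->
  0 <= e -> (e%:E <= region_mass mu w t0 tau)%E ->
  (region_mass mu w t0 tau + (c4 * e `^ p)%:E <= region_mass mu w t0 (4 * tau))%E.
Proof.
have [c3 c30 h3] := slice_mass_ge_power.
exists (c3 / 2); first by rewrite divr_gt0.
move=> T mu w t0 tau e hw t00 t0tau tauT e0 he.
have tau0 : 0 < tau by exact: lt_le_trans t0tau.
have mk := mk0 t0 hw.
have le2 : tau <= 2 * tau by lra.
have le4 : 2 * tau <= 4 * tau by lra.
pose c5 := c3 * e `^ p / (4 * tau).
have c50 : 0 <= c5 by rewrite divr_ge0 ?mulr_ge0 ?powR_ge0// ltW.
have -> : c3 / 2 * e `^ p = c5 * (4 * tau - 2 * tau).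
  by rewrite /c5; field; rewrite gt_eqF.
have h5 : {ae leb, forall r, 2 * tau <= r < 4 * tau -> (c5%:E <=
    slice_mass (parabolic_source eta t0 (weighted_power gamma p w)) r)%E}.
  apply: ae_mono (h3 T mu w t0 hw t00) => r hr /andP[r1 r2].
  have hr' : t0 < r < T by apply/andP; split; lra.
  have rtau : tau <= r / 2 by lra.
  have {}hr := hr hr' e e0 (le_trans he (cumulative_mass_le _ mk (@k00 w t0) rtau)).
  apply: le_trans hr; rewrite lee_fin /c5; apply: ler_wpM2l.
    by rewrite mulr_ge0 ?powR_ge0// ltW.
  by rewrite lef_pV2 ?posrE; lra.
apply: le_trans (cumulative_mass_increment _ mk (@k00 w t0) le4 c50 h5).
by apply: leeD2r; exact: cumulative_mass_le.
Qed.

Lemma ball_mass_decay : exists2 D, 0 < D & forall T mu w t0 n,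
  supersolution theta gamma p T mu w -> 0 < t0 -> 2 * (4 ^+ n * t0) < T ->
  exists2 M, mu (eball (@vzero R N) (eta * t0 `^ theta^-1)) = M%:E &
    n%:R * M `^ (p - 1) <= D.
Proof.
have [C2 C20 h2] := cumulative_mass_bounded.
have [c4 c40 h4] := cumulative_mass_step.
have [D D0 hD] := discrete_decay p1 c40 C20.
(* Along the times [4 ^+ k * t0] each step of [discrete_decay], with exponent [p - 1], is one use of
   [cumulative_mass_step]; the mass of the ball is at most [E 0]. *)
exists D => // T mu w t0 n hw t00 nT.
pose tau k := 4 ^+ k * t0.
have tauS k : tau k.+1 = 4 * tau k by rewrite /tau exprS mulrA.
have tau_ge k : t0 <= tau k.
  by rewrite /tau ler_peMl ?(ltW t00)// exprn_ege1//; lra.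
have tau_le k : (k <= n)%N -> 2 * tau k < T.
  move=> kn; apply: le_lt_trans nT; apply: ler_wpM2l => //.
  by rewrite /tau; apply: ler_wpM2r; [exact: ltW|apply: ler_weXn2l => //; lra].
pose E k := region_mass mu w t0 (tau k).
have E0 k : (0 <= E k)%E by apply: cumulative_mass_ge0 => //; exact: k00.
have EC k : (k <= n)%N -> (E k <= C2%:E)%E.
  move=> kn; apply: (h2 T mu w t0 (tau k) hw t00 _ (tau_le k kn)).
  by have := tau_ge k; lra.
have Efin k : (k <= n)%N -> E k = (fine (E k))%:E.
  by move=> kn; rewrite fineK// ge0_fin_numE// (le_lt_trans (EC k kn))// ltry.
have ME : (mu (eball (@vzero R N) (eta * t0 `^ theta^-1)) <= E 0%N)%E.
  rewrite /E /region_mass /cumulative_mass leeDl//.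
  by apply: integral_ge0 => r _; case: ifP => // _; apply: slice_mass_ge0; exact: k00.
have Mfin : mu (eball (@vzero R N) (eta * t0 `^ theta^-1)) \is a fin_num.
  by rewrite ge0_fin_numE// (le_lt_trans ME)// (Efin 0%N)// ltry.
exists (fine (mu (eball (@vzero R N) (eta * t0 `^ theta^-1)))); first by rewrite fineK.
have M0 : 0 <= fine (mu (eball (@vzero R N) (eta * t0 `^ theta^-1))) by exact: fine_ge0.
have : n%:R * fine (E 0%N) `^ (p - 1) <= D.
  apply: (hD (fun k => fine (E k))) => k kn.
    by rewrite fine_ge0// -lee_fin -Efin ?EC.
  rewrite (_ : 1 + (p - 1) = p); last by ring.
  rewrite -lee_fin EFinD -!Efin//; last exact: ltnW.
  have -> : E k.+1 = region_mass mu w t0 (4 * tau k) by rewrite /E tauS.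
  apply: (h4 T mu w t0 (tau k)) => //.
  - by rewrite -tauS; have := tau_le k.+1 kn; have := tau_ge k.+1; lra.
  - by rewrite fine_ge0.
  - by rewrite -Efin//; exact: ltnW.
apply: le_trans; apply: ler_wpM2l => //.
apply: ge0_ler_powR; rewrite ?nnegrE ?(ltW p1) ?fine_ge0//.
by rewrite -lee_fin fineK// -Efin.
Qed.

End parabolic_region.

End concentration.

(** * Second claim: from the number of steps to the logarithm *)

Lemma ln_expR1D_le (R : realType) (theta eta T t0 sigma : R) n :
  0 < theta -> 0 < eta -> 0 < t0 -> 0 <= T -> sigma = eta * t0 `^ theta^-1 ->
  T <= 2 * (4 ^+ n * t0) ->
  ln (expR 1 + T `^ theta^-1 / sigma) <=
  (1 + ln (1 + eta^-1) + theta^-1 * ln 8) * n.+1%:R.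
Proof.
move=> th0 eta0 t00 T0 -> Tn.
have th1 : 0 < theta^-1 by rewrite invr_gt0.
have eta1 : 0 < eta^-1 by rewrite invr_gt0.
have S0 : 0 < t0 `^ theta^-1 by exact: powR_gt0.
(* [8 ^+ n.+1] is a single power dominating [2 * 4 ^+ n], so its logarithm is a multiple of
   [n.+1]. *)
pose Y : R := (8 ^+ n.+1) `^ theta^-1.
have e81 : 1 <= (8 : R) ^+ n.+1 by rewrite exprn_ege1// ler1n.
have Y1 : 1 <= Y.
  have -> : 1 = 1 `^ theta^-1 :> R by rewrite powR1.
  apply: ge0_ler_powR => //; [exact: ltW|by rewrite nnegrE|].
  by rewrite nnegrE exprn_ge0.
have XY : T `^ theta^-1 / (eta * t0 `^ theta^-1) <= eta^-1 * Y.
  rewrite ler_pdivrMr ?mulr_gt0//.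
  rewrite (_ : eta^-1 * Y * (eta * t0 `^ theta^-1) = Y * t0 `^ theta^-1); last first.
    by move: (t0 `^ _) => S; field; rewrite gt_eqF.
  rewrite /Y -powRM ?exprn_ge0 ?(ltW t00)//.
  apply: ge0_ler_powR; rewrite ?nnegrE ?(ltW th1)//.
    by rewrite mulr_ge0 ?exprn_ge0 ?(ltW t00).
  apply: le_trans Tn _; rewrite mulrA; apply: ler_wpM2r; first exact: ltW.
  rewrite exprS; apply: ler_pM => //; rewrite ?exprn_ge0//; first by rewrite ler_nat.
  by apply: lerXn2r; rewrite ?nnegrE// ler_nat.
have e1 : 1 <= expR 1 :> R by have := expR_ge1Dx (1 : R); lra.
have le1 : expR 1 + T `^ theta^-1 / (eta * t0 `^ theta^-1) <=
    expR 1 * (1 + eta^-1) * Y.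
  apply: le_trans (lerD (lexx _) XY) _.
  clear XY; move: (expR 1) e1 eta^-1 eta1 Y Y1 => E E1 F F0 Z Z1.
  have h1 : 0 <= (E - 1) * (F * Z) by rewrite mulr_ge0 ?mulr_ge0 ?subr_ge0//; lra.
  have h2 : 0 <= E * (Z - 1) by rewrite mulr_ge0 ?subr_ge0//; lra.
  by nra.
have X0 : 0 <= T `^ theta^-1 / (eta * t0 `^ theta^-1).
  by rewrite divr_ge0 ?powR_ge0// mulr_ge0 ?ltW.
apply: (@le_trans _ _ (ln (expR 1 * (1 + eta^-1) * Y))).
  rewrite ler_ln ?posrE//; first by rewrite ltr_wpDr// expR_gt0.
  by rewrite !mulr_gt0 ?expR_gt0 ?powR_gt0 ?exprn_gt0// addr_gt0.
have eta2 : 0 < 1 + eta^-1 by rewrite addr_gt0.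
rewrite !lnM ?posrE ?mulr_gt0 ?expR_gt0 ?powR_gt0 ?exprn_gt0//.
rewrite expRK ln_powR lnXn// -[_ *+ n.+1]mulr_natr mulrA.
rewrite [leRHS]mulrDl; apply: lerD => //; rewrite ler_peMr ?ler1n//.
by rewrite addr_ge0// ln_ge0// lerDl ltW.
Qed.

Section critical_decay.
Context (R : realType) (N : nat) (theta gamma p : R).
Hypotheses (htheta : 0 < theta <= 2) (hN : (1 <= N)%N).
Hypotheses (hp : 1 < p) (hgamma : 0 < gamma).
Hypothesis hfrac : theta < 2 -> gamma < theta * (p - 1).
Hypothesis hcrit : N%:R * (p - 1) = theta - gamma.
Implicit Types (mu : {sigma_finite_measure set (N.-tuple R) -> \bar R}).

Lemma critical_mass_decay : exists2 C, 0 < C & forall T mu w sigma,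
  0 < T -> supersolution theta gamma p T mu w -> 0 < sigma < T `^ theta^-1 ->
  (mu (eball (@vzero R N) sigma) <=
   (C * ln (expR 1 + T `^ theta^-1 / sigma) `^ (- (p - 1)^-1))%:E)%E.
Proof.
have th0 : 0 < theta by case/andP : htheta.
have p1 : 0 < p - 1 by rewrite subr_gt0.
have [C C0 hC] := @initial_mass_decay R N theta gamma p htheta hN hp hgamma hfrac.
have [[c eta] /= [c0 /andP[eta0 eta1]] hG] := @heat_pos_lower_bound R N theta htheta.
have [D D0 hD] :=
  @ball_mass_decay R N theta gamma p htheta hN hp hgamma hfrac hcrit c eta c0 eta0 eta1 hG.
pose K : R := 1 + ln (1 + eta^-1) + theta^-1 * ln 8.
(* The count is raised from the [m] steps of [ball_mass_decay] to [n.+1 = m.+2]; the two extra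
   terms, and the case [n = 0], are paid by the bound [C] on the mass. *)
pose D' : R := D + 2 * C `^ (p - 1).
have D'0 : 0 < D' by rewrite addr_gt0// mulr_gt0// powR_gt0.
have K0 : 0 < K.
  have h1 : 0 <= ln (1 + eta^-1) by rewrite ln_ge0// lerDl invr_ge0 ltW.
  have h2 : 0 <= theta^-1 * ln 8 by rewrite mulr_ge0 ?ln_ge0 ?ler1n// invr_ge0 ltW.
  by rewrite /K; lra.
exists ((D' * K) `^ (p - 1)^-1); first by rewrite powR_gt0// mulr_gt0.
move=> T mu w sigma T0 hw hs; have /andP[s0 sT] := hs.
(* The starting time for which the initial ball of the parabolic region has radius [sigma]. *)
pose t0 := (sigma / eta) `^ theta.
have se0 : 0 < sigma / eta by exact: divr_gt0.
have t00 : 0 < t0 by exact: powR_gt0.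
have sE : sigma = eta * t0 `^ theta^-1.
  rewrite /t0 -powRrM mulfV ?gt_eqF// powRr1 ?(ltW se0)//.
  by rewrite mulrC divfK// gt_eqF.
(* At [z = 0] the first claim carries the total power of [sigma] with exponent 0, by [hcrit]. *)
have MC : (mu (eball (@vzero R N) sigma) <= C%:E)%E.
  apply: le_trans (hC T mu w _ sigma T0 hw hs) _.
  rewrite enorm0 add0r -mulrA -powRD; last by apply/implyP => _; rewrite gt_eqF.
  have -> : N%:R - theta / (p - 1) + gamma / (p - 1) = 0; last by rewrite powRr0 mulr1.
  have pn : p - 1 != 0 by rewrite gt_eqF.
  apply: (mulIf pn); rewrite mul0r mulrDl mulrBl !divfK// hcrit.
  by rewrite addrAC subrK subrr.
have [n hn nmin] : exists2 n, T <= 2 * (4 ^+ n * t0) &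
    forall k, (k < n)%N -> 2 * (4 ^+ k * t0) < T.
  have ex : exists n, T <= 2 * (4 ^+ n * t0).
    have [k hk] : exists k : nat, T / t0 <= k%:R.
      by exists (Num.trunc (T / t0)).+1; apply: ltW; exact: truncnS_gt.
    exists k; move: hk; rewrite ler_pdivrMr// => hk; apply: le_trans hk _.
    rewrite mulrA; apply: ler_wpM2r; first exact: ltW.
    have k4 : k%:R <= 4 ^+ k :> R by rewrite -natrX ler_nat ltnW// ltn_expl.
    have : 0 <= 4 ^+ k :> R by exact: exprn_ge0.
    by move: (4 ^+ k) k4 => x; lra.
  exists (ex_minn ex); case: ex_minnP => // m _ hm k km.
  by rewrite ltNge; apply/negP => /hm; rewrite leqNgt km.
have [M ME Mn] : exists2 M, mu (eball (@vzero R N) sigma) = M%:E &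
    n.+1%:R * M `^ (p - 1) <= D'.
  have Mfin : mu (eball (@vzero R N) sigma) \is a fin_num.
    by rewrite ge0_fin_numE// (le_lt_trans MC)// ltry.
  have M0 : 0 <= fine (mu (eball (@vzero R N) sigma)) by exact: fine_ge0.
  have hMC : fine (mu (eball (@vzero R N) sigma)) `^ (p - 1) <= C `^ (p - 1).
    apply: ge0_ler_powR; rewrite ?nnegrE ?(ltW p1) ?(ltW C0)//.
    by rewrite -lee_fin fineK.
  exists (fine (mu (eball (@vzero R N) sigma))); first by rewrite fineK.
  have Cp0 : 0 < C `^ (p - 1) by exact: powR_gt0.
  case: n hn nmin => [_ _|m _ /(_ m (ltnSn m)) hm].
    by rewrite mul1r /D'; lra.
  have [M ME hM] := hD T mu w t0 m hw t00 hm.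
  move: ME; rewrite -sE => ME; move: hMC; rewrite ME /= => hMC.
  by rewrite -!natr1 /D'; lra.
have M0 : 0 <= M by rewrite -lee_fin -ME.
have L1 : 0 < ln (expR 1 + T `^ theta^-1 / sigma).
  have e1 : 1 < expR 1 :> R by have := expR_ge1Dx (1 : R); lra.
  apply: ln_gt0; apply: lt_le_trans e1 _.
  by rewrite lerDl divr_ge0 ?powR_ge0// ltW.
have LK := ln_expR1D_le th0 eta0 t00 (ltW T0) sE hn.
rewrite ME lee_fin -[leRHS]mulr1; apply: powR_root_le => //.
  by rewrite mulr_ge0 ?ltW.
rewrite powR1 mulr1 ler_pdivlMr// mulrC.
apply: (@le_trans _ _ (K * n.+1%:R * M `^ (p - 1))).
  by apply: ler_wpM2r => //; exact: powR_ge0.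
by rewrite -mulrA mulrC; apply: ler_wpM2r => //; exact: ltW.
Qed.

End critical_decay.

(** * Conclusion for solutions with Radon initial data *)

Theorem theorem1p1 (R : realType) (N : nat) (theta p gamma : R)
    (hN : (1 <= N)%N) (htheta : 0 < theta <= 2) (hp : 1 < p)
    (hgamma : 0 < gamma < Num.min theta N%:R)
    (hfrac : theta < 2 -> gamma < theta * (p - 1)) :
  (exists2 C1 : R, 0 < C1 &
    forall (T : R) (mu : {measure set (N.-tuple R) -> \bar R})
      (u : N.-tuple R * measurableTypeR R -> \bar R),
    0 < T -> radon_measure mu -> is_solution theta gamma p T mu u ->
    forall sigma : R, 0 < sigma < T `^ theta^-1 ->
    (ereal_sup (range (fun z : N.-tuple R =>
       ((weight_average (gamma / (p - 1)) z sigma)^-1)%:E *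
       mu (eball z sigma)))
     <= (C1 * sigma `^ (N%:R - theta / (p - 1)))%:E)%E) /\
  (p = 1 + (theta - gamma) / N%:R ->
   exists2 C1' : R, 0 < C1' &
    forall (T : R) (mu : {measure set (N.-tuple R) -> \bar R})
      (u : N.-tuple R * measurableTypeR R -> \bar R),
    0 < T -> radon_measure mu -> is_solution theta gamma p T mu u ->
    forall sigma : R, 0 < sigma < T `^ theta^-1 ->
    (mu (eball (@vzero R N) sigma) <=
     (C1' * ln (expR 1 + T `^ theta^-1 / sigma)
        `^ (- (N%:R / (theta - gamma))))%:E)%E).
Proof.
have /andP[gamma0 gmin] := hgamma.
have [gt gN] : gamma < theta /\ gamma < N%:R by move: gmin; rewrite lt_min => /andP[].
have p1 : 0 < p - 1 by rewrite subr_gt0.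
have a0 : 0 < gamma / (p - 1) by exact: divr_gt0.
split.
  have [C C0 hC] := @initial_mass_decay R N theta gamma p htheta hN hp gamma0 hfrac.
  have [c c0 hc] := weight_average_ge hN a0.
  exists (C / c); first exact: divr_gt0.
  move=> T mu u T0 rmu sol sigma hs; have /andP[s0 _] := hs.
  (* [radon_copy rmu] is [mu] itself, regarded as sigma-finite so that Tonelli applies to it. *)
  have [w hw] := @solution_supersolution R N theta gamma p htheta hp T (radon_copy rmu) u sol.
  apply: ub_ereal_sup => _ [z _ <-].
  have hz := hC T (radon_copy rmu) w z sigma T0 hw hs.
  have avg := hc z sigma s0.
  have zs0 : 0 < (enorm z + sigma) `^ (gamma / (p - 1)).
    by apply: powR_gt0; rewrite ltr_wpDl// enorm_ge0.
  have avg0 : 0 < weight_average (gamma / (p - 1)) z sigma.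
    by apply: lt_le_trans avg; exact: mulr_gt0.
  have avg1 : (0 <= ((weight_average (gamma / (p - 1)) z sigma)^-1)%:E)%E.
    by rewrite lee_fin invr_ge0 ltW.
  apply: le_trans (lee_wpmul2l avg1 hz) _.
  rewrite -EFinM lee_fin mulrC ler_pdivrMr//.
  set S := sigma `^ _; have S0 : 0 <= S by exact: powR_ge0.
  apply: (@le_trans _ _ (C / c * S * (c * (enorm z + sigma) `^ (gamma / (p - 1))))).
    rewrite le_eqVlt; apply/orP; left; apply/eqP.
    by move: (_ `^ _) => W; field; rewrite gt_eqF.
  by apply: ler_wpM2l => //; rewrite mulr_ge0// divr_ge0// ltW.
move=> pE.
have N0 : N%:R != 0 :> R by rewrite pnatr_eq0 -lt0n.
have hcrit : N%:R * (p - 1) = theta - gamma.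
  by rewrite pE addrC addKr mulrC divfK.
have [C C0 hC] := @critical_mass_decay R N theta gamma p htheta hN hp gamma0 hfrac hcrit.
exists C => // T mu u T0 rmu sol sigma hs.
have [w hw] := @solution_supersolution R N theta gamma p htheta hp T (radon_copy rmu) u sol.
have := hC T (radon_copy rmu) w sigma T0 hw hs.
(* By [hcrit], [(p - 1)^-1] equals [N / (theta - gamma)]. *)
by rewrite -hcrit invfM mulrA divff// mul1r.
Qed.
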